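(* Let $\phi$ be a compactly supported contactomorphism of $(\mathbb{R}^{2n+1},\xi=\ker(dz-y\,dx))$ which is positive, i.e. $\phi$ is the time-1 map of a compactly supported contact isotopy generated by a contact Hamiltonian that is positive in the interior of its support (and $\phi\neq \mathrm{id}$). Then $\phi$ has infinitely many non-trivial, geometrically distinct iterated translated points; that is, there are infinitely many distinct points $q\in\mathbb{R}^{2n+1}$ such that, for some integer $k\geq 1$, $q$ is a translated point of $\phi^k$ with nonzero contact action $\mathcal{A}_{\phi^k}(q)\neq 0$.
   Context: Coordinates on $\mathbb{R}^{2n+1}$ are $(x,y,z)$ with $x,y\in\mathbb{R}^n$, $z\in\mathbb{R}$, and $y\,dx=\sum_i y_i\,dx_i$; the contact form is $\alpha=dz-y\,dx$, whose Reeb vector field is $\partial/\partial z$. For a contactomorphism $\psi$ let $g_\psi$ be the function with $\psi^*\alpha=e^{g_\psi}\alpha$. A point $q$ is a translated point of $\psi$ if $\psi(q)$ and $q$ lie on the same Reeb orbit (i.e. $\psi(q)$ has the same $x,y$ coordinates as $q$) and $g_\psi(q)=0$. An iterated translated point of $\phi$ is a translated point of some iterate $\phi^k$, $k\ge1$. Writing $\psi=(\psi_1,\psi_2,\psi_3)$ in $(x,y,z)$ components, the contact action of a translated point $q=(x,y,z)$ of $\psi$ is $\mathcal{A}_\psi(q)=\psi_3(q)-z$; the translated point is non-trivial if $\mathcal{A}_\psi(q)\neq0$ (in particular it lies in the interior of the support). *)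

(* Defs.v *)
From Stdlib Require Import Reals Lra List Arith.
Open Scope R_scope.

(* A point of R^m is a function v : nat -> R with v i = 0 for i >= m.
   On R^{2n+1}: x_i = v i (i < n), y_i = v (n+i) (i < n), z = v (2n). *)
Definition inR (m : nat) (v : nat -> R) : Prop :=
  forall i, (m <= i)%nat -> v i = 0.

Definition trunc (m : nat) (w : nat -> R) : nat -> R :=
  fun i => if Nat.ltb i m then w i else 0.

Definition upd (v : nat -> R) (i : nat) (s : R) : nat -> R :=
  fun j => if Nat.eqb j i then v j + s else v j.

Definition near (m : nat) (v w : nat -> R) (d : R) : Prop :=
  forall i, (i < m)%nat -> Rabs (w i - v i) < d.

Definition cont (m : nat) (f : (nat -> R) -> R) : Prop :=
  forall v, inR m v -> forall eps, 0 < eps ->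
    exists d, 0 < d /\ forall w, inR m w -> near m v w d -> Rabs (f w - f v) < eps.

Fixpoint Ck (m k : nat) (f : (nat -> R) -> R) : Prop :=
  match k with
  | O => cont m f
  | S k' => cont m f /\
      forall i, (i < m)%nat -> exists g : (nat -> R) -> R,
        (forall v, inR m v -> derivable_pt_lim (fun s => f (upd v i s)) 0 (g v))
        /\ Ck m k' g
  end.

Definition smooth (m : nat) (f : (nat -> R) -> R) : Prop := forall k, Ck m k f.

Definition smooth_map (m : nat) (f : (nat -> R) -> (nat -> R)) : Prop :=
  (forall v, inR m v -> inR m (f v)) /\
  forall j, (j < m)%nat -> smooth m (fun v => f v j).

Fixpoint fsum (n : nat) (f : nat -> R) : R :=
  match n with O => 0 | S k => fsum k f + f k end.

(* coefficient of alpha = dz - y dx on the j-th coordinate vector at p *)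
Definition alpha_coef (n : nat) (p : nat -> R) (j : nat) : R :=
  if Nat.ltb j n then - p (n + j)%nat
  else if Nat.ltb j (2 * n) then 0 else 1.

(* psi^* alpha = e^g alpha, tested on each coordinate vector at each point *)
Definition conf_factor (n : nat) (psi : (nat -> R) -> (nat -> R)) (g : (nat -> R) -> R) : Prop :=
  forall p, inR (2 * n + 1) p -> forall j, (j < 2 * n + 1)%nat ->
    exists (dz : R) (dx : nat -> R),
      derivable_pt_lim (fun s => psi (upd p j s) (2 * n)%nat) 0 dz /\
      (forall i, (i < n)%nat ->
         derivable_pt_lim (fun s => psi (upd p j s) i) 0 (dx i)) /\
      dz - fsum n (fun i => psi p (n + i)%nat * dx i) = exp (g p) * alpha_coef n p j.

Definition contactomorphism (n : nat) (psi : (nat -> R) -> (nat -> R)) : Prop :=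
  smooth_map (2 * n + 1) psi /\
  (exists psi' : (nat -> R) -> (nat -> R),
     smooth_map (2 * n + 1) psi' /\
     (forall p, inR (2 * n + 1) p -> psi' (psi p) = p) /\
     (forall p, inR (2 * n + 1) p -> psi (psi' p) = p)) /\
  exists g, smooth (2 * n + 1) g /\ conf_factor n psi g.

Definition compactly_supported (n : nat) (psi : (nat -> R) -> (nat -> R)) : Prop :=
  exists B, forall p, inR (2 * n + 1) p ->
    (exists i, (i < 2 * n + 1)%nat /\ B < Rabs (p i)) -> psi p = p.

Definition closure (m : nat) (S : (nat -> R) -> Prop) (p : nat -> R) : Prop :=
  forall d, 0 < d -> exists w, inR m w /\ near m p w d /\ S w.

Definition interior (m : nat) (T : (nat -> R) -> Prop) (p : nat -> R) : Prop :=
  exists d, 0 < d /\ forall w, inR m w -> near m p w d -> T w.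

(* Phi : time -> map.  Joint smoothness in (t,p): time is coordinate 2n+1 of R^{2n+2}.
   (Smooth on all of R x R^{2n+1}; any smooth isotopy on [0,1] extends so, by Seeley.) *)
Definition contact_isotopy (n : nat) (Phi : R -> (nat -> R) -> (nat -> R)) : Prop :=
  (forall j, (j < 2 * n + 1)%nat ->
     smooth (2 * n + 2) (fun w => Phi (w (2 * n + 1)%nat) (trunc (2 * n + 1) w) j)) /\
  (forall p, inR (2 * n + 1) p -> Phi 0 p = p) /\
  (forall t, 0 <= t <= 1 -> contactomorphism n (Phi t)).

Definition isotopy_compactly_supported (n : nat) (Phi : R -> (nat -> R) -> (nat -> R)) : Prop :=
  exists B, forall t p, 0 <= t <= 1 -> inR (2 * n + 1) p ->
    (exists i, (i < 2 * n + 1)%nat /\ B < Rabs (p i)) -> Phi t p = p.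

(* H is the contact Hamiltonian of Phi: H_t(Phi_t p) = alpha(d/dt Phi_t p) *)
Definition generates (n : nat) (H : R -> (nat -> R) -> R) (Phi : R -> (nat -> R) -> (nat -> R)) : Prop :=
  forall t p, 0 <= t <= 1 -> inR (2 * n + 1) p ->
    exists (dz : R) (dx : nat -> R),
      derivable_pt_lim (fun s => Phi s p (2 * n)%nat) t dz /\
      (forall i, (i < n)%nat -> derivable_pt_lim (fun s => Phi s p i) t (dx i)) /\
      H t (Phi t p) = dz - fsum n (fun i => Phi t p (n + i)%nat * dx i).

Definition positive_hamiltonian (n : nat) (H : R -> (nat -> R) -> R) : Prop :=
  forall t p, 0 <= t <= 1 ->
    interior (2 * n + 1) (closure (2 * n + 1) (fun q => H t q <> 0)) p -> 0 < H t p.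

Definition positive_contactomorphism (n : nat) (phi : (nat -> R) -> (nat -> R)) : Prop :=
  exists Phi H, contact_isotopy n Phi /\ isotopy_compactly_supported n Phi /\
    generates n H Phi /\ positive_hamiltonian n H /\
    (forall p, inR (2 * n + 1) p -> Phi 1 p = phi p).

Definition translated_point (n : nat) (psi : (nat -> R) -> (nat -> R)) (q : nat -> R) : Prop :=
  inR (2 * n + 1) q /\
  (forall i, (i < 2 * n)%nat -> psi q i = q i) /\
  exists g, conf_factor n psi g /\ g q = 0.

Definition contact_action (n : nat) (psi : (nat -> R) -> (nat -> R)) (q : nat -> R) : R :=
  psi q (2 * n)%nat - q (2 * n)%nat.

(* Main.v *)
(* Write phi as a composition of contact maps psi_0, ..., psi_(N-1) that are C^1-small steps of
   the isotopy.  Each step has a generating function S_j, compactly supported and, by positivity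
   of the Hamiltonian, nonnegative.  The translated points of the composition are the critical
   points of
     F(z, X, P) = z_N - z_0,  z_(j+1) = z_j + P_j (X_j - X_(j-1)) + S_j (X_j, P_j, z_j),  z_0 = z,
   with cyclic index j, and critical values are contact actions.  F differs from the quadratic
   form sum_j P_j (X_j - X_(j-1)) by a bounded function, and a linking argument (resting on the
   Poincare-Miranda theorem) yields a minimax value, which is critical as soon as it is positive.
   Realizing phi, ..., phi^K in one configuration space (padding by trivial steps), the minimax
   values c_1 < ... < c_K are positive and strictly increasing: equality would give a critical
   point at which all S_j of the last period vanish, and such a point is fixed by phi, hence
   has action 0.
   If q is a translated point of phi^k and of phi^l with k < l, then phi^k q = q + c_k d/dz is
   a translated point of phi^(l-k) with action c_l - c_k <> 0.  So if finitely many q served all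
   k <= K, then q and the q + c_k d/dz would provide too many points for K large. *)

(* The obstacle is compactness. The quadratic form is degenerate: its kernel consists of the
   configurations with all [X_j] equal and all [P_j] equal, and it does not see [z], so almost
   critical configurations can escape to infinity. They do so only near that kernel, where every
   node has left the supports and the functional is the quadratic form itself, whose value is
   quadratically small in its gradient. Hence compactness fails at most at level 0, which is why
   positivity of the minimax value matters. No gradient flow is integrated. Two explicit bounded
   displacements lower a sublevel set, and bounded displacements preserve the class of maps over
   which the minimax is taken: those at bounded distance from a linear embedding. For this class the
   intersection with the linking subspace is a surjectivity statement about maps close to the
   identity, so no homology enters. Strict growth of the values is obtained without multiplicity
   theory: the deformation compares two functionals [action <= g] at once, and it suffices that they
   differ at the critical points of the smaller one at its minimax level. *)
Require Import Defs.
From Stdlib Require Import Reals Lra Lia List Arith Classical ClassicalEpsilon FunctionalExtensionality.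
From mathcomp Require all_boot all_fingroup zify.
Open Scope R_scope.

(** * A cubical Sperner lemma *)

Module Sperner.
Import all_boot all_fingroup zify.
Local Open Scope nat_scope.

Lemma odd_card_invol (T : finType) (A : {set T}) (f : T -> T) :
  (forall x, x \in A -> f x \in A) -> (forall x, x \in A -> f (f x) = x) ->
  (forall x, x \in A -> f x != x) -> ~~ odd #|A|.
Proof.
move: {2}#|A|.+1 (ltnSn #|A|) => k; elim: k A => // k IH A ltA fA fK fN.
case: (set_0Vmem A) => [-> | [x xA]]; first by rewrite cards0.
have fxA := fA _ xA; have Nfx := fN _ xA.
have c2 : #|A| = (#|A :\ x :\ f x|).+2.
  by rewrite (cardsD1 x A) xA (cardsD1 (f x) (A :\ x)) !inE Nfx fxA.
rewrite c2 /= negbK; apply: IH.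
- by rewrite c2 in ltA; rewrite ltnS in ltA; apply: leq_trans ltA; rewrite ltnS leqnSn.
- move=> y; rewrite !inE => /and3P[y1 y2 yA]; rewrite fA // andbT; apply/andP; split.
    by apply: contra y2 => /eqP e; rewrite -(fK y) // e fK.
  by apply: contra y1 => /eqP e; rewrite -(fK y) // e.
- by move=> y; rewrite !inE => /and3P[_ _ yA]; apply: fK.
- by move=> y; rewrite !inE => /and3P[_ _ yA]; apply: fN.
Qed.

(** The count of Sperner's argument for one simplex. If all labels occur they occur once each, and
    only the facet opposite the vertex labelled [s] is a door. If a label is missing and there is a
    door, the missing label is [s] and exactly one other label is repeated, so the two facets
    opposite its vertices are the doors. *)
Lemma odd_doors (s : nat) (L : 'I_s.+1 -> 'I_s.+1) :
  odd #|[set k | [forall l : 'I_s.+1, (l < s) ==>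
                   [exists j, (j != k) && (L j == l)]]]|
  = [forall l, [exists k, L k == l]].
Proof.
set D := [set k | _].
have DP k : reflect (forall l : 'I_s.+1, l < s -> exists2 j, j != k & L j = l) (k \in D).
  rewrite inE; apply: (iffP forallP) => H l.
    by move=> ls; have /implyP/(_ ls)/existsP[j /andP[j1 /eqP j2]] := H l; exists j.
  by apply/implyP => /H[j j1 j2]; apply/existsP; exists j; rewrite j1 j2 eqxx.
have lts (l : 'I_s.+1) : l != ord_max -> l < s.
  move=> H; rewrite ltn_neqAle -ltnS ltn_ord andbT.
  by apply: contra H => /eqP e; apply/eqP/val_inj.
case: (boolP [forall l, _]) => [/forallP full | nfull].
  have surj l : exists k, L k = l by have /existsP[k /eqP] := full l; exists k.
  have inj : injective L.
    apply/injectiveP; rewrite /injectiveb /dinjectiveb map_inj_in_uniq ?enum_uniq //.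
    have/imset_injP I : #|[set L x | x in 'I_s.+1]| == #|'I_s.+1|.
      rewrite eqn_leq leq_imset_card /= -cardsT; apply: subset_leq_card.
      by apply/subsetP => l _; have [k <-] := surj l; apply: imset_f.
    by move=> x y _ _; apply: I.
  have [k0 Lk0] := surj ord_max.
  suff -> : D = [set k0] by rewrite cards1.
  apply/setP => k; rewrite in_set1; apply/DP/eqP => [H | -> l ls].
    case: (eqVneq (L k) ord_max) => [e | ne]; first by apply: inj; rewrite e.
    by have [j jk e] := H _ (lts _ ne); rewrite (inj _ _ e) eqxx in jk.
  have [j e] := surj l; exists j => //; apply/eqP => jk.
  by move: ls; rewrite -e jk Lk0 ltnn.
case: (set_0Vmem D) => [-> | [k0 k0D]]; first by rewrite cards0.
have k0P := DP _ k0D.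
have Lk0 : L k0 < s.
  apply: (lts); apply: contra nfull => /eqP e; apply/forallP => l.
  case: (eqVneq l ord_max) => [-> | /lts ls]; first by apply/existsP; exists k0; rewrite e.
  by have [j _ <-] := k0P _ ls; apply/existsP; exists j.
have [j0 j0k0 e0] := k0P _ Lk0.
have inj : {in [set~ k0] &, injective L}.
  apply/imset_injP; rewrite eqn_leq leq_imset_card /= cardsC1 card_ord /=.
  apply: (@leq_trans #|[set~ (ord_max : 'I_s.+1)]|); first by rewrite cardsC1 card_ord.
  apply: subset_leq_card; apply/subsetP => l; rewrite !inE => /lts/k0P[j jk <-].
  by apply: imset_f; rewrite !inE.
suff -> : D = [set k0; j0] by rewrite cards2 eq_sym j0k0.
apply/setP => k; rewrite !inE.
case: (eqVneq k k0) => [-> | kk0] /=; first by apply/idP; move: k0D; rewrite inE.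
apply/idP/idP => [kD | /eqP ->].
  have/DP kP : k \in D by rewrite inE.
  have Lk : L k < s.
    apply: (lts); apply/eqP => e.
    have c : #|[set L x | x in [set~ k0]]| = s by rewrite card_in_imset // cardsC1 card_ord.
    have : #|[set L x | x in [set~ k0]]| < s.+1 by rewrite c.
    have sub : [set: 'I_s.+1] \subset [set L x | x in [set~ k0]].
      apply/subsetP => l _; case: (eqVneq l ord_max) => [-> | /lts/k0P[j jk <-]].
        by rewrite -e; apply: imset_f; rewrite !inE.
      by apply: imset_f; rewrite !inE.
    by move/subset_leq_card: sub; rewrite cardsT card_ord leqNgt => /negP.
  have [j jk e] := kP _ Lk.
  case: (eqVneq j k0) => [ek | nk].
    by apply/eqP; apply: inj; rewrite ?inE // -e ek e0.
  by move: jk; rewrite (inj _ _ _ _ e) ?inE // eqxx.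
apply/forallP => l; apply/implyP => ls; have [j jk e] := k0P _ ls; apply/existsP.
case: (eqVneq j j0) => [ej | nj]; last by exists j; rewrite nj e eqxx.
by exists k0; rewrite eq_sym j0k0 -e0 -ej e eqxx.
Qed.

(** * Doors in the Freudenthal triangulation of a cube *)

Section Kuhn.
Variables (d m' : nat) (lab : (nat -> nat) -> nat).
Local Notation m := m'.+1.
Definition okv (v : nat -> nat) := forall i, i < d -> v i <= m.
(** These conditions fit the label that picks the first negative component of a map, or [d] if there
    is none: the [i]-th component is negative where coordinate [i] is lowest and positive where it
    is highest. *)
Hypothesis lab_le : forall v, okv v -> lab v <= d.
Hypothesis lab0 : forall v i, okv v -> i < d -> v i = 0 -> lab v <= i.
Hypothesis labm : forall v i, okv v -> i < d -> v i = m -> lab v <> i.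

Notation T := ({ffun 'I_d -> 'I_m} * {perm 'I_d})%type.

Implicit Types x : T.

(* Vertex k of the Freudenthal simplex based at x.1: coordinate i is raised between the
   vertices x.2 i and x.2 i + 1. *)
Definition vtx (x : T) (k : nat) : nat -> nat := fun i =>
  if insub i is Some j then x.1 j + (x.2 j < k) else 0.

Lemma vtxE (x : T) k (i : 'I_d) : vtx x k i = x.1 i + (x.2 i < k).
Proof. by rewrite /vtx valK. Qed.

Lemma vtx_ok x k : okv (vtx x k).
Proof.
move=> i id; rewrite -[i]/(val (Ordinal id)) vtxE.
by case: (_ < k); rewrite ?addn1 ?addn0 // ltnW.
Qed.

Lemma eq_vtx (x y : T) k l :
  (forall i, x.1 i + (x.2 i < k) = y.1 i + (y.2 i < l)) -> vtx x k = vtx y l.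
Proof.
move=> H; apply: FunctionalExtensionality.functional_extensionality => i.
by rewrite /vtx; case: insub.
Qed.

(** An [r]-simplex in the face where the coordinates from [r] on vanish is encoded by a
    top-dimensional one: those coordinates start at 0 and are raised in natural order after vertex
    [r], and only the vertices up to [r] count. One finite type then serves all dimensions. *)
Definition inS r (x : T) := [forall i : 'I_d, (r <= i) ==> ((x.1 i == 0 :> nat) && (x.2 i == i))].
Definition full r (x : T) := [forall l : 'I_r.+1, [exists k : 'I_r.+1, lab (vtx x k) == l]].
Definition door r (x : T) (k : 'I_r.+2) :=
  [forall l : 'I_r.+1, [exists j : 'I_r.+2, (j != k) && (lab (vtx x j) == l)]].

Lemma inSP r x : reflect (forall i : 'I_d, r <= i -> x.1 i = 0 :> nat /\ x.2 i = i) (inS r x).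
Proof.
apply: (iffP forallP) => H i.
  by move=> ri; have /implyP/(_ ri)/andP[/eqP ? /eqP ?] := H i.
by apply/implyP => /H[-> ->]; rewrite !eqxx.
Qed.

Lemma fullP r x : reflect (forall l, l <= r -> exists2 k, k <= r & lab (vtx x k) = l) (full r x).
Proof.
apply: (iffP forallP) => H l.
  move=> lr; have /existsP[k /eqP e] := H (Ordinal (lr : l < r.+1)).
  by exists k => //; rewrite -ltnS.
have [|k kr e] := H l; first by rewrite -ltnS.
by apply/existsP; exists (Ordinal (kr : k < r.+1)); rewrite /= e.
Qed.

Lemma doorP r x (k : 'I_r.+2) : reflect
  (forall l, l <= r -> exists2 j, j <= r.+1 & j <> k /\ lab (vtx x j) = l) (door r x k).
Proof.
apply: (iffP forallP) => H l.
  move=> lr; have /existsP[j /andP[jk /eqP e]] := H (Ordinal (lr : l < r.+1)).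
  by exists j; [rewrite -ltnS | split => //; move=> e'; case/eqP: jk; apply: val_inj].
have [|j jr [jk e]] := H l; first by rewrite -ltnS.
apply/existsP; exists (Ordinal (jr : j < r.+2)); rewrite /= e eqxx andbT.
by apply/eqP => /(congr1 val) /=.
Qed.

Lemma lab_inS r x k : inS r x -> r <= d -> lab (vtx x k) <= r \/ r < k.
Proof.
move=> /inSP S; rewrite leq_eqVlt => /orP[/eqP -> | rd]; first by left; apply/lab_le/vtx_ok.
case: (leqP k r) => kr; [left | by right].
apply: lab0 => //; first exact: vtx_ok.
rewrite -[r]/(val (Ordinal rd)) vtxE; have [-> ->] := S (Ordinal rd) (leqnn _).
by rewrite /= ltnNge kr.
Qed.

Definition N r := #|[set x | inS r x && full r x]|.
Definition doors r := [set y : T * 'I_r.+2 | inS r.+1 y.1 && door r y.1 y.2].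

Lemma odd_doors_full r x : r < d -> inS r.+1 x ->
  odd #|[set k | door r x k]| = full r.+1 x.
Proof.
move=> rd S.
have lt k : k < r.+2 -> lab (vtx x k) < r.+2.
  by move=> kr; case: (lab_inS _ _ k S rd) => // H; move: kr; rewrite ltnNge H.
pose L (k : 'I_r.+2) : 'I_r.+2 := Ordinal (lt k (ltn_ord k)).
have -> : full r.+1 x = [forall l, [exists k, L k == l]] by [].
rewrite -odd_doors; congr (odd #|pred_of_set _|); apply/setP => k; rewrite !inE.
apply/doorP/forallP => H l.
  apply/implyP => lr; have [j jr [jk e]] := H l lr.
  apply/existsP; exists (Ordinal (jr : j < r.+2)); apply/andP; split.
    by apply/eqP => /(congr1 val).
  by apply/eqP/val_inj; rewrite /= e.
move=> lr; have l2 : l < r.+2 by rewrite ltnS leqW.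
have /implyP/(_ (lr : l < r.+1))/existsP[j /andP[jk /eqP/(congr1 val) /= e]] := H (Ordinal l2).
exists j; first by rewrite -ltnS.
by split => // e'; case/eqP: jk; apply: val_inj.
Qed.

Lemma odd_card_doors r : r < d -> odd #|doors r| = odd (N r.+1).
Proof.
move=> rd.
have -> : #|doors r| = \sum_(x | inS r.+1 x) #|[set k | door r x k]|.
  rewrite -sum1_card.
  under [RHS]eq_bigr => x _ do rewrite -sum1_card.
  rewrite pair_big_dep /=; apply: eq_bigl => -[x k]; by rewrite !inE.
have -> : N r.+1 = \sum_(x | inS r.+1 x) full r.+1 x.
  rewrite /N -sum1_card big_mkcond [RHS]big_mkcond /=; apply: eq_bigr => x _.
  by rewrite inE; case: inS => //=; case: full.
apply: (big_ind2 (fun a b => odd a = odd b)) => // [a b c e H1 H2 | x S].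
  by rewrite !oddD H1 H2.
by rewrite odd_doors_full //; case: full.
Qed.

Section Pivot.
Variables (r : nat) (rd : r < d).

(** The cyclic shift of [0..r]. Dropping vertex 0 and appending a new last vertex turns the
    coordinate raised first into the one raised last and advances the others by one. *)
Definition rotf (j : 'I_d) : 'I_d :=
  if j <= r then (if j == 0 :> nat then Ordinal rd else Ordinal (leq_ltn_trans (leq_pred j) (ltn_ord j))) else j.
Lemma rotf_inj : injective rotf.
Proof.
move=> i j; rewrite /rotf => /(congr1 val).
case: (leqP i r) => ir; case: (leqP j r) => jr; case: (eqVneq (i : nat) 0) => i0;
  case: (eqVneq (j : nat) 0) => j0 //= e; apply: val_inj => /=; clear -ir jr i0 j0 e; lia.
Qed.
Definition rot := perm rotf_inj.

Definition o0 : 'I_d := Ordinal (leq_ltn_trans (leq0n r) rd).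
Definition orr : 'I_d := Ordinal rd.

Lemma rot0 : rot o0 = orr. Proof. by rewrite permE /rotf /=. Qed.
Lemma rot_big (j : 'I_d) : r < j -> rot j = j.
Proof. by rewrite permE /rotf ltnNge => /negbTE ->. Qed.
Lemma rotS (j : 'I_d) : j <= r -> j != 0 :> nat -> (rot j).+1 = j :> nat.
Proof. by rewrite permE /rotf => -> /negbTE j0; rewrite j0 /=; case: (val j) j0. Qed.

Lemma rot_lt (j : 'I_d) k : j != o0 -> k <= r -> (rot j < k) = (j < k.+1).
Proof.
move=> j0 kr; have j0' : j != 0 :> nat by apply: contra j0 => /eqP e; apply/eqP/val_inj.
case: (leqP j r) => jr; first by rewrite -(rotS j jr j0') ltnS.
rewrite rot_big // ltnNge (leq_trans kr (ltnW jr)) /= ltnNge.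
by rewrite (leq_ltn_trans kr jr).
Qed.

Definition vinc (v : {ffun 'I_d -> 'I_m}) (i0 : 'I_d) : {ffun 'I_d -> 'I_m} :=
  [ffun i => if i == i0 then inord (v i).+1 else v i].
Definition vdec (v : {ffun 'I_d -> 'I_m}) (i0 : 'I_d) : {ffun 'I_d -> 'I_m} :=
  [ffun i => if i == i0 then inord (v i).-1 else v i].

Implicit Types v : {ffun 'I_d -> 'I_m}.

Lemma vincE v i0 i : (v i0).+1 < m -> vinc v i0 i = v i + (i == i0) :> nat.
Proof.
move=> H; rewrite ffunE; case: (eqVneq i i0) => [-> | _] /=; last by rewrite addn0.
by rewrite inordK // addn1.
Qed.
Lemma vdecE v i0 i : 0 < v i0 -> vdec v i0 i + (i == i0) = v i :> nat.
Proof.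
move=> H; rewrite ffunE; case: (eqVneq i i0) => [-> | _] /=; last by rewrite addn0.
rewrite inordK; first by rewrite addn1 prednK.
by have := ltn_ord (v i0); clear; lia.
Qed.

Definition ko (k : nat) : 'I_d := odflt o0 (insub k).
Lemma koE k : k <= r -> ko k = k :> nat.
Proof. by move=> kr; rewrite /ko insubT ?(leq_ltn_trans kr rd). Qed.

(** Passage to the neighbour across the facet opposite vertex [k]. At the two ends the base point
    moves by one unit and the order of raising is rotated; in between, the two raisings around
    vertex [k] are exchanged. *)
Definition piv (y : T * 'I_r.+2) : T * 'I_r.+2 :=
  let x := y.1 in let k := y.2 in
  if k == ord0 then ((vinc x.1 ((x.2^-1)%g o0), (x.2 * rot)%g), ord_max)
  else if k == ord_max then ((vdec x.1 ((x.2^-1)%g orr), (x.2 * rot^-1)%g), ord0)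
  else ((x.1, (x.2 * tperm (ko k.-1) (ko k))%g), k).

(** The doors removed are those in the face where coordinate [r] vanishes; the neighbour across them
    would leave the cube. *)
Definition inner := [set y in doors r | ~~ [&& y.2 == ord_max, inS r y.1 & full r y.1]].

Lemma perm_small x (j : 'I_d) : inS r.+1 x -> j <= r -> (x.2^-1)%g j <= r.
Proof.
move=> /inSP S jr; rewrite leqNgt; apply/negP => H; have [_] := S _ H.
by rewrite permKV => e; move: jr; rewrite e leqNgt H.
Qed.

(** Otherwise all vertices of the facet lie on the face where coordinate [i0] equals [m]. There the
    label [i0] is excluded by [labm], while a door must carry it. *)
Lemma inner0 x : (x, ord0) \in inner ->
  (x.1 ((x.2^-1)%g o0)).+1 < m.
Proof.
rewrite !inE /= => /andP[/andP[S /doorP D] _].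
rewrite ltn_neqAle ltn_ord andbT; apply/eqP => e.
set i0 := (x.2^-1)%g o0 in e.
have [j jr [j0]] := D i0 (perm_small x o0 S (leq0n _)).
apply: labm => //; first exact: vtx_ok.
rewrite vtxE /i0 permKV /= -/i0.
have -> : 0 < j by case: j j0 {jr}.
by rewrite addn1.
Qed.

(** If the base coordinate [i0] were 0, it would vanish on the whole facet and bound its labels by
    [i0]. The label [r] then forces [i0 = r], which makes the door one of those removed in
    [inner]. *)
Lemma inner_max x : (x, ord_max) \in inner -> 0 < x.1 ((x.2^-1)%g orr).
Proof.
rewrite !inE /= => /andP[/andP[S /doorP D]]; rewrite eqxx /= => nB.
rewrite lt0n; apply: contra nB => /eqP e.
set i0 := (x.2^-1)%g orr in e.
have i0r : i0 <= r by apply: perm_small.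
have [j jr [/= j0 lj]] := D r (leqnn _).
have jr' : j <= r by lia.
have ri0 : r <= i0.
  rewrite -{1}lj; apply: lab0 => //; first exact: vtx_ok.
  by rewrite vtxE /i0 permKV /= -/i0 e ltnNge jr'.
have ei0 : i0 = orr by apply: val_inj => /=; lia.
have e2 : x.2 orr = orr by rewrite -{1}ei0 /i0 permKV.
have -> : inS r x.
  apply/inSP => i; rewrite leq_eqVlt => /orP[/eqP ri | ri]; last exact: (inSP _ _ S).
  have -> : i = orr by apply: val_inj.
  by rewrite -{1}ei0 e e2.
apply/fullP => l lr; have [k kr [/= k0 lk]] := D l lr; exists k => //; lia.
Qed.

Lemma eq_door x x' (k k' : 'I_r.+2) (f : nat -> nat) :
  (forall j, j <= r.+1 -> j <> k -> [/\ f j <= r.+1, f j <> k' & vtx x j = vtx x' (f j)]) ->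
  door r x k -> door r x' k'.
Proof.
move=> H /doorP D; apply/doorP => l lr; have [j jr [jk e]] := D l lr.
by have [H1 H2 H3] := H j jr jk; exists (f j) => //; rewrite -H3.
Qed.

Lemma inv_eq (p : {perm 'I_d}) i j : (i == (p^-1)%g j) = (p i == j).
Proof. by rewrite -[RHS](inj_eq (@perm_inj _ (p^-1)%g)) permK. Qed.

Lemma piv_inner y : y \in inner -> piv y \in inner.
Proof.
case: y => x k yI; have := yI; rewrite !inE /= => /andP[/andP[S Dr] nB].
rewrite /piv /=; case: (eqVneq k ord0) => [k0 | k0].
  rewrite k0 in yI Dr; have H := inner0 x yI.
  set i0 := (x.2^-1)%g o0 in H *.
  have i0r : i0 <= r by apply: perm_small.
  (* The facet keeps its vertices; their numbers drop by one. *)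
  have E j : j <= r -> vtx x j.+1 = vtx (vinc x.1 i0, (x.2 * rot)%g) j.
    move=> jr; apply: eq_vtx => i /=; rewrite vincE // permM inv_eq -addnA; congr (_ + _).
    case: (eqVneq (x.2 i) o0) => [-> | ni]; first by rewrite rot0 /= [r < j]ltnNge jr.
    by rewrite rot_lt.
  rewrite eqxx /=; apply/andP; split; last first.
    apply/negP => /andP[/inSP S' _]; have [] := S' orr (leqnn _).
    rewrite vincE // permM; case: (eqVneq orr i0) => [_ | n]; first by rewrite addn1.
    move=> _ e; case/eqP: n; rewrite /i0 -[orr in LHS](permK x.2); congr (_ _).
    by apply: (@perm_inj _ rot); rewrite e rot0.
  apply/andP; split.
    apply/inSP => i ri /=; have [H1 H2] := inSP _ _ S i ri.
    rewrite vincE // permM H1 H2 rot_big //; split => //.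
    by case: (eqVneq i i0) => // ei; move: ri; rewrite ei ltnNge i0r.
  apply: (@eq_door x _ ord0 ord_max predn) => // j jr /= j0; split; [lia | lia |].
  by rewrite -E ?prednK //; lia.
case: (eqVneq k ord_max) => [km | km].
  rewrite km in yI Dr; have H := inner_max x yI.
  set i0 := (x.2^-1)%g orr in H *.
  have i0r : i0 <= r by apply: perm_small.
  have E j : j <= r -> vtx x j = vtx (vdec x.1 i0, (x.2 * rot^-1)%g) j.+1.
    move=> jr; apply: eq_vtx => i /=; rewrite -(vdecE _ _ i H) permM inv_eq -addnA.
    congr (_ + _).
    rewrite -[x.2 i in LHS](permKV rot); set q := (rot^-1)%g _.
    case: (eqVneq q o0) => [e | ni].
      by rewrite e rot0 eqxx /= ltnNge jr.
    rewrite rot_lt //; case: (eqVneq (rot q) orr) => // e.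
    by case/eqP: ni; apply: (@perm_inj _ rot); rewrite rot0.
  rewrite /= andbT; apply/andP; split.
    apply/inSP => i ri /=; have [H1 H2] := inSP _ _ S i ri.
    rewrite permM H2; split.
      by have := vdecE _ _ i H; rewrite H1; lia.
    by apply: (@perm_inj _ rot); rewrite permKV rot_big.
  apply: (@eq_door x _ ord_max ord0 succn) => // j jr /= j0; split; [lia | lia |].
  by apply: E; lia.
have k0' : k != 0 :> nat by apply: contra k0 => /eqP e; apply/eqP/val_inj.
have km' : k <= r by move: km (ltn_ord k) => /eqP km kl; have : k <> r.+1 :> nat; [move=> e; apply: km; apply: val_inj | lia].
rewrite (negbTE km) /= andbT.
have ek : ko k.-1 = k.-1 :> nat by rewrite koE //; lia.
have ek' : ko k = k :> nat by rewrite koE.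
apply/andP; split.
  apply/inSP => i ri /=; have [H1 H2] := inSP _ _ S i ri.
  rewrite H1 permM H2 tpermD //; apply/eqP => /(congr1 val) /=; lia.
apply: (@eq_door x _ k k id) => // j jr /= j0; split => //.
apply: eq_vtx => i /=; congr (_ + _); rewrite permM; case: tpermP => // -> ; lia.
Qed.

Lemma pivK y : y \in inner -> piv (piv y) = y.
Proof.
case: y => x k yI; rewrite {2}/piv /=; case: (eqVneq k ord0) => [k0 | k0].
  rewrite k0 in yI *; have H := inner0 x yI.
  rewrite /piv /= eqxx.
  have e : (((x.2 * rot)^-1)%g orr) = (x.2^-1)%g o0.
    by apply: (@perm_inj _ (x.2 * rot)%g); rewrite permKV permM permKV rot0.
  rewrite e mulgK; case: x {yI e} H => v p /= H; congr (_, _, _).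
  apply/ffunP => i; apply: val_inj.
  set i0 := (p^-1)%g o0 in H *.
  have P : 0 < vinc v i0 i0 by rewrite (vincE v i0 i0 H) eqxx addn1.
  by have := vdecE _ _ i P; rewrite (vincE v i0 i H) => /addIn.
case: (eqVneq k ord_max) => [km | km]; last first.
  rewrite /piv /= (negbTE k0) (negbTE km) -mulgA tperm2 mulg1; by case: (x).
rewrite km in yI *; have H := inner_max x yI.
rewrite /piv /=.
have e : (((x.2 * rot^-1)^-1)%g o0) = (x.2^-1)%g orr.
  apply: (@perm_inj _ (x.2 * rot^-1)%g); rewrite permKV permM permKV.
  by apply: (@perm_inj _ rot); rewrite permKV rot0.
rewrite e mulgKV; case: x {yI e} H => v p /= H; congr (_, _, _).
apply/ffunP => i; apply: val_inj; set i0 := (p^-1)%g orr in H *.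
have P : (vdec v i0 i0).+1 < m by have := vdecE _ _ i0 H; rewrite eqxx addn1 => ->.
by have := vincE _ _ i P; rewrite (vdecE _ _ _ H).
Qed.

Lemma piv_neq y : y \in inner -> piv y != y.
Proof.
case: y => x k yI; rewrite /piv /=; case: (eqVneq k ord0) => [-> | k0].
  by rewrite xpair_eqE andbC.
case: (eqVneq k ord_max) => [-> | km]; first by rewrite xpair_eqE andbC.
rewrite xpair_eqE eqxx andbT; case: x {yI} => v p; rewrite xpair_eqE eqxx /=.
apply/eqP => /(congr1 (fun q => (p^-1 * q)%g)); rewrite mulKg mulVg => /permP/(_ (ko k)).
rewrite tpermR perm1 => /(congr1 val) /=.
have k0' : k != 0 :> nat by apply: contra k0 => /eqP e; apply/eqP/val_inj.
have km' : k <= r by move: km (ltn_ord k) => /eqP km kl; have : k <> r.+1 :> nat; [move=> e; apply: km; apply: val_inj | lia].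
by rewrite !koE //; lia.
Qed.

(* A door belongs to two simplices, exchanged by piv, unless it lies in the face where
   coordinate r vanishes; the latter doors are the full simplices of dimension r. *)
Lemma odd_step : odd (N r.+1) = odd (N r).
Proof.
rewrite -odd_card_doors //.
rewrite -(cardsID [set y | [&& y.2 == ord_max, inS r y.1 & full r y.1]] (doors r)) oddD.
have -> : doors r :\: [set y | [&& y.2 == ord_max, inS r y.1 & full r y.1]] = inner.
  by apply/setP => y; rewrite !inE andbC.
rewrite (negbTE (odd_card_invol _ _ piv piv_inner pivK piv_neq)) addbF; congr odd.
rewrite /N -[RHS](card_imset _ (f := fun x => (x, @ord_max r.+1))); last by move=> x y [].
apply: eq_card => -[x k]; rewrite !inE /=; apply/andP/imsetP => [[_ /and3P[/eqP -> S F]] | [y]].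
  by exists x => //; rewrite inE S.
rewrite inE => /andP[S F] [-> ->]; rewrite eqxx S F; split => //; apply/andP; split.
  by apply/inSP => i ri; apply: (inSP _ _ S); apply: ltnW.
apply/doorP => l lr; have [j jr e] := fullP _ _ F l lr; exists j; first exact: leqW.
by split => //= e'; move: jr; rewrite e' ltnn.
Qed.

End Pivot.

Lemma odd_N r : r <= d -> odd (N r).
Proof.
elim: r => [_ | r IH rd]; last by rewrite odd_step // IH // ltnW.
have -> : N 0 = 1; last by [].
pose x0 : T := ([ffun => ord0], 1%g).
have S0 : inS 0 x0 by apply/inSP => i _; rewrite ffunE perm1.
rewrite /N -(cards1 x0); apply: eq_card => x; rewrite !inE.
apply/andP/eqP => [[/inSP S _] | ->].
  case: x S => v p S; congr (_, _).
    by apply/ffunP => i; apply: val_inj; rewrite ffunE; have [] := S i (leq0n _).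
  by apply/permP => i; rewrite perm1; have [] := S i (leq0n _).
split=> //; apply/fullP => l; rewrite leqn0 => /eqP ->; exists 0 => //.
by case: (lab_inS 0 x0 0 S0 (leq0n _)) => //; rewrite leqn0 => /eqP.
Qed.

Lemma kuhn : exists v : nat -> nat, (forall i, i < d -> v i < m) /\
  forall l, l <= d -> exists w, lab w = l /\ forall i, i < d -> v i <= w i <= (v i).+1.
Proof.
have : 0 < N d by have := odd_N d (leqnn _); case: (N d).
case/card_gt0P => x; rewrite inE => /andP[_ /fullP F].
exists (vtx x 0); split.
  by move=> i id; rewrite -[i]/(val (Ordinal id)) vtxE ltn0 addn0.
move=> l ld; have [k kd e] := F l ld; exists (vtx x k); split => // i id.
by rewrite -[i]/(val (Ordinal id)) !vtxE; case: (_ < k); rewrite ltn0 ?addn1 addn0 leqnn leqnSn.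
Qed.

End Kuhn.
End Sperner.

(** Transfers [Sperner.kuhn] to the order relations used outside the module. *)
Lemma kuhn_cube (d m : nat) (lab : (nat -> nat) -> nat) :
  (forall v, (forall i, (i < d)%nat -> (v i <= S m)%nat) ->
     (lab v <= d)%nat /\ forall i, (i < d)%nat ->
       (v i = 0%nat -> (lab v <= i)%nat) /\ (v i = S m -> lab v <> i)) ->
  exists v, (forall i, (i < d)%nat -> (v i < S m)%nat) /\
    forall l, (l <= d)%nat -> exists w, lab w = l /\
      forall i, (i < d)%nat -> (v i <= w i <= S (v i))%nat.
Proof.
  intros H.
  assert (K : forall v, Sperner.okv d m v -> forall i, (i < d)%nat -> (v i <= S m)%nat).
  { intros v Hv i Hi. apply (ssrbool.elimT ssrnat.leP). apply Hv.
    now apply (ssrbool.introT ssrnat.leP). }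
  destruct (Sperner.kuhn d m lab) as [v [Hv1 Hv2]].
  - intros v Hv. apply (ssrbool.introT ssrnat.leP). exact (proj1 (H v (K v Hv))).
  - intros v i Hv Hi e. apply (ssrbool.introT ssrnat.leP).
    apply (proj2 (H v (K v Hv)) i); auto. now apply (ssrbool.elimT ssrnat.leP) in Hi.
  - intros v i Hv Hi e. apply (proj2 (H v (K v Hv)) i); auto.
    now apply (ssrbool.elimT ssrnat.leP) in Hi.
  - exists v. split.
    + intros i Hi. apply (ssrbool.elimT ssrnat.leP). apply Hv1.
      now apply (ssrbool.introT ssrnat.leP).
    + intros l Hl. destruct (Hv2 l) as [w [e Hw]].
      { now apply (ssrbool.introT ssrnat.leP). }
      exists w. split; auto. intros i Hi.
      destruct (ssrbool.elimT ssrbool.andP (Hw i (ssrbool.introT ssrnat.leP Hi))) as [H1 H2].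
      split; now apply (ssrbool.elimT ssrnat.leP).
Qed.

(** * Finite sums, distances and coordinates *)

Lemma abs_le_inv x a : Rabs x <= a -> - a <= x <= a.
Proof. intros H. assert (P := Rle_abs x). assert (Q := Rle_abs (- x)). rewrite Rabs_Ropp in Q. lra. Qed.

Lemma fsum_ext n f g : (forall i, (i < n)%nat -> f i = g i) -> fsum n f = fsum n g.
Proof. induction n; simpl; intros H; auto. rewrite IHn, H by auto with arith; auto. Qed.

Lemma fsum_plus n f g : fsum n (fun i => f i + g i) = fsum n f + fsum n g.
Proof. induction n; simpl; lra. Qed.

Lemma fsum_minus n f g : fsum n (fun i => f i - g i) = fsum n f - fsum n g.
Proof. induction n; simpl; lra. Qed.

Lemma fsum_scal n c f : fsum n (fun i => c * f i) = c * fsum n f.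
Proof. induction n; simpl; [ring | rewrite IHn; ring]. Qed.

Lemma fsum_zero n f : (forall i, (i < n)%nat -> f i = 0) -> fsum n f = 0.
Proof. induction n; simpl; intros H; [auto | rewrite IHn, H by auto with arith; lra]. Qed.

Lemma fsum_const n c : fsum n (fun _ => c) = INR n * c.
Proof. induction n; [simpl; ring | rewrite S_INR; simpl fsum; rewrite IHn; ring]. Qed.

Lemma fsum_le n f g : (forall i, (i < n)%nat -> f i <= g i) -> fsum n f <= fsum n g.
Proof.
  induction n; simpl; intros H; [lra|].
  apply Rplus_le_compat; [apply IHn; auto with arith | apply H; auto].
Qed.

Lemma fsum_nonneg n f : (forall i, (i < n)%nat -> 0 <= f i) -> 0 <= fsum n f.
Proof. intros H. rewrite <- (fsum_zero n (fun _ => 0)) by auto. now apply fsum_le. Qed.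

Lemma fsum_abs n f : Rabs (fsum n f) <= fsum n (fun i => Rabs (f i)).
Proof.
  induction n; simpl; [rewrite Rabs_R0; lra|].
  eapply Rle_trans; [apply Rabs_triang|lra].
Qed.

Lemma fsum_term_le n f i : (forall k, (k < n)%nat -> 0 <= f k) -> (i < n)%nat -> f i <= fsum n f.
Proof.
  induction n; simpl; intros H Hi; [lia|].
  assert (0 <= fsum n f) by (apply fsum_nonneg; auto with arith).
  assert (0 <= f n) by auto.
  destruct (Nat.eq_dec i n); [subst; lra|].
  assert (f i <= fsum n f) by (apply IHn; auto with arith; lia). lra.
Qed.

Lemma fsum_single n f i : (i < n)%nat -> (forall k, (k < n)%nat -> k <> i -> f k = 0) -> fsum n f = f i.
Proof.
  induction n; simpl; intros Hi H; [lia|].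
  destruct (Nat.eq_dec i n).
  - subst. rewrite fsum_zero; [lra|]. intros k Hk. apply H; lia.
  - rewrite IHn, (H n); auto with arith; [lra | lia].
Qed.

Lemma fsum_add a b f : fsum (a + b) f = fsum a f + fsum b (fun i => f (a + i)%nat).
Proof.
  induction b; simpl.
  - rewrite Nat.add_0_r; lra.
  - rewrite Nat.add_succ_r; simpl. rewrite IHb; lra.
Qed.

Definition dist1 (m : nat) (v w : nat -> R) : R := fsum m (fun i => Rabs (w i - v i)).

Lemma dist1_nonneg m v w : 0 <= dist1 m v w.
Proof. apply fsum_nonneg; intros; apply Rabs_pos. Qed.

Lemma dist1_sym m v w : dist1 m v w = dist1 m w v.
Proof. apply fsum_ext; intros; apply Rabs_minus_sym. Qed.

Lemma dist1_coord m v w i : (i < m)%nat -> Rabs (w i - v i) <= dist1 m v w.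
Proof. intros. apply (fsum_term_le m (fun i => Rabs (w i - v i))); auto. intros; apply Rabs_pos. Qed.

Lemma dist1_near m v w d : near m v w d -> dist1 m v w <= INR m * d.
Proof.
  intros H. rewrite <- fsum_const. apply fsum_le. intros i Hi. apply Rlt_le, H, Hi.
Qed.

Lemma near_dist1 m v w d : dist1 m v w < d -> near m v w d.
Proof. intros H i Hi. eapply Rle_lt_trans; [apply (dist1_coord m v w i Hi) | exact H]. Qed.

Lemma inR_ext m v w : inR m v -> inR m w -> (forall i, (i < m)%nat -> v i = w i) -> v = w.
Proof.
  intros Hv Hw H. apply functional_extensionality. intros i.
  destruct (lt_dec i m); [auto | rewrite Hv, Hw by lia; auto].
Qed.

Lemma near_refl m v d : 0 < d -> near m v v d.
Proof. intros H i _. unfold Rminus. rewrite Rplus_opp_r, Rabs_R0. exact H. Qed.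

Lemma near_le m v w d d' : d <= d' -> near m v w d -> near m v w d'.
Proof. intros H N i Hi. specialize (N i Hi). lra. Qed.

Lemma near_trans m u v w d d' : near m u v d -> near m v w d' -> near m u w (d + d').
Proof.
  intros H H' i Hi. replace (w i - u i) with ((v i - u i) + (w i - v i)) by ring.
  eapply Rle_lt_trans; [apply Rabs_triang|]. specialize (H i Hi). specialize (H' i Hi). lra.
Qed.

Lemma near_sym m v w d : near m v w d -> near m w v d.
Proof. intros H i Hi. rewrite Rabs_minus_sym. auto. Qed.

Lemma upd_inR m v i s : (i < m)%nat -> inR m v -> inR m (upd v i s).
Proof. intros Hi Hv j Hj. unfold upd. destruct (Nat.eqb_spec j i); [lia | auto]. Qed.

Lemma upd_upd v i s t : upd (upd v i s) i t = upd v i (s + t).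
Proof.
  apply functional_extensionality; intros j. unfold upd.
  destruct (Nat.eqb_spec j i); lra.
Qed.

Lemma upd_0 v i : upd v i 0 = v.
Proof. apply functional_extensionality; intros j. unfold upd. destruct (Nat.eqb j i); lra. Qed.

Lemma upd_same v i s : upd v i s i = v i + s.
Proof. unfold upd. now rewrite Nat.eqb_refl. Qed.

Lemma upd_other v i s j : j <> i -> upd v i s j = v j.
Proof. unfold upd. intros. destruct (Nat.eqb_spec j i); [contradiction|auto]. Qed.

Lemma trunc_inR m w : inR m (trunc m w).
Proof. intros i Hi. unfold trunc. destruct (Nat.ltb_spec i m); [lia | auto]. Qed.

Lemma trunc_lt m w i : (i < m)%nat -> trunc m w i = w i.
Proof. intros H. unfold trunc. destruct (Nat.ltb_spec i m); [auto | lia]. Qed.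

(** * Compactness *)

(** The supremum of the endpoints reachable from [a] can be passed with the help of its own
    neighbourhood, so it is [b]. This replaces every choice of a finite subdivision below: for
    compactness of boxes, for integrating a differential inequality, and for cutting the isotopy
    into steps. *)
Lemma creeping (a b : R) (G : R -> R -> Prop) : a < b ->
  (forall r s t, a <= r -> r <= s -> s <= t -> t <= b -> G r s -> G s t -> G r t) ->
  (forall x, a <= x <= b -> exists d, 0 < d /\ forall s t,
     a <= s -> s <= x -> x <= t -> t <= b -> x - d < s -> t < x + d -> s < t -> G s t) ->
  G a b.
Proof.
  intros ab tr loc.
  set (E := fun x => a < x <= b /\ G a x).
  assert (start : exists x, E x).
  { destruct (loc a) as [d [d0 H]]; [lra|].
    exists (Rmin b (a + d / 2)). split.
    - split; [apply Rmin_glb_lt; lra | apply Rmin_l].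
    - assert (Rmin b (a + d / 2) <= a + d/2) by apply Rmin_r.
      assert (a < Rmin b (a + d / 2)) by (apply Rmin_glb_lt; lra).
      apply H; try lra. apply Rmin_l. }
  destruct (completeness E) as [c [cub club]].
  { exists b. intros x [[_ H] _]; exact H. }
  { exact start. }
  destruct start as [x0 [[ax0 x0b] Gx0]].
  assert (x0c : x0 <= c) by (apply cub; split; auto).
  assert (cb : c <= b) by (apply club; intros x [[_ H] _]; exact H).
  destruct (loc c) as [d [d0 H]]; [lra|].
  assert (exists y, E y /\ c - d < y) as [y [[[ay yb] Gy] yc]].
  { apply NNPP. intros N. assert (c <= c - d); [|lra]. apply club. intros x Ex.
    apply Rnot_lt_le. intros L. apply N. exists x. auto. }
  assert (yc' : y <= c) by (apply cub; split; auto).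
  set (t := Rmin b (c + d / 2)).
  assert (tb : t <= b) by apply Rmin_l.
  assert (t <= c + d/2) by apply Rmin_r.
  assert (ct : c <= t) by (apply Rmin_glb; lra).
  assert (Gt : G a t).
  { destruct (Rlt_le_dec y t) as [yt|yt].
    - apply (tr a y t); try lra; auto. apply H; lra.
    - assert (t = y) as -> by lra. exact Gy. }
  assert (t <= c) by (apply cub; split; [lra | exact Gt]).
  assert (tb' : t = b); [clear Gt|rewrite tb' in Gt; exact Gt].
  unfold t in *. destruct (Rle_dec b (c + d/2)); [apply Rmin_left; lra|].
  rewrite Rmin_right in * by lra. lra.
Qed.

Definition box (m : nat) (B : R) (v : nat -> R) := forall i, (i < m)%nat -> Rabs (v i) <= B.

Lemma compact_uniform (m : nat) (B : R) (P : R -> (nat -> R) -> Prop) :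
  (forall d d' y, 0 < d' -> d' <= d -> P d y -> P d' y) ->
  (forall x, inR m x -> box m B x -> exists d, 0 < d /\
     forall y, inR m y -> box m B y -> near m x y d -> P d y) ->
  exists d, 0 < d /\ forall y, inR m y -> box m B y -> P d y.
Proof.
  intros mono loc.
  destruct (Rlt_le_dec B 0) as [Bn|B0].
  { destruct m as [|m].
    - destruct (loc (fun _ => 0)) as [d [d0 H]].
      { intros i _; auto. } { intros i Hi; lia. }
      exists d; split; auto. intros y Hy by_. apply H; auto. intros i Hi; lia.
    - exists 1. split; [lra|]. intros y _ Hb. specialize (Hb 0%nat ltac:(lia)).
      assert (P0 := Rabs_pos (y 0%nat)). lra. }
  (* The first [k] coordinates already range over the whole box, the others are still confined near
     [x]; each new coordinate is released by [creeping]. *)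
  assert (K : forall k, (k <= m)%nat -> forall x, inR m x -> box m B x -> exists d, 0 < d /\
     forall y, inR m y -> box m B y ->
       (forall i, (k <= i < m)%nat -> Rabs (y i - x i) < d) -> P d y).
  { induction k as [|k IH]; intros Hk x Hx Bx.
    - destruct (loc x Hx Bx) as [d [d0 H]]. exists d; split; auto.
      intros y Hy By N. apply H; auto. intros i Hi. apply N; lia.
    - set (G := fun s t => exists d, 0 < d /\ forall y, inR m y -> box m B y ->
        (forall i, (S k <= i < m)%nat -> Rabs (y i - x i) < d) -> s <= y k <= t -> P d y).
      assert (Gtr : forall r s t, G r s -> G s t -> G r t).
      { intros r s t [d [d0 H]] [e [e0 H']]. exists (Rmin d e).
        assert (L1 := Rmin_l d e). assert (L2 := Rmin_r d e).
        assert (L3 : 0 < Rmin d e) by (apply Rmin_glb_lt; auto).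
        split; auto. intros y Hy By N Hyk.
        destruct (Rle_lt_dec (y k) s).
        - apply (mono d); auto. apply H; auto; [|lra].
          intros i Hi. specialize (N i Hi). lra.
        - apply (mono e); auto. apply H'; auto; [|lra].
          intros i Hi. specialize (N i Hi). lra. }
      assert (Gloc : forall c, -B <= c <= B -> exists d, 0 < d /\
          forall s t, c - d < s -> t < c + d -> G s t).
      { intros c Hc.
        set (x' := fun i => if Nat.eqb i k then c else x i).
        destruct (IH ltac:(lia) x') as [d [d0 H]].
        { intros i Hi. unfold x'. destruct (Nat.eqb_spec i k); [lia | auto]. }
        { intros i Hi. unfold x'. destruct (Nat.eqb_spec i k); [apply Rabs_le; lra | auto]. }
        exists d; split; auto. intros s t Hs Ht. exists d; split; auto.
        intros y Hy By N Hyk. apply H; auto. intros i Hi. unfold x'.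
        destruct (Nat.eqb_spec i k) as [->|ne]; [apply Rabs_def1; lra | apply N; lia]. }
      assert (GB : G (-B) B).
      { destruct (Req_dec B 0) as [->|Bne].
        - destruct (Gloc 0) as [d [d0 H]]; [lra|]. apply H; lra.
        - apply creeping; [lra | intros; eapply Gtr; eauto |].
          intros c Hc. destruct (Gloc c Hc) as [d [d0 H]]. exists d; split; auto. }
      destruct GB as [d [d0 H]]. exists d; split; auto.
      intros y Hy By N. apply H; auto.
      assert (Q := By k ltac:(lia)). apply abs_le_inv in Q. lra. }
  destruct (K m (le_n m) (fun _ => 0)) as [d [d0 H]].
  { intros i _; auto. } { intros i _. rewrite Rabs_R0; auto. }
  exists d; split; auto. intros y Hy By. apply H; auto. intros i Hi; lia.
Qed.

(** * The Poincare-Miranda theorem *)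

Fixpoint first_neg (g : nat -> R) (d : nat) : nat :=
  match d with
  | O => O
  | S d => if lt_dec (first_neg g d) d then first_neg g d
           else if Rlt_dec (g d) 0 then d else S d
  end.

Lemma first_neg_spec g d : (first_neg g d <= d)%nat /\
  ((first_neg g d < d)%nat -> g (first_neg g d) < 0) /\
  forall i, (i < first_neg g d)%nat -> 0 <= g i.
Proof.
  induction d as [|d [H1 [H2 H3]]]; simpl; [repeat split; intros; lia|].
  destruct (lt_dec (first_neg g d) d) as [l|l]; [repeat split; auto|].
  assert (e : first_neg g d = d) by lia. rewrite e in *.
  destruct (Rlt_dec (g d) 0); repeat split; auto; try lia.
  intros i Hi. destruct (Nat.eq_dec i d) as [->|]; [lra | apply H3; lia].
Qed.

(** Without a zero, compactness gives one radius [e] such that around each point some component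
    keeps a strict sign on the whole [e]-neighbourhood. A cell of a grid finer than [e] that carries
    all labels contradicts this. *)
Theorem poincare_miranda (d : nat) (K : R) (f : (nat -> R) -> nat -> R) : 0 < K ->
  (forall i, (i < d)%nat -> cont d (fun u => f u i)) ->
  (forall u i, inR d u -> box d K u -> (i < d)%nat ->
     (u i = - K -> f u i < 0) /\ (u i = K -> 0 < f u i)) ->
  exists u, inR d u /\ forall i, (i < d)%nat -> f u i = 0.
Proof.
  intros K0 Cf Bd. apply NNPP. intros No.
  destruct (compact_uniform d K (fun e y => exists i, (i < d)%nat /\
     ((forall y', inR d y' -> near d y y' e -> f y' i < 0) \/
      (forall y', inR d y' -> near d y y' e -> 0 < f y' i)))) as [e [e0 H]].
  { intros e e' y e'0 le [i [Hi [H|H]]]; exists i; (split; [exact Hi|]); [left|right];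
      intros y' Hy' N; apply H; auto; intros j Hj; specialize (N j Hj); lra. }
  { intros x Hx Bx.
    assert (exists i, (i < d)%nat /\ f x i <> 0) as [i [Hi Hne]].
    { apply NNPP. intros N. apply No. exists x. split; auto. intros i Hi.
      apply NNPP. intros N'. apply N. exists i. auto. }
    destruct (Cf i Hi x Hx (Rabs (f x i))) as [e [e0 H]]; [now apply Rabs_pos_lt|].
    exists (e / 2). split; [lra|]. intros y Hy By N. exists i. split; auto.
    assert (Q : forall y', inR d y' -> near d y y' (e/2) -> Rabs (f y' i - f x i) < Rabs (f x i)).
    { intros y' Hy' N'. apply H; auto. replace e with (e/2 + e/2) by lra.
      eapply near_trans; eauto. }
    destruct (Rlt_le_dec (f x i) 0) as [l|l].
    - left. intros y' Hy' N'. specialize (Q y' Hy' N'). rewrite (Rabs_left (f x i)) in Q by auto.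
      apply Rabs_def2 in Q. lra.
    - right. intros y' Hy' N'. specialize (Q y' Hy' N'). rewrite (Rabs_right (f x i)) in Q by lra.
      apply Rabs_def2 in Q. lra. }
  destruct (archimed_cor1 (e / (2 * K))) as [m [m1 m2]].
  { apply Rdiv_lt_0_compat; lra. }
  destruct m as [|m]; [lia|]. clear m2.
  set (h := 2 * K / INR (S m)).
  assert (mp : 0 < INR (S m)) by (apply lt_0_INR; lia).
  assert (h0 : 0 < h) by (apply Rdiv_lt_0_compat; lra).
  assert (he : h < e).
  { unfold h. apply (Rmult_lt_compat_l (2*K)) in m1; [|lra].
    replace (2 * K * (e / (2*K))) with e in m1 by (field; lra). exact m1. }
  set (pt := fun (v : nat -> nat) (i : nat) => if Nat.ltb i d then - K + h * INR (v i) else 0).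
  assert (ptR : forall v, inR d (pt v)).
  { intros v i Hi. unfold pt. destruct (Nat.ltb_spec i d); [lia|auto]. }
  assert (pti : forall v i, (i < d)%nat -> pt v i = - K + h * INR (v i)).
  { intros v i Hi. unfold pt. destruct (Nat.ltb_spec i d); [auto|lia]. }
  assert (hm : h * INR (S m) = 2 * K) by (unfold h; field; lra).
  assert (ptB : forall v, (forall i, (i < d)%nat -> (v i <= S m)%nat) -> box d K (pt v)).
  { intros v Hv i Hi. rewrite pti by auto. specialize (Hv i Hi). apply le_INR in Hv.
    assert (0 <= INR (v i)) by apply pos_INR.
    assert (0 <= h * INR (v i)) by nra. assert (h * INR (v i) <= h * INR (S m)) by nra.
    apply Rabs_le. lra. }
  destruct (kuhn_cube d m (fun v => first_neg (fun i => f (pt v) i) d)) as [v [Hv HL]].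
  { intros v Hv. destruct (first_neg_spec (fun i => f (pt v) i) d) as [S1 [S2 S3]].
    split; auto. intros i Hi. specialize (Bd (pt v) i (ptR v) (ptB v Hv) Hi).
    rewrite pti in Bd by auto. destruct Bd as [Bl Bh]. split; intros E.
    - rewrite E in Bl. simpl in Bl. specialize (Bl ltac:(lra)).
      apply Nat.nlt_ge. intros L. specialize (S3 i L). lra.
    - rewrite E, hm in Bh. specialize (Bh ltac:(lra)). intros E'. rewrite <- E' in Hi, Bh.
      specialize (S2 Hi). simpl in *. lra. }
  (* At the vertex labelled [d] no component is negative, so the component [i] of constant sign
     nearby is positive; but the vertex of the same cell labelled [i] has it negative. *)
  destruct (HL d (le_n d)) as [w [lw Hw]].
  assert (wB : box d K (pt w)).
  { apply ptB. intros i Hi. specialize (Hw i Hi). specialize (Hv i Hi). lia. }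
  destruct (H (pt w) (ptR w) wB) as [i [Hi [Hn|Hp]]].
  - specialize (Hn (pt w) (ptR w) (near_refl _ _ _ e0)).
    destruct (first_neg_spec (fun i => f (pt w) i) d) as [_ [_ S3]].
    rewrite lw in S3. specialize (S3 i Hi). simpl in S3. lra.
  - destruct (HL i) as [w' [lw' Hw']]; [lia|].
    destruct (first_neg_spec (fun i => f (pt w') i) d) as [_ [S2 _]].
    rewrite lw' in S2. specialize (S2 Hi). simpl in S2.
    assert (0 < f (pt w') i); [|lra]. apply Hp; auto.
    intros j Hj. rewrite !pti by auto. specialize (Hw j Hj). specialize (Hw' j Hj).
    destruct Hw as [a1 a2], Hw' as [b1 b2].
    apply le_INR in a1, a2, b1, b2. rewrite S_INR in a2, b2.
    apply Rabs_def1; nra.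
Qed.

(** On a cube larger than the displacement and the target together, [f u - c] has the sign of [u] on
    each face. This is the only topological input, used for inverting [sigma_map] and for
    linking. *)
Corollary bounded_displacement_surj (d : nat) (C : R) (f : (nat -> R) -> nat -> R) (c : nat -> R) :
  (forall i, (i < d)%nat -> cont d (fun u => f u i)) ->
  (forall u i, inR d u -> (i < d)%nat -> Rabs (f u i - u i) <= C) ->
  exists u, inR d u /\ forall i, (i < d)%nat -> f u i = c i.
Proof.
  intros Cf Df.
  set (K := Rabs C + 1 + fsum d (fun i => Rabs (c i))).
  assert (S0 : 0 <= fsum d (fun i => Rabs (c i))) by (apply fsum_nonneg; intros; apply Rabs_pos).
  assert (C0 := Rabs_pos C). assert (CC := Rle_abs C).
  destruct (poincare_miranda d K (fun u i => f u i - c i)) as [u [Hu H]].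
  - unfold K; lra.
  - intros i Hi v Hv e e0. destruct (Cf i Hi v Hv e e0) as [e' [e'0 H]]. exists e'; split; auto.
    intros w Hw N. replace (f w i - c i - (f v i - c i)) with (f w i - f v i) by ring. auto.
  - intros u i Hu Bu Hi. specialize (Df u i Hu Hi).
    assert (ci := fsum_term_le d (fun i => Rabs (c i)) i (fun _ _ => Rabs_pos _) Hi). simpl in ci.
    apply abs_le_inv in Df. assert (c1 := Rle_abs (c i)). assert (c2 := Rle_abs (- c i)).
    rewrite Rabs_Ropp in c2. unfold K. split; intros E; rewrite E in Df; lra.
  - exists u. split; auto. intros i Hi. specialize (H i Hi). simpl in H. lra.
Qed.

(** * Continuity and derivatives *)

Lemma cont_const m c : cont m (fun _ => c).
Proof. intros v Hv e e0. exists 1; split; [lra|]. intros. unfold Rminus. rewrite Rplus_opp_r, Rabs_R0; auto. Qed.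

Lemma cont_coord m i : (i < m)%nat -> cont m (fun v => v i).
Proof. intros Hi v Hv e e0. exists e; split; auto. Qed.

Lemma cont_ext m f g : (forall v, inR m v -> f v = g v) -> cont m f -> cont m g.
Proof.
  intros E H v Hv e e0. destruct (H v Hv e e0) as [d [d0 K]]. exists d; split; auto.
  intros w Hw N. rewrite <- !E by auto. auto.
Qed.

Lemma cont_plus m f g : cont m f -> cont m g -> cont m (fun v => f v + g v).
Proof.
  intros Hf Hg v Hv e e0.
  destruct (Hf v Hv (e/2)) as [d [d0 K]]; [lra|]. destruct (Hg v Hv (e/2)) as [d' [d'0 K']]; [lra|].
  exists (Rmin d d'). split; [apply Rmin_glb_lt; auto|]. intros w Hw N.
  specialize (K w Hw (near_le _ _ _ _ _ (Rmin_l d d') N)).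
  specialize (K' w Hw (near_le _ _ _ _ _ (Rmin_r d d') N)).
  replace (f w + g w - (f v + g v)) with ((f w - f v) + (g w - g v)) by ring.
  eapply Rle_lt_trans; [apply Rabs_triang | lra].
Qed.

Lemma cont_comp1 m (h : R -> R) f : (forall x, continuity_pt h x) -> cont m f -> cont m (fun v => h (f v)).
Proof.
  intros Hh Hf v Hv e e0. destruct (Hh (f v) e e0) as [d [d0 K]].
  destruct (Hf v Hv d d0) as [d' [d'0 K']]. exists d'; split; auto. intros w Hw N.
  specialize (K' w Hw N).
  destruct (Req_dec (f w) (f v)) as [E|E].
  - rewrite E. unfold Rminus. rewrite Rplus_opp_r, Rabs_R0; auto.
  - apply (K (f w)). split; [split; [exact I | auto]|]. exact K'.
Qed.

Lemma cont_scal m c f : cont m f -> cont m (fun v => c * f v).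
Proof.
  apply (cont_comp1 m (fun x => c * x)). intros x. apply derivable_continuous_pt.
  apply derivable_pt_scal, derivable_pt_id.
Qed.

Lemma cont_opp m f : cont m f -> cont m (fun v => - f v).
Proof. intros H. apply (cont_ext m (fun v => (-1) * f v)); [intros; ring | now apply cont_scal]. Qed.

Lemma cont_minus m f g : cont m f -> cont m g -> cont m (fun v => f v - g v).
Proof. intros Hf Hg. apply cont_plus; [auto | now apply cont_opp]. Qed.

Lemma cont_sqr m f : cont m f -> cont m (fun v => f v * f v).
Proof.
  apply (cont_comp1 m (fun x => x * x)). intros x. apply derivable_continuous_pt.
  apply (derivable_pt_mult id id); apply derivable_pt_id.
Qed.

Lemma cont_mult m f g : cont m f -> cont m g -> cont m (fun v => f v * g v).
Proof.
  intros Hf Hg.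
  (* Polarization reduces products to squares, which are compositions with a function of one
     variable. *)
  apply (cont_ext m (fun v => (/4) * ((f v + g v) * (f v + g v)) + (- / 4) * ((f v - g v) * (f v - g v)))).
  - intros; field.
  - apply cont_plus; apply cont_scal.
    + apply (cont_sqr m (fun v => f v + g v)). now apply cont_plus.
    + apply (cont_sqr m (fun v => f v - g v)). now apply cont_minus.
Qed.

Lemma cont_fsum m k (f : nat -> (nat -> R) -> R) :
  (forall i, (i < k)%nat -> cont m (f i)) -> cont m (fun v => fsum k (fun i => f i v)).
Proof.
  induction k; intros H; simpl; [apply cont_const|]. apply cont_plus; auto.
Qed.

Lemma cont_abs m f : cont m f -> cont m (fun v => Rabs (f v)).
Proof. apply cont_comp1. intros; apply Rcontinuity_abs. Qed.

Lemma cont_inv m f : (forall v, inR m v -> 0 < f v) -> cont m f -> cont m (fun v => / f v).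
Proof.
  intros Hp Hf v Hv e e0. specialize (Hp v Hv) as fp.
  assert (C : continuity_pt (fun x => / x) (f v)).
  { apply (continuity_pt_inv id). - apply derivable_continuous_pt, derivable_pt_id. - unfold id; lra. }
  destruct (C e e0) as [d [d0 K]].
  destruct (Hf v Hv d d0) as [d' [d'0 K']]. exists d'; split; auto. intros w Hw N.
  specialize (K' w Hw N).
  destruct (Req_dec (f w) (f v)) as [E|E].
  - rewrite E. unfold Rminus. rewrite Rplus_opp_r, Rabs_R0; auto.
  - apply (K (f w)). split; [split; [exact I | auto]|]. exact K'.
Qed.

Lemma cont_comp m k (f : (nat -> R) -> R) (s : (nat -> R) -> nat -> R) :
  cont k f -> (forall u, inR m u -> inR k (s u)) ->
  (forall i, (i < k)%nat -> cont m (fun u => s u i)) -> cont m (fun u => f (s u)).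
Proof.
  intros Hf Hs Cs v Hv e e0. destruct (Hf (s v) (Hs v Hv) e e0) as [d [d0 K]].
  assert (Q : forall j, (j <= k)%nat -> exists d', 0 < d' /\ forall w, inR m w -> near m v w d' ->
            near j (s v) (s w) d).
  { induction j; intros Hj.
    - exists 1; split; [lra|]. intros w _ _ i Hi; lia.
    - destruct IHj as [d1 [d10 H1]]; [lia|]. destruct (Cs j Hj v Hv d d0) as [d2 [d20 H2]].
      exists (Rmin d1 d2). split; [apply Rmin_glb_lt; auto|]. intros w Hw N i Hi.
      destruct (Nat.eq_dec i j) as [->|].
      + apply H2; auto. eapply near_le; [apply Rmin_r | eauto].
      + apply H1; auto; [|lia]. eapply near_le; [apply Rmin_l | eauto]. }
  destruct (Q k (le_n k)) as [d' [d'0 H]]. exists d'; split; auto.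
Qed.

Lemma cont_lip m f C : (forall v w, inR m v -> inR m w -> Rabs (f w - f v) <= C * dist1 m v w) -> cont m f.
Proof.
  intros H v Hv e e0.
  assert (M0 : 0 <= INR m) by apply pos_INR. assert (C0 := Rabs_pos C).
  assert (D : 0 < Rabs C * INR m + 1) by nra.
  exists (e / (Rabs C * INR m + 1)). split; [apply Rdiv_lt_0_compat; lra|].
  intros w Hw N. specialize (H v w Hv Hw). apply dist1_near in N.
  assert (CC := Rle_abs C). assert (d0 := dist1_nonneg m v w).
  assert (E : Rabs C * (INR m * (e / (Rabs C * INR m + 1))) < e).
  { replace (Rabs C * (INR m * (e / (Rabs C * INR m + 1)))) with
      (e - e / (Rabs C * INR m + 1)) by (field; lra).
    assert (0 < e / (Rabs C * INR m + 1)) by (apply Rdiv_lt_0_compat; lra). lra. }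
  nra.
Qed.

Lemma cont_bounded m f B : cont m f -> exists C, 0 < C /\ forall v, inR m v -> box m B v -> Rabs (f v) <= C.
Proof.
  intros Hf. destruct (compact_uniform m B (fun d y => Rabs (f y) <= / d)) as [d [d0 H]].
  - intros d d' y d'0 le Hy. eapply Rle_trans; [exact Hy|]. now apply Rinv_le_contravar.
  - intros x Hx Bx. destruct (Hf x Hx 1) as [d [d0 K]]; [lra|].
    assert (P := Rabs_pos (f x)).
    assert (D : 0 < / (Rabs (f x) + 1)) by (apply Rinv_0_lt_compat; lra).
    exists (Rmin d (/ (Rabs (f x) + 1))). split; [apply Rmin_glb_lt; auto|].
    intros y Hy By N. apply (Rle_trans _ (Rabs (f x) + 1)).
    + specialize (K y Hy (near_le _ _ _ _ _ (Rmin_l _ _) N)).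
      assert (T := Rabs_triang (f x) (f y - f x)).
      replace (f x + (f y - f x)) with (f y) in T by ring. lra.
    + apply (Rle_trans _ (/ / (Rabs (f x) + 1))); [rewrite Rinv_inv; lra|].
      apply Rinv_le_contravar; [apply Rmin_glb_lt; auto | apply Rmin_r].
  - exists (/ d). split; [now apply Rinv_0_lt_compat | exact H].
Qed.

Lemma cont_uniform m f B e : cont m f -> 0 < e -> exists d, 0 < d /\ forall v w,
  inR m v -> inR m w -> box m B v -> near m v w d -> Rabs (f w - f v) <= e.
Proof.
  intros Hf e0. destruct (compact_uniform m B (fun d y => forall w, inR m w -> near m y w d -> Rabs (f w - f y) <= e))
    as [d [d0 H]].
  - intros d d' y d'0 le Hy w Hw N. apply Hy; auto. eapply near_le; eauto.
  - intros x Hx Bx. destruct (Hf x Hx (e/2)) as [d [d0 K]]; [lra|].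
    exists (d/2). split; [lra|]. intros y Hy By N w Hw N'.
    assert (K1 := K y Hy (near_le _ _ _ (d/2) d ltac:(lra) N)).
    assert (N2 : near m x w d). { replace d with (d/2+d/2) by lra. eapply near_trans; eauto. }
    assert (K2 := K w Hw N2).
    replace (f w - f y) with ((f w - f x) + - (f y - f x)) by ring.
    eapply Rle_trans; [apply Rabs_triang|]. rewrite Rabs_Ropp. lra.
  - exists d; split; auto.
Qed.

(** * Partial and Frechet derivatives *)

Definition partials (M : nat) (f : (nat -> R) -> R) (g : nat -> (nat -> R) -> R) :=
  forall v i, inR M v -> (i < M)%nat -> derivable_pt_lim (fun s => f (upd v i s)) 0 (g i v).

Lemma partials_along M f g v i s : partials M f g -> inR M v -> (i < M)%nat ->
  derivable_pt_lim (fun s => f (upd v i s)) s (g i (upd v i s)).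
Proof.
  intros H Hv Hi e e0. destruct (H (upd v i s) i (upd_inR _ _ _ _ Hi Hv) Hi e e0) as [d K].
  exists d. intros h h0 hd. specialize (K h h0 hd).
  rewrite Rplus_0_l, upd_0, upd_upd in K. exact K.
Qed.

(* The segment from v to w is replaced by a path changing one coordinate at a time. *)
Lemma mean_value_bound M f g a eps v w : partials M f g -> inR M v -> inR M w ->
  (forall u i, inR M u -> (i < M)%nat ->
     (forall j, (j < M)%nat -> Rmin (v j) (w j) <= u j <= Rmax (v j) (w j)) ->
     Rabs (g i u - a i) <= eps) ->
  Rabs (f w - f v - fsum M (fun i => a i * (w i - v i))) <= eps * dist1 M v w.
Proof.
  intros Hp Hv Hw Hb.
  set (h := fun k i => if Nat.ltb i k then w i else v i).
  assert (hR : forall k, inR M (h k)).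
  { intros k i Hi. unfold h. destruct (Nat.ltb i k); auto. }
  assert (h0 : h 0%nat = v) by (apply functional_extensionality; intros; reflexivity).
  assert (hM : h M = w).
  { apply (inR_ext M); auto. intros i Hi. unfold h. destruct (Nat.ltb_spec i M); [auto|lia]. }
  assert (K : forall k, (k <= M)%nat ->
    Rabs (f (h k) - f v - fsum k (fun i => a i * (w i - v i))) <= eps * dist1 k v w).
  { induction k as [|k IH]; intros Hk.
    - rewrite h0. unfold dist1; simpl. replace (f v - f v - 0) with 0 by ring. rewrite Rabs_R0; lra.
    - specialize (IH ltac:(lia)). unfold dist1 in *. simpl.
      assert (E : f (h (S k)) = f (upd (h k) k (1 * (w k - v k)))).
      { f_equal. apply functional_extensionality. intros i. unfold h, upd.
        destruct (Nat.eqb_spec i k) as [->|ne].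
        - rewrite Nat.ltb_irrefl. destruct (Nat.ltb_spec k (S k)); [ring|lia].
        - destruct (Nat.ltb_spec i k); destruct (Nat.ltb_spec i (S k)); auto; lia. }
      destruct (MVT_cor2 (fun s => f (upd (h k) k (s * (w k - v k))))
        (fun s => g k (upd (h k) k (s * (w k - v k))) * (1 * (w k - v k))) 0 1) as [c [Hc1 Hc2]]; [lra| |].
      { intros c _. apply (derivable_pt_lim_comp (fun s => s * (w k - v k)) (fun s => f (upd (h k) k s))).
        - replace (1 * (w k - v k)) with (1 * (w k - v k) + c * 0) by ring.
          apply (derivable_pt_lim_mult id (fun _ => w k - v k)).
          + apply derivable_pt_lim_id. + apply derivable_pt_lim_const.
        - apply partials_along with (M := M); auto; lia. }
      simpl in Hc1. rewrite <- E, Rmult_0_l, upd_0 in Hc1.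
      assert (Q := Hb (upd (h k) k (c * (w k - v k))) k).
      assert (Q' : Rabs (g k (upd (h k) k (c * (w k - v k))) - a k) <= eps).
      { apply Q; [apply upd_inR; auto; lia | lia |]. intros j Hj. unfold upd, h.
        assert (Rmin (v j) (w j) <= v j <= Rmax (v j) (w j)) by (split; [apply Rmin_l | apply Rmax_l]).
        assert (Rmin (v j) (w j) <= w j <= Rmax (v j) (w j)) by (split; [apply Rmin_r | apply Rmax_r]).
        destruct (Nat.eqb_spec j k) as [->|ne].
        - rewrite Nat.ltb_irrefl. nra.
        - destruct (Nat.ltb j k); lra. }
      set (gk := g k (upd (h k) k (c * (w k - v k)))) in *.
      replace (f (h (S k)) - f v - (fsum k (fun i => a i * (w i - v i)) + a k * (w k - v k)))
        with ((f (h k) - f v - fsum k (fun i => a i * (w i - v i))) + (gk - a k) * (w k - v k))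
        by lra.
      eapply Rle_trans; [apply Rabs_triang|]. rewrite Rabs_mult.
      assert (P := Rabs_pos (w k - v k)). nra. }
  specialize (K M (le_n M)). rewrite hM in K. exact K.
Qed.

Definition frechet (M : nat) (f : (nat -> R) -> R) (A : nat -> R) (v : nat -> R) :=
  forall eps, 0 < eps -> exists d, 0 < d /\ forall w, inR M w -> near M v w d ->
    Rabs (f w - f v - fsum M (fun i => A i * (w i - v i))) <= eps * dist1 M v w.

Lemma uniform_near M (P : nat -> (nat -> R) -> Prop) v :
  (forall i, (i < M)%nat -> exists d, 0 < d /\ forall w, inR M w -> near M v w d -> P i w) ->
  exists d, 0 < d /\ forall w i, inR M w -> near M v w d -> (i < M)%nat -> P i w.
Proof.
  intros H. assert (Q : forall k, (k <= M)%nat -> exists d, 0 < d /\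
    forall w i, inR M w -> near M v w d -> (i < k)%nat -> P i w).
  { induction k; intros Hk.
    - exists 1; split; [lra|]. intros; lia.
    - destruct IHk as [d [d0 K]]; [lia|]. destruct (H k Hk) as [d' [d'0 K']].
      exists (Rmin d d'). split; [apply Rmin_glb_lt; auto|]. intros w i Hw N Hi.
      destruct (Nat.eq_dec i k) as [->|].
      + apply K'; auto. eapply near_le; [apply Rmin_r|eauto].
      + apply K; auto; [|lia]. eapply near_le; [apply Rmin_l|eauto]. }
  apply (Q M (le_n M)).
Qed.

Lemma partials_frechet M f g v : partials M f g -> (forall i, (i < M)%nat -> cont M (g i)) ->
  inR M v -> frechet M f (fun i => g i v) v.
Proof.
  intros Hp Hc Hv eps e0.
  destruct (uniform_near M (fun i w => Rabs (g i w - g i v) < eps) v) as [d [d0 K]].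
  { intros i Hi. apply (Hc i Hi v Hv eps e0). }
  exists d. split; auto. intros w Hw N. apply (mean_value_bound M f g); auto.
  intros u i Hu Hi Hb. apply Rlt_le, K; auto. intros j Hj. specialize (N j Hj). specialize (Hb j Hj).
  apply Rabs_def2 in N. unfold Rmin, Rmax in Hb. destruct (Rle_dec (v j) (w j)); apply Rabs_def1; lra.
Qed.

Lemma derivable_pt_lim_little f x l : derivable_pt_lim f x l <->
  forall e, 0 < e -> exists d, 0 < d /\ forall h, Rabs h < d -> Rabs (f (x + h) - f x - l * h) <= e * Rabs h.
Proof.
  split.
  - intros H e e0. destruct (H e e0) as [d K]. exists d. split; [apply cond_pos|]. intros h hd.
    destruct (Req_dec h 0) as [->|h0].
    + rewrite Rplus_0_r. replace (f x - f x - l * 0) with 0 by ring. rewrite Rabs_R0; lra.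
    + specialize (K h h0 hd). replace (f (x + h) - f x - l * h) with (((f (x+h) - f x)/h - l) * h) by (field; auto).
      rewrite Rabs_mult. apply Rmult_le_compat_r; [apply Rabs_pos | lra].
  - intros H e e0. destruct (H (e/2)) as [d [d0 K]]; [lra|]. exists (mkposreal d d0). intros h h0 hd.
    specialize (K h hd). replace ((f (x + h) - f x) / h - l) with ((f (x+h) - f x - l * h) * / h) by (field; auto).
    rewrite Rabs_mult, Rabs_inv. assert (P := Rabs_pos_lt h h0).
    apply (Rle_lt_trans _ (e/2 * Rabs h * / Rabs h)).
    + apply Rmult_le_compat_r; [left; now apply Rinv_0_lt_compat | exact K].
    + replace (e/2 * Rabs h * / Rabs h) with (e/2) by (field; lra). lra.
Qed.

Lemma frechet_curve M f A (c : R -> nat -> R) c' t : frechet M f A (c t) ->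
  (forall s, inR M (c s)) -> (forall i, (i < M)%nat -> derivable_pt_lim (fun s => c s i) t (c' i)) ->
  derivable_pt_lim (fun s => f (c s)) t (fsum M (fun i => A i * c' i)).
Proof.
  intros Hf Hc Hd. apply derivable_pt_lim_little. intros e e0.
  set (Kc := fsum M (fun i => Rabs (c' i)) + INR M).
  assert (Kc0 : 0 <= Kc).
  { unfold Kc. assert (0 <= fsum M (fun i => Rabs (c' i))) by (apply fsum_nonneg; intros; apply Rabs_pos).
    assert (0 <= INR M) by apply pos_INR. lra. }
  set (KA := fsum M (fun i => Rabs (A i))).
  assert (KA0 : 0 <= KA) by (apply fsum_nonneg; intros; apply Rabs_pos).
  set (e1 := e / (2 * (Kc + 1))). assert (e10 : 0 < e1) by (apply Rdiv_lt_0_compat; lra).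
  set (e2 := Rmin 1 (e / (2 * (KA + 1)))).
  assert (e20 : 0 < e2) by (apply Rmin_glb_lt; [lra | apply Rdiv_lt_0_compat; lra]).
  assert (Q : forall k, (k <= M)%nat -> exists d, 0 < d /\ forall h i, Rabs h < d -> (i < k)%nat ->
     Rabs (c (t + h) i - c t i - c' i * h) <= e2 * Rabs h).
  { induction k; intros Hk; [exists 1; split; [lra | intros; lia]|].
    destruct IHk as [d [d0 K]]; [lia|].
    destruct (proj1 (derivable_pt_lim_little _ _ _) (Hd k Hk) e2 e20) as [d' [d'0 K']].
    exists (Rmin d d'). split; [apply Rmin_glb_lt; auto|]. intros h i hd Hi.
    assert (L1 := Rmin_l d d'). assert (L2 := Rmin_r d d').
    destruct (Nat.eq_dec i k) as [->|]; [apply K'; lra | apply K; [lra|lia]]. }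
  destruct (Q M (le_n M)) as [d1 [d10 K1]].
  destruct (Hf e1 e10) as [d2 [d20 K2]].
  exists (Rmin d1 (d2 / (Kc + 1))). split; [apply Rmin_glb_lt; [auto | apply Rdiv_lt_0_compat; lra]|].
  intros h hd. assert (hd1 := Rlt_le_trans _ _ _ hd (Rmin_l _ _)). assert (hd2 := Rlt_le_trans _ _ _ hd (Rmin_r _ _)).
  assert (ph := Rabs_pos h).
  assert (dd : dist1 M (c t) (c (t + h)) <= Kc * Rabs h).
  { unfold dist1, Kc.     apply (Rle_trans _ (fsum M (fun i => Rabs h * (Rabs (c' i) + 1)))).
    - apply fsum_le. intros i Hi. specialize (K1 h i hd1 Hi).
      replace (c (t + h) i - c t i) with ((c (t + h) i - c t i - c' i * h) + c' i * h) by ring.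
      eapply Rle_trans; [apply Rabs_triang|]. rewrite Rabs_mult.
      assert (e2 <= 1) by apply Rmin_l. nra.
    - rewrite fsum_scal, fsum_plus, fsum_const. lra. }
  assert (N : near M (c t) (c (t + h)) d2).
  { apply near_dist1. apply (Rle_lt_trans _ _ _ dd).
    apply (Rle_lt_trans _ ((Kc + 1) * Rabs h)); [nra|].
    apply (Rmult_lt_compat_l (Kc+1)) in hd2; [|lra].
    replace ((Kc + 1) * (d2 / (Kc + 1))) with d2 in hd2 by (field; lra). exact hd2. }
  specialize (K2 (c (t + h)) (Hc _) N).
  assert (S1 : Rabs (fsum M (fun i => A i * (c (t+h) i - c t i)) - fsum M (fun i => A i * c' i) * h) <= KA * (e2 * Rabs h)).
  { rewrite (Rmult_comm _ h), <- fsum_scal, <- fsum_minus. eapply Rle_trans; [apply fsum_abs|].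
    unfold KA. rewrite (Rmult_comm _ (e2 * _)), <- fsum_scal. apply fsum_le. intros i Hi.
    replace (A i * (c (t+h) i - c t i) - h * (A i * c' i)) with (A i * (c (t+h) i - c t i - c' i * h)) by ring.
    rewrite Rabs_mult. specialize (K1 h i hd1 Hi). assert (P := Rabs_pos (A i)). nra. }
  replace (f (c (t+h)) - f (c t) - fsum M (fun i => A i * c' i) * h) with
    ((f (c (t+h)) - f (c t) - fsum M (fun i => A i * (c (t+h) i - c t i))) +
     (fsum M (fun i => A i * (c (t+h) i - c t i)) - fsum M (fun i => A i * c' i) * h)) by ring.
  eapply Rle_trans; [apply Rabs_triang|].
  assert (B1 : e1 * dist1 M (c t) (c (t + h)) <= e/2 * Rabs h).
  { apply (Rle_trans _ (e1 * (Kc * Rabs h))); [nra|].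
    replace (e/2 * Rabs h) with (e1 * ((Kc+1) * Rabs h)) by (unfold e1; field; lra). nra. }
  assert (B2 : KA * (e2 * Rabs h) <= e/2 * Rabs h).
  { assert (e2 <= e / (2 * (KA + 1))) by apply Rmin_r.
    apply (Rle_trans _ (KA * (e / (2 * (KA+1)) * Rabs h))); [apply Rmult_le_compat_l; nra|].
    replace (e/2 * Rabs h) with ((KA + 1) * (e / (2 * (KA+1)) * Rabs h)) by (field; lra).
    assert (0 < e / (2 * (KA + 1))) by (apply Rdiv_lt_0_compat; lra). nra. }
  lra.
Qed.

(** * Families of functions depending on time *)

Lemma derivable_pt_lim_ext_near f g x l d : 0 < d ->
  (forall h, Rabs h < d -> f (x + h) = g (x + h)) ->
  derivable_pt_lim f x l -> derivable_pt_lim g x l.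
Proof.
  intros d0 E H e e0. destruct (H e e0) as [d' K].
  assert (P : 0 < Rmin d d') by (apply Rmin_glb_lt; [auto | apply cond_pos]).
  exists (mkposreal _ P). intros h h0 hd. simpl in hd.
  assert (h1 := Rlt_le_trans _ _ _ hd (Rmin_l _ _)). assert (h2 := Rlt_le_trans _ _ _ hd (Rmin_r _ _)).
  rewrite <- E by auto. rewrite <- (Rplus_0_r x) at 2. rewrite <- E by (rewrite Rabs_R0; auto).
  rewrite Rplus_0_r. apply K; auto.
Qed.

Lemma derivable_pt_lim_shift f x l :
  derivable_pt_lim (fun s => f (x + s)) 0 l <-> derivable_pt_lim f x l.
Proof.
  split; intros H e e0; destruct (H e e0) as [d K]; exists d; intros h h0 hd; specialize (K h h0 hd).
  - now rewrite Rplus_0_l, Rplus_0_r in K.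
  - now rewrite Rplus_0_l, Rplus_0_r.
Qed.

Lemma partials_minus M f f' g g' : partials M f g -> partials M f' g' ->
  partials M (fun v => f v - f' v) (fun i v => g i v - g' i v).
Proof. intros H H' v i Hv Hi. apply derivable_pt_lim_minus; auto. Qed.

Lemma partials_scal M c f g : partials M f g -> partials M (fun v => c * f v) (fun i v => c * g i v).
Proof. intros H v i Hv Hi. apply (derivable_pt_lim_scal (fun s => f (upd v i s))); auto. Qed.

Lemma partials_fsum M k f g : (forall j, (j < k)%nat -> partials M (f j) (g j)) ->
  partials M (fun v => fsum k (fun j => f j v)) (fun i v => fsum k (fun j => g j i v)).
Proof.
  induction k; intros H v i Hv Hi; simpl.
  - apply derivable_pt_lim_const.
  - apply (derivable_pt_lim_plus (fun s => fsum k (fun j => f j (upd v i s))) (fun s => f k (upd v i s))).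
    + apply IHk; auto.
    + apply H; auto.
Qed.

Lemma Ck_cont M k f : Ck M k f -> cont M f.
Proof. destruct k; simpl; tauto. Qed.

(** Choice gathers the derivatives hidden in the existential of [Ck] into one family, so that they
    can be used simultaneously. *)
Lemma Ck_partials M k f : Ck M (S k) f -> exists g, partials M f g /\ forall i, (i < M)%nat -> Ck M k (g i).
Proof.
  intros [_ H].
  exists (fun i => match lt_dec i M with
     | left l => proj1_sig (constructive_indefinite_description _ (H i l))
     | right _ => fun _ => 0 end).
  split.
  - intros v i Hv Hi. destruct (lt_dec i M) as [l|]; [|lia].
    destruct (constructive_indefinite_description _ (H i l)) as [g [Hg Cg]]. simpl. auto.
  - intros i Hi. destruct (lt_dec i M) as [l|]; [|lia].
    destruct (constructive_indefinite_description _ (H i l)) as [g [Hg Cg]]. simpl. auto.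
Qed.

Lemma C1_minus M f g : Ck M 1 f -> Ck M 1 g -> Ck M 1 (fun v => f v - g v).
Proof.
  intros [Cf Hf] [Cg Hg]. split; [now apply cont_minus|]. intros i Hi.
  destruct (Hf i Hi) as [f' [Df Cf']]. destruct (Hg i Hi) as [g' [Dg Cg']].
  exists (fun v => f' v - g' v). split; [|now apply cont_minus].
  intros v Hv. apply derivable_pt_lim_minus; auto.
Qed.

Lemma C1_mult M f g : Ck M 1 f -> Ck M 1 g -> Ck M 1 (fun v => f v * g v).
Proof.
  intros [Cf Hf] [Cg Hg]. split; [now apply cont_mult|]. intros i Hi.
  destruct (Hf i Hi) as [f' [Df Cf']]. destruct (Hg i Hi) as [g' [Dg Cg']]. simpl in Cf', Cg'.
  exists (fun v => f' v * g v + f v * g' v).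
  split; [|apply cont_plus; now apply cont_mult].
  intros v Hv.
  assert (Q := derivable_pt_lim_mult (fun s => f (upd v i s)) (fun s => g (upd v i s)) 0 _ _ (Df v Hv) (Dg v Hv)).
  cbv beta in Q. rewrite !upd_0 in Q. exact Q.
Qed.

Lemma C1_fsum M k (f : nat -> (nat -> R) -> R) : (forall j, (j < k)%nat -> Ck M 1 (f j)) ->
  Ck M 1 (fun v => fsum k (fun j => f j v)).
Proof.
  intros H. split; [apply cont_fsum; intros; eapply Ck_cont; eauto|]. intros i Hi.
  induction k; simpl.
  - exists (fun _ => 0). split; [intros; apply derivable_pt_lim_const | apply cont_const].
  - destruct IHk as [g [Dg Cg]]; [auto with arith|]. destruct (H k) as [_ Hk]; auto.
    destruct (Hk i Hi) as [f' [Df Cf']]. exists (fun v => g v + f' v). simpl in *.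
    split; [|now apply cont_plus]. intros v Hv.
    apply (derivable_pt_lim_plus (fun s => fsum k (fun j => f j (upd v i s))) (fun s => f k (upd v i s))); auto.
Qed.

Definition pack (m : nat) (t : R) (r : nat -> R) : nat -> R := fun i => if Nat.eqb i m then t else r i.

Lemma pack_inR m t r : inR m r -> inR (S m) (pack m t r).
Proof. intros H i Hi. unfold pack. destruct (Nat.eqb_spec i m); [lia | apply H; lia]. Qed.

Lemma pack_time m t r : pack m t r m = t.
Proof. unfold pack. now rewrite Nat.eqb_refl. Qed.

Lemma pack_lt m t r i : (i < m)%nat -> pack m t r i = r i.
Proof. intros. unfold pack. destruct (Nat.eqb_spec i m); [lia | auto]. Qed.

Lemma trunc_pack m t r : inR m r -> trunc m (pack m t r) = r.
Proof.
  intros H. apply (inR_ext m); [apply trunc_inR | auto |]. intros i Hi.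
  rewrite trunc_lt, pack_lt; auto.
Qed.

Lemma upd_pack m t r i s : (i < m)%nat -> upd (pack m t r) i s = pack m t (upd r i s).
Proof.
  intros Hi. apply functional_extensionality. intros j. unfold upd, pack.
  destruct (Nat.eqb_spec j i), (Nat.eqb_spec j m); auto; lia.
Qed.

Lemma upd_pack_time m t r s : upd (pack m t r) m s = pack m (t + s) r.
Proof.
  apply functional_extensionality. intros j. unfold upd, pack. now destruct (Nat.eqb_spec j m).
Qed.

Lemma pack_near m t t' r r' d : Rabs (t' - t) < d -> near m r r' d -> near (S m) (pack m t r) (pack m t' r') d.
Proof.
  intros H N i Hi. unfold pack. destruct (Nat.eqb_spec i m); [auto | apply N; lia].
Qed.

Lemma pack_dist1 m t t' r r' : dist1 (S m) (pack m t r) (pack m t' r') = dist1 m r r' + Rabs (t' - t).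
Proof.
  unfold dist1. simpl. rewrite !pack_time. f_equal. apply fsum_ext. intros i Hi. now rewrite !pack_lt.
Qed.

Lemma pack_box m t r B : box m B r -> 0 <= t <= 1 -> box (S m) (Rmax B 1) (pack m t r).
Proof.
  intros H Ht i Hi. unfold pack. destruct (Nat.eqb_spec i m).
  - apply (Rle_trans _ 1); [apply Rabs_le; lra | apply Rmax_r].
  - apply (Rle_trans _ B); [apply H; lia | apply Rmax_l].
Qed.

Definition off (m : nat) (B : R) (r : nat -> R) := exists i, (i < m)%nat /\ B < Rabs (r i).

Lemma off_or_box m B r : off m B r \/ box m B r.
Proof.
  destruct (classic (off m B r)) as [|N]; [auto|]. right. intros i Hi.
  apply Rnot_lt_le. intros L. apply N. exists i; auto.
Qed.

Lemma off_upd m B r k : off m B r -> exists d, 0 < d /\ forall s, Rabs s < d -> off m B (upd r k s).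
Proof.
  intros [i [Hi L]]. exists (Rabs (r i) - B). split; [lra|]. intros s Hs. exists i. split; auto.
  unfold upd. destruct (Nat.eqb i k); [|auto].
  assert (T := Rabs_triang (r i + s) (-s)). rewrite Rabs_Ropp in T.
  replace (r i + s + - s) with (r i) in T by ring. lra.
Qed.

Section Family.
Variables (m : nat) (B : R) (h : (nat -> R) -> R) (g : nat -> (nat -> R) -> R).
Variables (a b : R) (j : nat).
Hypothesis Hp : partials (S m) h g.
Hypothesis Hc : forall i, (i < S m)%nat -> cont (S m) (g i).
(** This covers the components of the isotopy ([a = 1], [b = 0]) and its conformal factor ([a = 0],
    [b = 1]). Beyond the box both are affine and independent of time, so bounds over a compact box
    become global. *)
Hypothesis Hoff : forall t r, 0 <= t <= 1 -> inR m r -> off m B r -> h (pack m t r) = a * r j + b.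

Lemma family_off_partial t r i : 0 <= t <= 1 -> inR m r -> off m B r -> (i < m)%nat ->
  g i (pack m t r) = if Nat.eqb j i then a else 0.
Proof.
  intros Ht Hr Ho Hi. destruct (off_upd m B r i Ho) as [d [d0 Hd]].
  apply (uniqueness_limite (fun s => a * upd r i s j + b) 0).
  - apply (derivable_pt_lim_ext_near (fun s => h (upd (pack m t r) i s)) _ 0 _ d d0).
    + intros s Hs. rewrite Rplus_0_l, upd_pack by auto. apply Hoff; auto. now apply upd_inR.
    + apply Hp; [now apply pack_inR | lia].
  - replace (if Nat.eqb j i then a else 0) with (a * (if Nat.eqb j i then 1 else 0) + 0)
      by (destruct (Nat.eqb j i); ring).
    apply (derivable_pt_lim_plus (fun s => a * upd r i s j) (fun _ => b)); [|apply derivable_pt_lim_const].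
    apply (derivable_pt_lim_scal (fun s => upd r i s j)). unfold upd. destruct (Nat.eqb j i).
    + replace 1 with (0 + 1) by ring.
      apply (derivable_pt_lim_plus (fun _ => r j) id); [apply derivable_pt_lim_const | apply derivable_pt_lim_id].
    + apply derivable_pt_lim_const.
Qed.

Lemma family_slice t : partials m (fun r => h (pack m t r)) (fun i r => g i (pack m t r)).
Proof.
  intros r i Hr Hi. assert (Q := Hp (pack m t r) i (pack_inR _ _ _ Hr) ltac:(lia)).
  eapply derivable_pt_lim_ext_near; [apply Rlt_0_1 | | exact Q].
  intros s _. simpl. now rewrite upd_pack by auto.
Qed.

Lemma family_bound : exists C, 0 < C /\ forall t r i, 0 <= t <= 1 -> inR m r -> (i < m)%nat ->
  Rabs (g i (pack m t r)) <= C.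
Proof.
  assert (Q : forall k, (k <= m)%nat -> exists C, 0 < C /\ forall t r i, 0 <= t <= 1 -> inR m r -> (i < k)%nat ->
     Rabs (g i (pack m t r)) <= C).
  { induction k; intros Hk; [exists 1; split; [lra | intros; lia]|].
    destruct IHk as [C [C0 K]]; [lia|].
    destruct (cont_bounded (S m) (g k) (Rmax B 1)) as [C' [C'0 K']]; [apply Hc; lia|].
    exists (C + C' + Rabs a). assert (P := Rabs_pos a). split; [lra|]. intros t r i Ht Hr Hi.
    destruct (Nat.eq_dec i k) as [->|].
    - destruct (off_or_box m B r) as [Ho|Hb].
      + rewrite family_off_partial by (auto; lia). destruct (Nat.eqb j k); [lra | rewrite Rabs_R0; lra].
      + apply (Rle_trans _ C'); [|lra]. apply K'; [now apply pack_inR | now apply pack_box].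
    - apply (Rle_trans _ C); [apply K; auto; lia | lra]. }
  apply (Q m (le_n m)).
Qed.

Lemma family_lip : exists C, 0 < C /\ forall t r r', 0 <= t <= 1 -> inR m r -> inR m r' ->
  Rabs (h (pack m t r') - h (pack m t r)) <= C * dist1 m r r'.
Proof.
  destruct family_bound as [C [C0 K]]. exists C. split; auto. intros t r r' Ht Hr Hr'.
  assert (Q := mean_value_bound m _ _ (fun _ => 0) C r r' (family_slice t) Hr Hr').
  rewrite fsum_zero, Rminus_0_r in Q by (intros; ring). apply Q.
  intros u i Hu Hi _. rewrite Rminus_0_r. auto.
Qed.

Lemma family_time_lip : exists C, 0 < C /\ forall t t' r, 0 <= t <= 1 -> 0 <= t' <= 1 -> inR m r ->
  Rabs (h (pack m t' r) - h (pack m t r)) <= C * Rabs (t' - t).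
Proof.
  destruct (cont_bounded (S m) (g m) (Rmax B 1)) as [C [C0 K]]; [apply Hc; lia|].
  exists C; split; auto. intros t t' r Ht Ht' Hr.
  destruct (off_or_box m B r) as [Ho|Hb].
  - rewrite !Hoff by auto. unfold Rminus at 1. rewrite Rplus_opp_r, Rabs_R0.
    assert (P := Rabs_pos (t' - t)). nra.
  - destruct (Req_dec t t') as [->|ne].
    { unfold Rminus. rewrite !Rplus_opp_r, Rabs_R0. lra. }
    assert (L : forall x y, 0 <= x <= 1 -> 0 <= y <= 1 -> x < y ->
        Rabs (h (pack m y r) - h (pack m x r)) <= C * Rabs (y - x)).
    { intros x y Hx Hy xy.
      destruct (MVT_cor2 (fun s => h (pack m s r)) (fun s => g m (pack m s r)) x y xy) as [c [Hc1 Hc2]].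
      { intros c Hc'. apply derivable_pt_lim_shift.
        eapply derivable_pt_lim_ext_near; [apply Rlt_0_1 | | apply (Hp (pack m c r) m); [now apply pack_inR|lia]].
        intros s _. simpl. now rewrite upd_pack_time. }
      simpl in Hc1. rewrite Hc1, Rabs_mult. apply Rmult_le_compat_r; [apply Rabs_pos|].
      apply K; [now apply pack_inR | apply pack_box; auto; lra]. }
    destruct (Rlt_le_dec t t'); [auto|]. rewrite Rabs_minus_sym, (Rabs_minus_sym t' t). apply L; auto; lra.
Qed.

(** Spatial derivatives are uniformly continuous in time, so the difference of two nearby time
    slices has a small Lipschitz constant. This is the form in which closeness in the C^1 sense is
    used. *)
Lemma family_small t0 e : 0 <= t0 <= 1 -> 0 < e -> exists d, 0 < d /\ forall t t' r r',
  0 <= t <= 1 -> 0 <= t' <= 1 -> Rabs (t - t0) < d -> Rabs (t' - t0) < d -> inR m r -> inR m r' ->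
  Rabs ((h (pack m t' r') - h (pack m t r')) - (h (pack m t' r) - h (pack m t r))) <= e * dist1 m r r'.
Proof.
  intros Ht0 e0.
  assert (Q : forall k, (k <= m)%nat -> exists d, 0 < d /\ forall t t' r i, 0 <= t <= 1 -> 0 <= t' <= 1 ->
    Rabs (t - t0) < d -> Rabs (t' - t0) < d -> inR m r -> (i < k)%nat ->
    Rabs (g i (pack m t' r) - g i (pack m t r)) <= e).
  { induction k; intros Hk; [exists 1; split; [lra | intros; lia]|].
    destruct IHk as [d [d0 K]]; [lia|].
    destruct (cont_uniform (S m) (g k) (Rmax B 1) e) as [d' [d'0 K']]; [apply Hc; lia | auto |].
    exists (Rmin d (d' / 2)). split; [apply Rmin_glb_lt; lra|]. intros t t' r i Ht Ht' T T' Hr Hi.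
    assert (L1 := Rmin_l d (d'/2)). assert (L2 := Rmin_r d (d'/2)).
    destruct (Nat.eq_dec i k) as [->|].
    - destruct (off_or_box m B r) as [Ho|Hb].
      + rewrite !family_off_partial by (auto; lia). unfold Rminus. rewrite Rplus_opp_r, Rabs_R0. lra.
      + apply K'; [now apply pack_inR | now apply pack_inR | now apply pack_box |].
        apply pack_near; [|now apply near_refl].
        replace (t' - t) with ((t' - t0) + - (t - t0)) by ring.
        eapply Rle_lt_trans; [apply Rabs_triang|]. rewrite Rabs_Ropp. lra.
    - apply K; auto; try lra. lia. }
  destruct (Q m (le_n m)) as [d [d0 K]]. exists d. split; auto.
  intros t t' r r' Ht Ht' T T' Hr Hr'.
  assert (M := mean_value_bound m _ _ (fun _ => 0) e r r'
    (partials_minus _ _ _ _ _ (family_slice t') (family_slice t)) Hr Hr').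
  simpl in M. rewrite fsum_zero, Rminus_0_r in M by (intros; ring). apply M.
  intros u i Hu Hi _. rewrite Rminus_0_r. auto.
Qed.

End Family.

(** * Generating functions of small contact steps *)

Lemma finite_delta (m : nat) (Q : nat -> R -> Prop) :
  (forall j d d', 0 < d' -> d' <= d -> Q j d -> Q j d') ->
  (forall j, (j < m)%nat -> exists d, 0 < d /\ Q j d) ->
  exists d, 0 < d /\ forall j, (j < m)%nat -> Q j d.
Proof.
  intros mono. induction m; intros H; [exists 1; split; [lra | intros; lia]|].
  destruct IHm as [d [d0 K]]; [auto|]. destruct (H m) as [d' [d'0 K']]; [auto|].
  assert (P : 0 < Rmin d d') by (apply Rmin_glb_lt; auto).
  exists (Rmin d d'). split; auto. intros j Hj. destruct (Nat.eq_dec j m) as [->|].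
  - apply (mono m d'); auto. apply Rmin_r.
  - apply (mono j d); auto; [apply Rmin_l | apply K; lia].
Qed.

Lemma finite_bound (m : nat) (Q : nat -> R -> Prop) :
  (forall j c c', c <= c' -> Q j c -> Q j c') ->
  (forall j, (j < m)%nat -> exists c, 0 < c /\ Q j c) ->
  exists c, 0 < c /\ forall j, (j < m)%nat -> Q j c.
Proof.
  intros mono. induction m; intros H; [exists 1; split; [lra | intros; lia]|].
  destruct IHm as [d [d0 K]]; [auto|]. destruct (H m) as [d' [d'0 K']]; [auto|].
  exists (d + d'). split; [lra|]. intros j Hj. destruct (Nat.eq_dec j m) as [->|].
  - apply (mono m d'); auto. lra.
  - apply (mono j d); [lra | apply K; lia].
Qed.

Lemma fsum_split n f : fsum (2 * n + 1) f = fsum n f + fsum n (fun i => f (n + i)%nat) + f (2 * n)%nat.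
Proof.
  replace (2 * n + 1)%nat with (S (n + n)) by lia. simpl. rewrite fsum_add.
  replace (n + (n + 0))%nat with (n + n)%nat by lia. reflexivity.
Qed.

(* With psi a contact map of conformal factor F and q = (x,y,z), psi q = (X,Y,Z):
   w = (X, F y, z), dS = (Y - F y) dX + (x - X) d(F y) + (F - 1) dz and S = Z - z - F y (X - x). *)
Definition generated (n : nat) (S : (nat -> R) -> R) (A : nat -> (nat -> R) -> R)
    (psi : (nat -> R) -> nat -> R) (F : (nat -> R) -> R) (w q : nat -> R) : Prop :=
  (forall i, (i < n)%nat -> psi q i = w i /\ w (n + i)%nat = F q * q (n + i)%nat /\
     A i w = psi q (n + i)%nat - w (n + i)%nat /\ A (n + i)%nat w = q i - w i) /\
  q (2 * n)%nat = w (2 * n)%nat /\ A (2 * n)%nat w = F q - 1 /\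
  S w = psi q (2 * n)%nat - q (2 * n)%nat - fsum n (fun i => w (n + i)%nat * (w i - q i)).

(** The interface between the isotopy and the variational argument. [A] is the differential of [S],
    and the contact property of [psi] is carried by the relation [generated]. *)
Record contact_step (n : nat) (S : (nat -> R) -> R) (A : nat -> (nat -> R) -> R)
    (psi : (nat -> R) -> nat -> R) (F : (nat -> R) -> R) : Prop := {
  step_frechet : forall w, inR (2 * n + 1) w -> frechet (2 * n + 1) S (fun i => A i w) w;
  step_cont : forall i, (i < 2 * n + 1)%nat -> cont (2 * n + 1) (A i);
  step_supp : exists B, forall w, inR (2 * n + 1) w -> off (2 * n + 1) B w ->
    S w = 0 /\ forall i, (i < 2 * n + 1)%nat -> A i w = 0;
  step_nonneg : forall w, inR (2 * n + 1) w -> 0 <= S w;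
  step_inR : forall q, inR (2 * n + 1) q -> inR (2 * n + 1) (psi q);
  step_pos : forall q, inR (2 * n + 1) q -> 0 < F q;
  step_gen : forall w, inR (2 * n + 1) w -> exists q, inR (2 * n + 1) q /\ generated n S A psi F w q }.

(** Algebra behind the formula for [dS]: its remainder is that of the contact form at the end of the
    step, minus [l] times that at its start, minus a term of second order. Here [p = l y] is the
    rescaled momentum and [l] the conformal factor of the step. *)
Lemma remainder_identity n (X X' x x' Y y p p' : nat -> R) l :
  (forall i, (i < n)%nat -> p i = l * y i) ->
  - fsum n (fun i => p' i * (X' i - x' i)) + fsum n (fun i => p i * (X i - x i))
  - fsum n (fun i => (Y i - p i) * (X' i - X i)) - fsum n (fun i => (x i - X i) * (p' i - p i))
  = - fsum n (fun i => Y i * (X' i - X i)) + l * fsum n (fun i => y i * (x' i - x i))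
    - fsum n (fun i => (p' i - p i) * ((X' i - x' i) - (X i - x i))).
Proof.
  induction n; intros H; simpl; [ring|].
  specialize (IHn ltac:(auto)). specialize (H n ltac:(auto)). rewrite H in *.
  ring_simplify in IHn. ring_simplify. nra.
Qed.

(** * A compactly supported contact isotopy and its conformal factor *)

Section Isotopy.
Variables (n : nat) (Phi : R -> (nat -> R) -> nat -> R) (H : R -> (nat -> R) -> R).
Variables (D : nat -> nat -> (nat -> R) -> R) (B : R).
Let m := (2 * n + 1)%nat.
Definition component (j : nat) (w : nat -> R) : R := Phi (w m) (trunc m w) j.
Hypothesis HD : forall j, (j < m)%nat -> partials (S m) (component j) (D j).
Hypothesis HDC : forall j i, (j < m)%nat -> (i < S m)%nat -> Ck (S m) 1 (D j i).
Hypothesis HC : forall j, (j < m)%nat -> Ck (S m) 1 (component j).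
Hypothesis HB : forall t r, 0 <= t <= 1 -> inR m r -> off m B r -> Phi t r = r.
Hypothesis HR : forall t r, 0 <= t <= 1 -> inR m r -> inR m (Phi t r).
Hypothesis Hconf : forall t, 0 <= t <= 1 -> exists g, conf_factor n (Phi t) g.
Hypothesis Hinv : forall t, 0 <= t <= 1 -> exists psi, smooth_map m psi /\
  (forall p, inR m p -> psi (Phi t p) = p) /\ (forall p, inR m p -> Phi t (psi p) = p).
Hypothesis HG : generates n H Phi.
Hypothesis Hnn : forall t p, 0 <= t <= 1 -> inR m p -> 0 <= H t p.

Lemma comp_pack j t r : inR m r -> component j (pack m t r) = Phi t r j.
Proof. intros Hr. unfold component. now rewrite pack_time, trunc_pack. Qed.

Lemma comp_upd j t r i : inR m r -> (j < m)%nat -> (i < m)%nat ->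
  derivable_pt_lim (fun s => Phi t (upd r i s) j) 0 (D j i (pack m t r)).
Proof.
  intros Hr Hj Hi. eapply derivable_pt_lim_ext_near; [apply Rlt_0_1 | |
    apply (HD j Hj (pack m t r) i); [now apply pack_inR | lia]].
  intros s _. simpl. rewrite upd_pack by auto. apply comp_pack. now apply upd_inR.
Qed.

Lemma comp_time j t r : inR m r -> (j < m)%nat ->
  derivable_pt_lim (fun s => Phi s r j) t (D j m (pack m t r)).
Proof.
  intros Hr Hj. apply derivable_pt_lim_shift.
  eapply derivable_pt_lim_ext_near; [apply Rlt_0_1 | |
    apply (HD j Hj (pack m t r) m); [now apply pack_inR | lia]].
  intros s _. simpl. rewrite upd_pack_time. now apply comp_pack.
Qed.

(** The coefficients on space-time of the pull-back of [alpha] under [(t, r) -> Phi t r]. The index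
    [2 * n] gives the conformal factor, because [alpha] is 1 on the vertical direction; the time
    index [m] gives the Hamiltonian along the orbit. *)
Definition coeff (k : nat) (w : nat -> R) : R :=
  D (2 * n) k w - fsum n (fun i => component (n + i) w * D i k w).

Definition conf (t : R) (r : nat -> R) : R := coeff (2 * n) (pack m t r).

Lemma form_C1 k : (k < S m)%nat -> Ck (S m) 1 (coeff k).
Proof.
  intros Hk. apply C1_minus; [apply HDC; unfold m; lia|].
  apply (C1_fsum (S m) n (fun i w => component (n + i) w * D i k w)). intros i Hi.
  apply C1_mult; [apply HC | apply HDC]; unfold m; lia.
Qed.

Lemma form_conf t g r k : 0 <= t <= 1 -> conf_factor n (Phi t) g -> inR m r -> (k < m)%nat ->
  coeff k (pack m t r) = exp (g r) * alpha_coef n r k.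
Proof.
  intros Ht Hg Hr Hk. destruct (Hg r Hr k Hk) as [dz [dx [Hz [Hx <-]]]].
  unfold coeff. f_equal.
  - eapply uniqueness_limite; [apply comp_upd; auto; unfold m; lia | exact Hz].
  - apply fsum_ext. intros i Hi. rewrite comp_pack by auto. f_equal.
    eapply uniqueness_limite; [apply comp_upd; auto; unfold m; lia | auto].
Qed.

Lemma alpha_last r : alpha_coef n r (2 * n) = 1.
Proof.
  unfold alpha_coef. destruct (Nat.ltb_spec (2 * n) n); [lia|]. now rewrite Nat.ltb_irrefl.
Qed.

Lemma E_conf t g r : 0 <= t <= 1 -> conf_factor n (Phi t) g -> inR m r -> conf t r = exp (g r).
Proof.
  intros Ht Hg Hr. unfold conf. rewrite (form_conf t g) by (auto; unfold m; lia).
  rewrite alpha_last. ring.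
Qed.

Lemma E_pos t r : 0 <= t <= 1 -> inR m r -> 0 < conf t r.
Proof. intros Ht Hr. destruct (Hconf t Ht) as [g Hg]. rewrite (E_conf t g) by auto. apply exp_pos. Qed.

Lemma form_E t r k : 0 <= t <= 1 -> inR m r -> (k < m)%nat ->
  coeff k (pack m t r) = conf t r * alpha_coef n r k.
Proof.
  intros Ht Hr Hk. destruct (Hconf t Ht) as [g Hg].
  now rewrite (E_conf t g), (form_conf t g) by auto.
Qed.

Lemma form_time t r : 0 <= t <= 1 -> inR m r -> coeff m (pack m t r) = H t (Phi t r).
Proof.
  intros Ht Hr. destruct (HG t r Ht Hr) as [dz [dx [Hz [Hx ->]]]]. unfold coeff. f_equal.
  - eapply uniqueness_limite; [apply comp_time; auto; unfold m; lia | exact Hz].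
  - apply fsum_ext. intros i Hi. rewrite comp_pack by auto. f_equal.
    eapply uniqueness_limite; [apply comp_time; auto; unfold m; lia | auto].
Qed.

Lemma comp_off j t r : 0 <= t <= 1 -> inR m r -> off m B r -> component j (pack m t r) = 1 * r j + 0.
Proof. intros Ht Hr Ho. rewrite comp_pack, HB by auto. ring. Qed.

Lemma cont_D j i : (j < m)%nat -> (i < S m)%nat -> cont (S m) (D j i).
Proof. intros Hj Hi. eapply Ck_cont, HDC; auto. Qed.

Lemma E_off t r : 0 <= t <= 1 -> inR m r -> off m B r -> conf t r = 0 * r 0%nat + 1.
Proof.
  intros Ht Hr Ho. unfold conf, coeff.
  rewrite (family_off_partial m B (component (2*n)) (D (2*n)) 1 0 (2*n)); auto;
    [|apply HD; unfold m; lia | intros; now apply comp_off | unfold m; lia].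
  rewrite Nat.eqb_refl, fsum_zero; [ring|]. intros i Hi.
  rewrite (family_off_partial m B (component i) (D i) 1 0 i); auto;
    [|apply HD; unfold m; lia | intros; now apply comp_off | unfold m; lia].
  destruct (Nat.eqb_spec i (2 * n)); [lia | ring].
Qed.

(** With the momenta frozen at the base point, [dZ - Y dX] becomes the differential of a single
    function, and that differential is [H dt + conf * alpha]. *)
Lemma contact_expansion t r e : 0 <= t <= 1 -> inR m r -> 0 < e ->
  exists d, 0 < d /\ forall t' r', Rabs (t' - t) < d -> inR m r' -> near m r r' d ->
    Rabs (Phi t' r' (2 * n)%nat - Phi t r (2 * n)%nat
      - fsum n (fun i => Phi t r (n + i)%nat * (Phi t' r' i - Phi t r i))
      - H t (Phi t r) * (t' - t)
      - conf t r * fsum m (fun k => alpha_coef n r k * (r' k - r k)))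
    <= e * (Rabs (t' - t) + dist1 m r r').
Proof.
  intros Ht Hr e0. set (w := pack m t r).
  assert (Hw : inR (S m) w) by now apply pack_inR.
  assert (P : partials (S m)
     (fun v => component (2 * n) v - fsum n (fun i => Phi t r (n + i)%nat * component i v))
     (fun k v => D (2 * n) k v - fsum n (fun i => Phi t r (n + i)%nat * D i k v))).
  { apply partials_minus; [apply HD; unfold m; lia|].
    apply (partials_fsum (S m) n (fun i v => Phi t r (n + i)%nat * component i v)
      (fun i k v => Phi t r (n + i)%nat * D i k v)).
    intros i Hi. apply partials_scal. apply HD; unfold m; lia. }
  destruct (partials_frechet _ _ _ w P) with (eps := e) as [d [d0 K]]; auto.
  { intros k Hk. apply cont_minus; [apply cont_D; unfold m; lia|].
    apply (cont_fsum (S m) n (fun i v => Phi t r (n + i)%nat * D i k v)). intros i Hi.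
    apply cont_scal, cont_D; unfold m; lia. }
  exists d. split; auto. intros t' r' Ht' Hr' N.
  specialize (K (pack m t' r') (pack_inR _ _ _ Hr') (pack_near _ _ _ _ _ _ Ht' N)).
  unfold w in K. rewrite pack_dist1 in K.
  simpl fsum in K.
  assert (Ek : forall k, D (2 * n)%nat k (pack m t r) -
     fsum n (fun i => Phi t r (n + i)%nat * D i k (pack m t r)) = coeff k (pack m t r)).
  { intros k. unfold coeff. f_equal. apply fsum_ext. intros i Hi. now rewrite comp_pack. }
  rewrite Ek, form_time, !pack_time in K by auto.
  rewrite (fsum_ext m _ (fun k => conf t r * (alpha_coef n r k * (r' k - r k)))) in K.
  2:{ intros k Hk. rewrite Ek, form_E, !pack_lt by auto. ring. }
  rewrite fsum_scal, !comp_pack in K by auto.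
  rewrite (fsum_ext n (fun i => Phi t r (n + i)%nat * component i (pack m t' r'))
      (fun i => Phi t r (n + i)%nat * Phi t' r' i)) in K by (intros; now rewrite comp_pack).
  rewrite (fsum_ext n (fun i => Phi t r (n + i)%nat * component i (pack m t r))
      (fun i => Phi t r (n + i)%nat * Phi t r i)) in K by (intros; now rewrite comp_pack).
  rewrite (fsum_ext n (fun i => Phi t r (n + i)%nat * (Phi t' r' i - Phi t r i))
     (fun i => Phi t r (n + i)%nat * Phi t' r' i - Phi t r (n + i)%nat * Phi t r i)) by (intros; ring).
  rewrite fsum_minus.
  match type of K with Rabs ?a <= _ => match goal with |- Rabs ?b <= _ => replace b with a by ring end end.
  lra.
Qed.

(** The point [w] of [generated] for the step from time [s] to time [t], expressed through the
    common preimage [r], where [q = Phi s r] and [psi q = Phi t r]. *)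
Definition sigma_map (s t : R) (r : nat -> R) : nat -> R := fun i =>
  if Nat.ltb i n then Phi t r i
  else if Nat.ltb i (2 * n) then conf t r * / conf s r * Phi s r i
  else if Nat.ltb i m then Phi s r i else 0.

Lemma sigma_inR s t r : inR m (sigma_map s t r).
Proof.
  intros i Hi. unfold sigma_map, m in *. destruct (Nat.ltb_spec i n); [lia|].
  destruct (Nat.ltb_spec i (2 * n)); [lia|]. now destruct (Nat.ltb_spec i (2*n+1)); [lia|].
Qed.

Lemma sigma_x s t r i : (i < n)%nat -> sigma_map s t r i = Phi t r i.
Proof. intros Hi. unfold sigma_map. now destruct (Nat.ltb_spec i n); [|lia]. Qed.

Lemma sigma_p s t r i : (i < n)%nat -> sigma_map s t r (n + i)%nat = conf t r * / conf s r * Phi s r (n + i)%nat.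
Proof.
  intros Hi. unfold sigma_map. destruct (Nat.ltb_spec (n + i) n); [lia|].
  now destruct (Nat.ltb_spec (n + i) (2 * n)); [|lia].
Qed.

Lemma sigma_z s t r : sigma_map s t r (2 * n)%nat = Phi s r (2 * n)%nat.
Proof.
  unfold sigma_map, m. destruct (Nat.ltb_spec (2 * n) n); [lia|]. rewrite Nat.ltb_irrefl.
  now destruct (Nat.ltb_spec (2 * n) (2 * n + 1)); [|lia].
Qed.

Lemma index_cases j : (j < m)%nat ->
  (j < n)%nat \/ (exists i, (i < n)%nat /\ j = (n + i)%nat) \/ j = (2 * n)%nat.
Proof.
  unfold m. intros Hj. destruct (lt_dec j n); [auto|]. right.
  destruct (lt_dec j (2 * n)); [left; exists (j - n)%nat; lia | right; lia].
Qed.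

Lemma sigma_off s t r : 0 <= s <= 1 -> 0 <= t <= 1 -> inR m r -> off m B r -> sigma_map s t r = r.
Proof.
  intros Hs Ht Hr Ho. apply (inR_ext m); [apply sigma_inR | auto |]. intros j Hj.
  destruct (index_cases j Hj) as [Hn|[[i [Hi ->]]| ->]].
  - rewrite sigma_x, HB; auto.
  - rewrite sigma_p, !E_off, HB by auto. field.
  - rewrite sigma_z, HB; auto.
Qed.

Lemma cont_pack t h : cont (S m) h -> cont m (fun r => h (pack m t r)).
Proof.
  intros Hh. apply (cont_comp m (S m) h (fun r => pack m t r)); auto.
  - intros; now apply pack_inR.
  - intros i Hi. unfold pack. destruct (Nat.eqb_spec i m); [apply cont_const | apply cont_coord; lia].
Qed.

Lemma cont_Phi t j : (j < m)%nat -> cont m (fun r => Phi t r j).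
Proof.
  intros Hj. apply (cont_ext m (fun r => component j (pack m t r))).
  - intros; now apply comp_pack.
  - apply cont_pack. eapply Ck_cont, HC; auto.
Qed.

Lemma cont_E t : cont m (conf t).
Proof. apply (cont_pack t (coeff (2 * n))). eapply Ck_cont, form_C1. unfold m; lia. Qed.

Lemma cont_ratio s t : 0 <= s <= 1 -> cont m (fun r => conf t r * / conf s r).
Proof.
  intros Hs. apply cont_mult; [apply cont_E|]. apply cont_inv; [|apply cont_E].
  intros; now apply E_pos.
Qed.

Lemma cont_sigma s t j : 0 <= s <= 1 -> (j < m)%nat -> cont m (fun r => sigma_map s t r j).
Proof.
  intros Hs Hj. destruct (index_cases j Hj) as [Hn|[[i [Hi ->]]| ->]].
  - apply (cont_ext m (fun r => Phi t r j)); [intros; now rewrite sigma_x | now apply cont_Phi].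
  - apply (cont_ext m (fun r => conf t r * / conf s r * Phi s r (n + i)%nat)); [intros; now rewrite sigma_p|].
    apply (cont_mult m (fun r => conf t r * / conf s r)); [now apply cont_ratio | now apply cont_Phi].
  - apply (cont_ext m (fun r => Phi s r (2 * n)%nat)); [intros; now rewrite sigma_z | now apply cont_Phi].
Qed.

Lemma Phi_lip : exists C, 0 < C /\ forall j, (j < m)%nat -> forall t r r', 0 <= t <= 1 -> inR m r -> inR m r' ->
  Rabs (Phi t r' j - Phi t r j) <= C * dist1 m r r'.
Proof.
  apply (finite_bound m (fun j C => forall t r r', 0 <= t <= 1 -> inR m r -> inR m r' ->
    Rabs (Phi t r' j - Phi t r j) <= C * dist1 m r r')).
  - intros j c c' le K t r r' Ht Hr Hr'. specialize (K t r r' Ht Hr Hr').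
    assert (P := dist1_nonneg m r r'). nra.
  - intros j Hj. destruct (family_lip m B (component j) (D j) 1 0 j) as [C [C0 K]]; auto.
    + intros; apply cont_D; auto.
    + intros; now apply comp_off.
    + exists C. split; auto. intros t r r' Ht Hr Hr'. specialize (K t r r' Ht Hr Hr').
      now rewrite !comp_pack in K.
Qed.

Lemma Phi_time_lip : exists C, 0 < C /\ forall j, (j < m)%nat -> forall t t' r, 0 <= t <= 1 -> 0 <= t' <= 1 ->
  inR m r -> Rabs (Phi t' r j - Phi t r j) <= C * Rabs (t' - t).
Proof.
  apply (finite_bound m (fun j C => forall t t' r, 0 <= t <= 1 -> 0 <= t' <= 1 ->
    inR m r -> Rabs (Phi t' r j - Phi t r j) <= C * Rabs (t' - t))).
  - intros j c c' le K t t' r Ht Ht' Hr. specialize (K t t' r Ht Ht' Hr).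
    assert (P := Rabs_pos (t' - t)). nra.
  - intros j Hj. destruct (family_time_lip m B (component j) (D j) 1 0 j) as [C [C0 K]]; auto.
    + intros; apply cont_D; auto.
    + intros; now apply comp_off.
    + exists C. split; auto. intros t t' r Ht Ht' Hr. specialize (K t t' r Ht Ht' Hr).
      now rewrite !comp_pack in K.
Qed.

Lemma Phi_small t0 e : 0 <= t0 <= 1 -> 0 < e -> exists d, 0 < d /\ forall j, (j < m)%nat -> forall t r r',
  0 <= t <= 1 -> Rabs (t - t0) < d -> inR m r -> inR m r' ->
  Rabs ((Phi t r' j - Phi t0 r' j) - (Phi t r j - Phi t0 r j)) <= e * dist1 m r r'.
Proof.
  intros Ht0 e0.
  apply (finite_delta m (fun j d => forall t r r', 0 <= t <= 1 -> Rabs (t - t0) < d -> inR m r -> inR m r' ->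
    Rabs ((Phi t r' j - Phi t0 r' j) - (Phi t r j - Phi t0 r j)) <= e * dist1 m r r')).
  - intros j d d' d'0 le K t r r' Ht T Hr Hr'. apply K; auto; lra.
  - intros j Hj. destruct (family_small m B (component j) (D j) 1 0 j) with (t0 := t0) (e := e) as [d [d0 K]]; auto.
    + intros; apply cont_D; auto.
    + intros; now apply comp_off.
    + exists d. split; auto. intros t r r' Ht T Hr Hr'.
      specialize (K t0 t r r' Ht0 Ht). unfold Rminus in K at 1. rewrite Rplus_opp_r, Rabs_R0 in K.
      specialize (K d0 T Hr Hr'). now rewrite !comp_pack in K.
Qed.

Lemma E_facts : exists g, partials (S m) (coeff (2 * n)) g /\ forall i, (i < S m)%nat -> cont (S m) (g i).
Proof.
  destruct (Ck_partials (S m) 0 (coeff (2 * n))) as [g [Hg Cg]]; [apply form_C1; unfold m; lia|].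
  exists g. split; auto.
Qed.

Lemma E_lip : exists C, 0 < C /\ forall t r r', 0 <= t <= 1 -> inR m r -> inR m r' ->
  Rabs (conf t r' - conf t r) <= C * dist1 m r r'.
Proof.
  destruct E_facts as [g [Hg Cg]].
  apply (family_lip m B (coeff (2 * n)) g 0 1 0); auto. intros; now apply E_off.
Qed.

Lemma E_time_lip : exists C, 0 < C /\ forall t t' r, 0 <= t <= 1 -> 0 <= t' <= 1 -> inR m r ->
  Rabs (conf t' r - conf t r) <= C * Rabs (t' - t).
Proof.
  destruct E_facts as [g [Hg Cg]].
  apply (family_time_lip m B (coeff (2 * n)) g 0 1 0); auto. intros; now apply E_off.
Qed.

Lemma E_small t0 e : 0 <= t0 <= 1 -> 0 < e -> exists d, 0 < d /\ forall t t' r r',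
  0 <= t <= 1 -> 0 <= t' <= 1 -> Rabs (t - t0) < d -> Rabs (t' - t0) < d -> inR m r -> inR m r' ->
  Rabs ((conf t' r' - conf t r') - (conf t' r - conf t r)) <= e * dist1 m r r'.
Proof.
  destruct E_facts as [g [Hg Cg]]. intros.
  apply (family_small m B (coeff (2 * n)) g 0 1 0); auto. intros; now apply E_off.
Qed.

Lemma E_inv_bound : exists J, 0 < J /\ forall t r, 0 <= t <= 1 -> inR m r -> / conf t r <= J.
Proof.
  (* The box in space-time contains times outside [[0, 1]], where positivity is not known; the
     predicate is made vacuous there. *)
  destruct (compact_uniform (S m) (Rmax B 1)
     (fun d w => 0 <= w m <= 1 -> d <= coeff (2 * n) w)) as [d [d0 K]].
  - intros d d' y d'0 le Hy T. specialize (Hy T). lra.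
  - intros x Hx Bx. destruct (classic (0 <= x m <= 1)) as [T|T].
    + assert (P : 0 < coeff (2 * n) x).
      { replace x with (pack m (x m) (trunc m x)).
        - apply E_pos; auto. apply trunc_inR.
        - apply (inR_ext (S m)); auto; [apply pack_inR, trunc_inR|]. intros i Hi.
          unfold pack. destruct (Nat.eqb_spec i m) as [->|]; [auto | apply trunc_lt; lia]. }
      destruct (Ck_cont _ _ _ (form_C1 (2 * n) ltac:(unfold m; lia)) x Hx (coeff (2 * n) x / 2)) as [d [d0 K]]; [lra|].
      exists (Rmin d (coeff (2 * n) x / 2)). split; [apply Rmin_glb_lt; lra|]. intros y Hy _ N _.
      specialize (K y Hy (near_le _ _ _ _ _ (Rmin_l _ _) N)). apply Rabs_def2 in K.
      assert (L := Rmin_r d (coeff (2 * n) x / 2)). lra.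
    + assert (exists d, 0 < d /\ forall s, Rabs (s - x m) < d -> ~ (0 <= s <= 1)) as [d [d0 K]].
      { destruct (Rlt_le_dec (x m) 0).
        - exists (- x m). split; [lra|]. intros s Hs. apply Rabs_def2 in Hs. lra.
        - exists (x m - 1). split; [lra|]. intros s Hs. apply Rabs_def2 in Hs. lra. }
      exists d. split; auto. intros y Hy _ N T'. exfalso. apply (K (y m)); auto.
  - exists (/ d + 1). assert (P := Rinv_0_lt_compat d d0). split; [lra|]. intros t r Ht Hr.
    destruct (off_or_box m B r) as [Ho|Hb].
    + rewrite E_off by auto. rewrite Rmult_0_l, Rplus_0_l, Rinv_1. lra.
    + assert (L : d <= conf t r).
      { apply K; [now apply pack_inR | now apply pack_box | now rewrite pack_time]. }
      apply Rinv_le_contravar in L; lra.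
Qed.

Lemma Phi_box_bound : exists Y, 0 < Y /\ forall j, (j < m)%nat -> forall t r, 0 <= t <= 1 -> inR m r ->
  box m B r -> Rabs (Phi t r j) <= Y.
Proof.
  apply (finite_bound m (fun j Y => forall t r, 0 <= t <= 1 -> inR m r -> box m B r -> Rabs (Phi t r j) <= Y)).
  - intros j c c' le K t r Ht Hr Hb. specialize (K t r Ht Hr Hb). lra.
  - intros j Hj. destruct (cont_bounded (S m) (component j) (Rmax B 1)) as [C [C0 K]].
    { eapply Ck_cont, HC; auto. }
    exists C. split; auto. intros t r Ht Hr Hb. rewrite <- comp_pack by auto.
    apply K; [now apply pack_inR | now apply pack_box].
Qed.

Lemma sigma_time_lip : exists C, 0 < C /\ forall s t t' r, 0 <= s <= 1 -> 0 <= t <= 1 -> 0 <= t' <= 1 ->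
  inR m r -> dist1 m (sigma_map s t r) (sigma_map s t' r) <= C * Rabs (t' - t).
Proof.
  destruct Phi_time_lip as [C1 [C10 K1]]. destruct E_time_lip as [C2 [C20 K2]].
  destruct E_inv_bound as [J [J0 KJ]]. destruct Phi_box_bound as [Y [Y0 KY]].
  assert (P0 : 0 < C2 * J * Y) by (repeat apply Rmult_lt_0_compat; auto).
  assert (Pm : 0 < INR m) by (apply lt_0_INR; unfold m; lia).
  exists (INR m * (C1 + C2 * J * Y)). split; [nra|]. intros s t t' r Hs Ht Ht' Hr.
  rewrite Rmult_assoc, <- fsum_const. apply fsum_le. intros j Hj.
  assert (PT := Rabs_pos (t' - t)).
  destruct (index_cases j Hj) as [Hn|[[i [Hi ->]]| ->]].
  - rewrite !sigma_x by auto. eapply Rle_trans; [apply K1; auto|]. nra.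
  - rewrite !sigma_p by auto.
    replace (conf t' r * / conf s r * Phi s r (n + i)%nat - conf t r * / conf s r * Phi s r (n + i)%nat)
      with ((conf t' r - conf t r) * (/ conf s r * Phi s r (n + i)%nat)) by ring.
    (* The momentum is unbounded only off the box, and there the conformal factor does not vary with
       time. *)
    destruct (off_or_box m B r) as [Ho|Hb].
    + rewrite !E_off by auto. unfold Rminus at 1. rewrite Rplus_opp_r, Rmult_0_l, Rabs_R0. nra.
    + rewrite !Rabs_mult. specialize (K2 t t' r Ht Ht' Hr). specialize (KJ s r Hs Hr).
      specialize (KY (n + i)%nat Hj s r Hs Hr Hb).
      assert (Q := Rinv_0_lt_compat _ (E_pos s r Hs Hr)). rewrite (Rabs_right (/ conf s r)) by lra.
      assert (Rabs (Phi s r (n + i)%nat) >= 0) by (apply Rle_ge, Rabs_pos).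
      assert (/ conf s r * Rabs (Phi s r (n + i)%nat) <= J * Y) by (apply Rmult_le_compat; lra).
      apply (Rle_trans _ ((C2 * Rabs (t' - t)) * (J * Y))).
      * apply Rmult_le_compat; try lra; [apply Rabs_pos|]. apply Rmult_le_pos; lra.
      * nra.
  - rewrite !sigma_z. unfold Rminus at 1. rewrite Rplus_opp_r, Rabs_R0. nra.
Qed.

(** For times near [t0] the ratio of conformal factors is close to 1 with a small Lipschitz
    constant, so [sigma_map] is a Lipschitz-small perturbation of [Phi t0]. *)
Lemma sigma_close t0 e : 0 <= t0 <= 1 -> 0 < e -> exists d, 0 < d /\ forall s t r r' j,
  0 <= s <= 1 -> 0 <= t <= 1 -> Rabs (s - t0) < d -> Rabs (t - t0) < d -> inR m r -> inR m r' ->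
  (j < m)%nat ->
  Rabs ((sigma_map s t r' j - Phi t0 r' j) - (sigma_map s t r j - Phi t0 r j)) <= e * dist1 m r r'.
Proof.
  intros Ht0 e0.
  destruct Phi_lip as [C [C0 KC]]. destruct E_lip as [CE [CE0 KCE]].
  destruct E_time_lip as [C2 [C20 K2]].
  destruct E_inv_bound as [J [J0 KJ]]. destruct Phi_box_bound as [Y [Y0 KY]].
  destruct (Phi_small t0 (e / 2)) as [d1 [d10 K1]]; auto; [lra|].
  (* With this and [d3] below, the Lipschitz bound for the momentum correction,
     [2 * c * d3 + J * Y * e1], comes to [e / 4]. *)
  set (e1 := e / (8 * J * Y)).
  assert (JY : 0 < J * Y) by (apply Rmult_lt_0_compat; auto).
  assert (e10 : 0 < e1) by (apply Rdiv_lt_0_compat; nra).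
  destruct (E_small t0 e1) as [d2 [d20 KE]]; auto.
  set (c := C2 * J * C + C2 * J * J * CE * Y).
  assert (c0 : 0 < c) by (unfold c; apply Rplus_lt_0_compat; repeat apply Rmult_lt_0_compat; auto).
  set (d3 := e / (16 * c)). assert (d30 : 0 < d3) by (apply Rdiv_lt_0_compat; lra).
  exists (Rmin d1 (Rmin d2 d3)).
  split; [repeat apply Rmin_glb_lt; auto|]. intros s t r r' j Hs Ht Ss Tt Hr Hr' Hj.
  assert (L1 := Rmin_l d1 (Rmin d2 d3)). assert (L2 := Rmin_r d1 (Rmin d2 d3)).
  assert (L3 := Rmin_l d2 d3). assert (L4 := Rmin_r d2 d3).
  assert (Pd := dist1_nonneg m r r').
  destruct (index_cases j Hj) as [Hn|[[i [Hi ->]]| ->]].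
  - rewrite !sigma_x by auto. eapply Rle_trans; [apply K1; auto; lra|]. nra.
  - rewrite !sigma_p by auto.
    set (k := fun r => conf t r * / conf s r - 1).
    assert (kst : forall q, inR m q -> Rabs (k q) <= J * (C2 * (2 * d3))).
    { intros q Hq. unfold k. assert (P := E_pos s q Hs Hq).
      replace (conf t q * / conf s q - 1) with (/ conf s q * (conf t q - conf s q)) by (field; lra).
      rewrite Rabs_mult, Rabs_right by (left; now apply Rinv_0_lt_compat).
      apply Rmult_le_compat; [left; now apply Rinv_0_lt_compat | apply Rabs_pos | auto |].
      eapply Rle_trans; [apply K2; auto|]. apply Rmult_le_compat_l; [lra|].
      replace (t - s) with ((t - t0) + - (s - t0)) by ring.
      eapply Rle_trans; [apply Rabs_triang|]. rewrite Rabs_Ropp. lra. }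
    assert (kd : forall q q', inR m q -> inR m q' -> Rabs (k q' - k q) <=
        (J * e1 + C2 * (2 * d3) * (J * J * CE)) * dist1 m q q').
    { intros q q' Hq Hq'. unfold k. assert (P := E_pos s q Hs Hq). assert (P' := E_pos s q' Hs Hq').
      replace (conf t q' * / conf s q' - 1 - (conf t q * / conf s q - 1)) with
        (/ conf s q' * ((conf t q' - conf s q') - (conf t q - conf s q)) +
         (conf t q - conf s q) * (/ conf s q' * / conf s q * (conf s q - conf s q'))) by (field; lra).
      eapply Rle_trans; [apply Rabs_triang|]. rewrite !Rabs_mult.
      assert (I := Rinv_0_lt_compat _ P). assert (I' := Rinv_0_lt_compat _ P').
      rewrite (Rabs_right (/ conf s q)), (Rabs_right (/ conf s q')) by lra.
      assert (A1 : Rabs ((conf t q' - conf s q') - (conf t q - conf s q)) <= e1 * dist1 m q q')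
        by (apply KE; auto; lra).
      assert (A2 : Rabs (conf s q - conf s q') <= CE * dist1 m q q').
      { rewrite Rabs_minus_sym. auto. }
      assert (A3 : Rabs (conf t q - conf s q) <= C2 * (2 * d3)).
      { eapply Rle_trans; [apply K2; auto|]. apply Rmult_le_compat_l; [lra|].
        replace (t - s) with ((t - t0) + - (s - t0)) by ring.
        eapply Rle_trans; [apply Rabs_triang|]. rewrite Rabs_Ropp. lra. }
      assert (B1 := KJ s q Hs Hq). assert (B2 := KJ s q' Hs Hq').
      rewrite Rmult_plus_distr_r. apply Rplus_le_compat.
      - rewrite Rmult_assoc. apply Rmult_le_compat; auto; try lra; apply Rabs_pos.
      - replace (C2 * (2 * d3) * (J * J * CE) * dist1 m q q') with
          ((C2 * (2 * d3)) * ((J * J) * (CE * dist1 m q q'))) by ring.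
        assert (0 <= / conf s q' * / conf s q) by (apply Rmult_le_pos; lra).
        apply Rmult_le_compat; [apply Rabs_pos | apply Rmult_le_pos; [auto | apply Rabs_pos] | exact A3 |].
        apply Rmult_le_compat; auto; [apply Rabs_pos|]. apply Rmult_le_compat; lra. }
    assert (ky : forall q q', inR m q -> inR m q' -> box m B q ->
       Rabs (k q' * Phi s q' (n + i)%nat - k q * Phi s q (n + i)%nat) <= e / 2 * dist1 m q q').
    { intros q q' Hq Hq' Bq. specialize (kd q q' Hq Hq'). specialize (kst q' Hq').
      specialize (KC (n + i)%nat Hj s q q' Hs Hq Hq').
      specialize (KY (n + i)%nat Hj s q Hs Hq Bq).
      replace (k q' * Phi s q' (n + i)%nat - k q * Phi s q (n + i)%nat) with
        (k q' * (Phi s q' (n + i)%nat - Phi s q (n + i)%nat) + (k q' - k q) * Phi s q (n + i)%nat) by ring.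
      eapply Rle_trans; [apply Rabs_triang|]. rewrite !Rabs_mult.
      assert (Pq := dist1_nonneg m q q').
      apply (Rle_trans _ (J * (C2 * (2 * d3)) * (C * dist1 m q q') +
         (J * e1 + C2 * (2 * d3) * (J * J * CE)) * dist1 m q q' * Y)).
      - apply Rplus_le_compat; apply Rmult_le_compat; auto; apply Rabs_pos.
      - replace (J * (C2 * (2 * d3)) * (C * dist1 m q q') +
         (J * e1 + C2 * (2 * d3) * (J * J * CE)) * dist1 m q q' * Y) with
         ((2 * c * d3 + J * Y * e1) * dist1 m q q') by (unfold c; ring).
        apply Rmult_le_compat_r; auto.
        assert (X1 : c * d3 = e / 16) by (unfold d3; field; lra).
        assert (X2 : J * Y * e1 = e / 8) by (unfold e1; field; split; lra). lra. }
    (* The product estimate needs a bounded momentum at one of the two points only; if both are off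
       the box, the correction vanishes at both. *)
    assert (ky' : Rabs (k r' * Phi s r' (n + i)%nat - k r * Phi s r (n + i)%nat) <= e / 2 * dist1 m r r').
    { destruct (off_or_box m B r) as [Ho|Hb]; [|auto].
      destruct (off_or_box m B r') as [Ho'|Hb'].
      - unfold k. rewrite !E_off by auto.
        match goal with |- Rabs ?x <= _ => replace x with 0 by field end.
        rewrite Rabs_R0. nra.
      - rewrite Rabs_minus_sym, dist1_sym. auto. }
    assert (kp : Rabs ((Phi s r' (n + i)%nat - Phi t0 r' (n + i)%nat) - (Phi s r (n + i)%nat - Phi t0 r (n + i)%nat))
      <= e / 2 * dist1 m r r') by (apply K1; auto; lra).
    match goal with |- Rabs ?x <= _ => replace x with
      ((k r' * Phi s r' (n + i)%nat - k r * Phi s r (n + i)%nat) +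
       ((Phi s r' (n + i)%nat - Phi t0 r' (n + i)%nat) - (Phi s r (n + i)%nat - Phi t0 r (n + i)%nat)))
      by (unfold k; ring) end.
    eapply Rle_trans; [apply Rabs_triang|]. lra.
  - rewrite !sigma_z. eapply Rle_trans; [apply K1; auto; lra|]. nra.
Qed.

(** The inverse is smooth and the identity off the box, hence globally Lipschitz. It enters
    [family_lip] as a family constant in time. *)
Lemma Phi_expanding t0 : 0 <= t0 <= 1 -> exists L, 0 < L /\ forall r r', inR m r -> inR m r' ->
  dist1 m r r' <= L * dist1 m (Phi t0 r) (Phi t0 r').
Proof.
  intros Ht0. destruct (Hinv t0 Ht0) as [psi [[psiR psiS] [psil psir]]].
  assert (Q : exists C, 0 < C /\ forall j, (j < m)%nat -> forall q q', inR m q -> inR m q' ->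
     Rabs (psi q' j - psi q j) <= C * dist1 m q q').
  { apply (finite_bound m (fun j C => forall q q', inR m q -> inR m q' ->
     Rabs (psi q' j - psi q j) <= C * dist1 m q q')).
    - intros j c c' le K q q' Hq Hq'. specialize (K q q' Hq Hq'). assert (P := dist1_nonneg m q q'). nra.
    - intros j Hj. destruct (Ck_partials m 0 _ (psiS j Hj 1%nat)) as [g [Hg Cg]].
      destruct (family_lip m B (fun w => psi (trunc m w) j)
        (fun i w => if Nat.eqb i m then 0 else g i (trunc m w)) 1 0 j) as [C [C0 K]].
      + intros w i Hw Hi. destruct (Nat.eqb_spec i m) as [->|ne].
        * apply (derivable_pt_lim_ext_near (fun _ => psi (trunc m w) j) _ 0 _ 1 Rlt_0_1).
          -- intros h _. f_equal. apply (inR_ext m); try apply trunc_inR. intros k Hk.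
             rewrite !trunc_lt by auto. rewrite upd_other; auto. lia.
          -- apply derivable_pt_lim_const.
        * eapply derivable_pt_lim_ext_near; [apply Rlt_0_1 | | apply (Hg (trunc m w) i); [apply trunc_inR | lia]].
          intros h _. simpl. f_equal. apply (inR_ext m); [apply upd_inR; [lia | apply trunc_inR] | apply trunc_inR |].
          intros k Hk. unfold upd. rewrite !trunc_lt by auto. reflexivity.
      + intros i Hi. destruct (Nat.eqb_spec i m) as [->|ne]; [apply cont_const|].
        apply (cont_comp (S m) m (g i) (trunc m)); [apply Cg; lia | intros; apply trunc_inR |].
        intros k Hk. apply (cont_ext (S m) (fun u => u k)); [intros; now rewrite trunc_lt | apply cont_coord; lia].
      + intros t r Ht Hr Ho. rewrite trunc_pack by auto. rewrite <- (HB t0 r Ht0 Hr Ho) at 1.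
        rewrite psil by auto. ring.
      + exists C. split; auto. intros q q' Hq Hq'. specialize (K 0 q q' ltac:(lra) Hq Hq').
        now rewrite !trunc_pack in K. }
  destruct Q as [C [C0 K]].
  assert (Pm : 0 < INR m) by (apply lt_0_INR; unfold m; lia).
  exists (INR m * C). split; [nra|]. intros r r' Hr Hr'.
  rewrite Rmult_assoc, <- fsum_const. apply fsum_le. intros j Hj.
  specialize (K j Hj (Phi t0 r) (Phi t0 r') (HR _ _ Ht0 Hr) (HR _ _ Ht0 Hr')).
  now rewrite !psil in K.
Qed.

(** The perturbation is taken with half the Lipschitz constant that [Phi t0] tolerates, so
    injectivity survives with constant [2 * L]. Surjectivity follows because [sigma_map] composed
    with the inverse of [Phi t0] has bounded displacement. *)
Lemma sigma_bijective t0 : 0 <= t0 <= 1 -> exists d L, 0 < d /\ 0 < L /\ forall s t,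
  0 <= s <= 1 -> 0 <= t <= 1 -> Rabs (s - t0) < d -> Rabs (t - t0) < d ->
  (forall r r', inR m r -> inR m r' -> dist1 m r r' <= L * dist1 m (sigma_map s t r) (sigma_map s t r')) /\
  (forall w, inR m w -> exists r, inR m r /\ sigma_map s t r = w).
Proof.
  intros Ht0. destruct (Phi_expanding t0 Ht0) as [L [L0 HL]].
  assert (Pm : 0 < INR m) by (apply lt_0_INR; unfold m; lia).
  assert (e0 : 0 < / (2 * L * INR m)) by (apply Rinv_0_lt_compat; nra).
  destruct (sigma_close t0 _ Ht0 e0) as [d [d0 K]].
  exists d, (2 * L). split; [auto|]. split; [lra|]. intros s t Hs Ht Ss Tt. split.
  - intros r r' Hr Hr'. specialize (HL r r' Hr Hr').
    assert (T : dist1 m (Phi t0 r) (Phi t0 r') <= dist1 m (sigma_map s t r) (sigma_map s t r') +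
       INR m * (/ (2 * L * INR m) * dist1 m r r')).
    { rewrite <- fsum_const. unfold dist1 at 1 2. rewrite <- fsum_plus. apply fsum_le. intros j Hj.
      specialize (K s t r r' j Hs Ht Ss Tt Hr Hr' Hj).
      replace (Phi t0 r' j - Phi t0 r j) with ((sigma_map s t r' j - sigma_map s t r j) +
        - ((sigma_map s t r' j - Phi t0 r' j) - (sigma_map s t r j - Phi t0 r j))) by ring.
      eapply Rle_trans; [apply Rabs_triang|]. rewrite Rabs_Ropp. lra. }
    replace (INR m * (/ (2 * L * INR m) * dist1 m r r')) with (dist1 m r r' / (2 * L)) in T by (field; lra).
    apply (Rmult_le_compat_l L) in T; [|lra].
    replace (L * (dist1 m (sigma_map s t r) (sigma_map s t r') + dist1 m r r' / (2 * L))) with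
      (L * dist1 m (sigma_map s t r) (sigma_map s t r') + dist1 m r r' / 2) in T by (field; lra).
    lra.
  - intros w Hw. destruct (Hinv t0 Ht0) as [psi [[psiR psiS] [psil psir]]].
    set (U := fun j r => sigma_map s t r j - Phi t0 r j).
    assert (CU : forall j, (j < m)%nat -> cont m (U j)).
    { intros j Hj. apply (cont_lip m (U j) (/ (2 * L * INR m))). intros r r' Hr Hr'. apply K; auto. }
    assert (BU : exists C, 0 < C /\ forall j, (j < m)%nat -> forall r, inR m r -> Rabs (U j r) <= C).
    { apply (finite_bound m (fun j C => forall r, inR m r -> Rabs (U j r) <= C)).
      - intros j c c' le Q r Hr. specialize (Q r Hr). lra.
      - intros j Hj. destruct (cont_bounded m (U j) B (CU j Hj)) as [C [C0 Q]]. exists C. split; auto.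
        intros r Hr. destruct (off_or_box m B r) as [Ho|Hb]; [|auto]. unfold U.
        rewrite sigma_off, HB by auto. unfold Rminus. rewrite Rplus_opp_r, Rabs_R0. lra. }
    destruct BU as [C [C0 HBU]].
    destruct (bounded_displacement_surj m C (fun u => sigma_map s t (psi u)) w) as [u [Hu conf']].
    + intros j Hj. apply (cont_ext m (fun u => U j (psi u) + u j)).
      * intros v Hv. unfold U. rewrite psir by auto. ring.
      * apply cont_plus; [|now apply cont_coord]. apply (cont_comp m m (U j) psi); auto.
        intros i Hi. exact (Ck_cont _ _ _ (psiS i Hi 0%nat)).
    + intros u i Hu Hi. specialize (HBU i Hi (psi u) (psiR u Hu)). unfold U in HBU.
      now rewrite psir in HBU.
    + exists (psi u). split; [now apply psiR|]. apply (inR_ext m); auto. apply sigma_inR.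
Qed.

(** * The generating function of one step *)

Section Step.
Variables (s t L : R).
Hypothesis Hs : 0 <= s <= 1.
Hypothesis Ht : 0 <= t <= 1.
Hypothesis st : s < t.
Hypothesis L0 : 0 < L.
Hypothesis HL : forall x, s <= x <= t ->
  (forall r r', inR m r -> inR m r' -> dist1 m r r' <= L * dist1 m (sigma_map s x r) (sigma_map s x r')) /\
  (forall w, inR m w -> exists r, inR m r /\ sigma_map s x r = w).

Definition rho (x : R) (w : nat -> R) : nat -> R :=
  epsilon (inhabits (fun _ => 0)) (fun r => inR m r /\ sigma_map s x r = w).

Lemma rho_spec x w : s <= x <= t -> inR m w -> inR m (rho x w) /\ sigma_map s x (rho x w) = w.
Proof.
  intros Hx Hw. unfold rho. apply epsilon_spec. apply HL; auto.
Qed.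

Definition genS (x : R) (w : nat -> R) : R :=
  let r := rho x w in
  Phi x r (2 * n)%nat - Phi s r (2 * n)%nat - fsum n (fun i => w (n + i)%nat * (w i - Phi s r i)).

Definition genA (x : R) (i : nat) (w : nat -> R) : R :=
  let r := rho x w in
  if Nat.ltb i n then Phi x r (n + i)%nat - w (n + i)%nat
  else if Nat.ltb i (2 * n) then Phi s r (i - n)%nat - w (i - n)%nat
  else conf x r * / conf s r - 1.

(** The Hamilton-Jacobi equation. With [w] fixed, the position at time [x] and the height at time
    [s] do not move; what the moving preimage contributes through [alpha] cancels between the
    expansion at [x] and [l] times the expansion at [s], leaving the Hamiltonian at the image
    point. *)
Lemma genS_time x w e : s <= x <= t -> inR m w -> 0 < e -> exists d, 0 < d /\ forall x', s <= x' <= t ->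
  Rabs (x' - x) < d ->
  Rabs (genS x' w - genS x w - H x (Phi x (rho x w)) * (x' - x)) <= e * Rabs (x' - x).
Proof.
  intros Hx Hw e0. destruct sigma_time_lip as [C [C0 KC]].
  destruct (rho_spec x w Hx Hw) as [Hr Er]. set (r := rho x w) in *.
  assert (Px : 0 < conf x r) by (apply E_pos; auto; lra). assert (Ps : 0 < conf s r) by (apply E_pos; auto).
  set (l := conf x r * / conf s r). assert (l0 : 0 < l) by (apply Rmult_lt_0_compat; auto; now apply Rinv_0_lt_compat).
  assert (LC : 0 < L * C) by (apply Rmult_lt_0_compat; auto).
  set (c := 1 + L * C + l * (L * C)). assert (c0 : 0 < c) by (unfold c; nra).
  assert (e1 : 0 < e / c) by (apply Rdiv_lt_0_compat; auto).
  destruct (contact_expansion x r (e / c)) as [d1 [d10 K1]]; auto; [lra|].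
  destruct (contact_expansion s r (e / c)) as [d2 [d20 K2]]; auto.
  set (d3 := Rmin d1 (Rmin d1 d2 / (L * C))).
  assert (m0 : 0 < Rmin d1 d2) by (apply Rmin_glb_lt; auto).
  exists d3. split; [apply Rmin_glb_lt; auto; now apply Rdiv_lt_0_compat|]. intros x' Hx' Dx.
  destruct (rho_spec x' w Hx' Hw) as [Hr' Er']. set (r' := rho x' w) in *.
  assert (D1 : dist1 m r r' <= L * C * Rabs (x' - x)).
  { eapply Rle_trans; [apply (proj1 (HL x Hx)); auto|]. rewrite Rmult_assoc. apply Rmult_le_compat_l; [lra|].
    rewrite Er. rewrite <- Er'. rewrite dist1_sym. apply KC; auto; lra. }
  assert (D2 : L * C * Rabs (x' - x) < Rmin d1 d2).
  { assert (Q := Rlt_le_trans _ _ _ Dx (Rmin_r _ _)). apply (Rmult_lt_compat_l (L * C)) in Q; auto.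
    replace (L * C * (Rmin d1 d2 / (L * C))) with (Rmin d1 d2) in Q by (field; split; lra). exact Q. }
  assert (N : near m r r' (Rmin d1 d2)) by (apply near_dist1; lra).
  specialize (K1 x' r' (Rlt_le_trans _ _ _ Dx (Rmin_l _ _)) Hr' (near_le _ _ _ _ _ (Rmin_l _ _) N)).
  assert (z0 : Rabs (s - s) < d2) by (unfold Rminus; rewrite Rplus_opp_r, Rabs_R0; auto).
  specialize (K2 s r' z0 Hr' (near_le _ _ _ _ _ (Rmin_r _ _) N)).
  replace (s - s) with 0 in K2 by ring. rewrite Rmult_0_r, Rminus_0_r, Rabs_R0, Rplus_0_l in K2.
  assert (EX : forall i, (i < n)%nat -> Phi x r i = w i /\ Phi x' r' i = w i).
  { intros i Hi. split; [rewrite <- Er | rewrite <- Er']; now rewrite sigma_x. }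
  assert (EP : forall i, (i < n)%nat -> w (n + i)%nat = l * Phi s r (n + i)%nat).
  { intros i Hi. unfold l. rewrite <- sigma_p by auto. now rewrite Er. }
  assert (EZ : Phi s r (2 * n)%nat = w (2 * n)%nat /\ Phi s r' (2 * n)%nat = w (2 * n)%nat).
  { split; [rewrite <- Er | rewrite <- Er']; now rewrite sigma_z. }
  rewrite (fsum_zero n (fun i => Phi x r (n + i)%nat * (Phi x' r' i - Phi x r i))) in K1.
  2:{ intros i Hi. destruct (EX i Hi) as [-> ->]. ring. }
  destruct EZ as [EZ EZ']. rewrite EZ, EZ' in K2.
  set (T := fsum m (fun k => alpha_coef n r k * (r' k - r k))) in *.
  set (Y := fsum n (fun i => Phi s r (n + i)%nat * (Phi s r' i - Phi s r i))) in *.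
  assert (EG : genS x' w - genS x w = Phi x' r' (2 * n)%nat - Phi x r (2 * n)%nat + l * Y).
  { unfold genS. fold r r'. rewrite EZ, EZ'. unfold Y. rewrite <- fsum_scal.
    rewrite (fsum_ext n (fun i => l * (Phi s r (n + i)%nat * (Phi s r' i - Phi s r i)))
      (fun i => w (n + i)%nat * (w i - Phi s r i) - w (n + i)%nat * (w i - Phi s r' i))).
    - rewrite fsum_minus. ring.
    - intros i Hi. rewrite (EP i Hi). ring. }
  rewrite EG.
  replace (Phi x' r' (2 * n)%nat - Phi x r (2 * n)%nat + l * Y - H x (Phi x r) * (x' - x)) with
    ((Phi x' r' (2 * n)%nat - Phi x r (2 * n)%nat - 0 - H x (Phi x r) * (x' - x) - conf x r * T) +
     - (l * (w (2 * n)%nat - w (2 * n)%nat - Y - conf s r * T)))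
   by (unfold l; field; lra).
  eapply Rle_trans; [apply Rabs_triang|]. rewrite Rabs_Ropp, Rabs_mult, (Rabs_right l) by lra.
  apply (Rle_trans _ (e / c * (Rabs (x' - x) + L * C * Rabs (x' - x)) + l * (e / c * (L * C * Rabs (x' - x))))).
  - apply Rplus_le_compat.
    + eapply Rle_trans; [exact K1|]. apply Rmult_le_compat_l; lra.
    + apply Rmult_le_compat_l; [lra|]. eapply Rle_trans; [exact K2|]. apply Rmult_le_compat_l; lra.
  - apply Req_le. unfold c. field. fold c. lra.
Qed.

Lemma genS_start w : inR m w -> genS s w = 0.
Proof.
  intros Hw. destruct (rho_spec s w) as [Hr Er]; [lra | auto |]. unfold genS. set (r := rho s w) in *.
  rewrite fsum_zero; [ring|]. intros i Hi. assert (Q := sigma_x s s r i Hi). rewrite Er in Q. rewrite Q. ring.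
Qed.

(** The function starts at 0 and its time derivative is a value of the Hamiltonian. A negative value
    would violate the bound by slope [- e] that [creeping] assembles from the local estimates. *)
Lemma genS_nonneg w : inR m w -> 0 <= genS t w.
Proof.
  intros Hw. apply Rnot_lt_le. intros Neg.
  set (e := - genS t w / (2 * (t - s))). assert (e0 : 0 < e) by (apply Rdiv_lt_0_compat; lra).
  assert (Q : - e * (t - s) <= genS t w - genS s w).
  { apply (creeping s t (fun a b => - e * (b - a) <= genS b w - genS a w)); auto.
    - intros. lra.
    - intros x Hx. destruct (genS_time x w e Hx Hw e0) as [dd [dd0 K]]. exists dd. split; auto.
      assert (Hx' : 0 <= H x (Phi x (rho x w))).
      { apply Hnn; [lra|]. apply HR; [lra|]. now apply rho_spec. }
      intros a b a1 a2 b1 b2 a3 b3 ab.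
      assert (Ka := K a ltac:(lra) ltac:(apply Rabs_def1; lra)).
      assert (Kb := K b ltac:(lra) ltac:(apply Rabs_def1; lra)).
      rewrite (Rabs_left1 (a - x)) in Ka by lra. rewrite (Rabs_right (b - x)) in Kb by lra.
      apply abs_le_inv in Ka. apply abs_le_inv in Kb.
      assert (0 <= H x (Phi x (rho x w)) * (b - x)) by (apply Rmult_le_pos; lra).
      assert (0 <= H x (Phi x (rho x w)) * (x - a)) by (apply Rmult_le_pos; lra).
      lra. }
  rewrite genS_start in Q by auto.
  assert (- e * (t - s) = genS t w / 2) by (unfold e; field; lra). lra.
Qed.

Lemma genA_x i w : (i < n)%nat -> genA t i w = Phi t (rho t w) (n + i)%nat - w (n + i)%nat.
Proof. intros Hi. unfold genA. now destruct (Nat.ltb_spec i n); [|lia]. Qed.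

Lemma genA_p i w : (i < n)%nat -> genA t (n + i) w = Phi s (rho t w) i - w i.
Proof.
  intros Hi. unfold genA. destruct (Nat.ltb_spec (n + i) n); [lia|].
  destruct (Nat.ltb_spec (n + i) (2 * n)); [|lia]. now replace (n + i - n)%nat with i by lia.
Qed.

Lemma genA_z w : genA t (2 * n) w = conf t (rho t w) * / conf s (rho t w) - 1.
Proof.
  unfold genA. destruct (Nat.ltb_spec (2 * n) n); [lia|]. now rewrite Nat.ltb_irrefl.
Qed.

Lemma rho_lip w w' : inR m w -> inR m w' -> dist1 m (rho t w) (rho t w') <= L * dist1 m w w'.
Proof.
  intros Hw Hw'. destruct (rho_spec t w) as [Hr Er]; [lra | auto |].
  destruct (rho_spec t w') as [Hr' Er']; [lra | auto |].
  assert (Q := proj1 (HL t ltac:(lra)) _ _ Hr Hr'). now rewrite Er, Er' in Q.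
Qed.

Lemma cont_rho f : cont m f -> cont m (fun w => f (rho t w)).
Proof.
  intros Hf. apply (cont_comp m m f (rho t)); auto.
  - intros w Hw. apply rho_spec; [lra | auto].
  - intros i Hi. apply (cont_lip m (fun w => rho t w i) L). intros v w Hv Hw.
    eapply Rle_trans; [apply (dist1_coord m); auto | now apply rho_lip].
Qed.

Lemma genA_cont i : (i < m)%nat -> cont m (genA t i).
Proof.
  intros Hi. destruct (index_cases i Hi) as [Hn|[[k [Hk ->]]| ->]].
  - apply (cont_ext m (fun w => Phi t (rho t w) (n + i)%nat - w (n + i)%nat)).
    + intros; now rewrite genA_x.
    + apply cont_minus; [|apply cont_coord; unfold m; lia].
      apply (cont_rho (fun r => Phi t r (n + i)%nat)). apply cont_Phi. unfold m; lia.
  - apply (cont_ext m (fun w => Phi s (rho t w) k - w k)).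
    + intros; now rewrite genA_p.
    + apply cont_minus; [|apply cont_coord; unfold m; lia].
      apply (cont_rho (fun r => Phi s r k)). apply cont_Phi. unfold m; lia.
  - apply (cont_ext m (fun w => conf t (rho t w) * / conf s (rho t w) - 1)).
    + intros; now rewrite genA_z.
    + apply cont_minus; [|apply cont_const]. apply (cont_rho (fun r => conf t r * / conf s r)).
      now apply cont_ratio.
Qed.

(** The box has bounded image under [sigma_map], so a point beyond that image comes from outside the
    support, where the step is the identity. *)
Lemma gen_supp : exists B', forall w, inR m w -> off m B' w ->
  genS t w = 0 /\ forall i, (i < m)%nat -> genA t i w = 0.
Proof.
  assert (Q : exists C, 0 < C /\ forall j, (j < m)%nat -> forall r, inR m r -> box m B r -> Rabs (sigma_map s t r j) <= C).
  { apply (finite_bound m (fun j C => forall r, inR m r -> box m B r -> Rabs (sigma_map s t r j) <= C)).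
    - intros j c c' le Q r Hr Hb. specialize (Q r Hr Hb). lra.
    - intros j Hj. destruct (cont_bounded m _ B (cont_sigma s t j Hs Hj)) as [C [C0 K]].
      exists C. split; auto. }
  destruct Q as [C [C0 K]]. exists C. intros w Hw [j [Hj Ho]].
  destruct (rho_spec t w) as [Hr Er]; [lra | auto |].
  assert (Hoff : off m B (rho t w)).
  { destruct (off_or_box m B (rho t w)) as [|Hb]; auto. exfalso.
    specialize (K j Hj _ Hr Hb). rewrite Er in K. lra. }
  assert (Ew : rho t w = w) by (rewrite <- (sigma_off s t (rho t w)); auto).
  split.
  - unfold genS. rewrite !HB by auto. rewrite Ew. rewrite fsum_zero; [ring | intros; ring].
  - intros i Hi. destruct (index_cases i Hi) as [Hn|[[k [Hk ->]]| ->]].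
    + rewrite genA_x, HB, Ew by auto. ring.
    + rewrite genA_p, HB, Ew by auto. ring.
    + rewrite genA_z, !E_off by auto. field.
Qed.

(** Subtracting [l] times the contact expansion at [s] from the one at [t] cancels the [alpha]
    terms. What [remainder_identity] leaves is [R3], a sum of products of two increments, small by
    the Lipschitz bounds. *)
Lemma genS_frechet w : inR m w -> frechet m (genS t) (fun i => genA t i w) w.
Proof.
  intros Hw e e0. destruct Phi_lip as [C [C0 KC]].
  destruct (rho_spec t w) as [Hr Er]; [lra | auto |]. set (r := rho t w) in *.
  assert (Px : 0 < conf t r) by (apply E_pos; auto; lra). assert (Ps : 0 < conf s r) by (apply E_pos; auto).
  set (l := conf t r * / conf s r). assert (l0 : 0 < l) by (apply Rmult_lt_0_compat; auto; now apply Rinv_0_lt_compat).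
  assert (Pm : 0 < INR m) by (apply lt_0_INR; unfold m; lia).
  set (e1 := e / (2 * (1 + l) * L)). assert (e10 : 0 < e1) by (apply Rdiv_lt_0_compat; nra).
  destruct (contact_expansion t r e1) as [d1 [d10 K1]]; auto.
  destruct (contact_expansion s r e1) as [d2 [d20 K2]]; auto.
  assert (m0 : 0 < Rmin d1 d2) by (apply Rmin_glb_lt; auto).
  set (d3 := Rmin (Rmin d1 d2 / (2 * (L * INR m))) (e / (4 * C * L * INR m))).
  assert (LM : 0 < L * INR m) by (apply Rmult_lt_0_compat; auto).
  assert (CLM : 0 < C * L * INR m) by (rewrite Rmult_assoc; apply Rmult_lt_0_compat; auto).
  exists d3. split; [apply Rmin_glb_lt; apply Rdiv_lt_0_compat; lra|]. intros w' Hw' N.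
  destruct (rho_spec t w') as [Hr' Er']; [lra | auto |]. set (r' := rho t w') in *.
  assert (D1 : dist1 m r r' <= L * dist1 m w w') by now apply rho_lip.
  assert (D0 := dist1_near m w w' d3 N). assert (Pd := dist1_nonneg m w w').
  assert (D2 : L * dist1 m w w' < Rmin d1 d2).
  { assert (d3 <= Rmin d1 d2 / (2 * (L * INR m))) by apply Rmin_l.
    apply (Rle_lt_trans _ (L * INR m * (Rmin d1 d2 / (2 * (L * INR m))))).
    - rewrite Rmult_assoc. apply Rmult_le_compat_l; [lra|]. eapply Rle_trans; [exact D0|].
      apply Rmult_le_compat_l; lra.
    - replace (L * INR m * (Rmin d1 d2 / (2 * (L * INR m)))) with (Rmin d1 d2 / 2) by (field; split; lra). lra. }
  assert (Nr : near m r r' (Rmin d1 d2)) by (apply near_dist1; lra).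
  assert (zt : Rabs (t - t) < d1) by (unfold Rminus; rewrite Rplus_opp_r, Rabs_R0; auto).
  assert (zs : Rabs (s - s) < d2) by (unfold Rminus; rewrite Rplus_opp_r, Rabs_R0; auto).
  specialize (K1 t r' zt Hr' (near_le _ _ _ _ _ (Rmin_l _ _) Nr)).
  specialize (K2 s r' zs Hr' (near_le _ _ _ _ _ (Rmin_r _ _) Nr)).
  replace (t - t) with 0 in K1 by ring. replace (s - s) with 0 in K2 by ring.
  rewrite Rmult_0_r, Rminus_0_r, Rabs_R0, Rplus_0_l in K1, K2.
  assert (EX : forall i, (i < n)%nat -> w i = Phi t r i /\ w' i = Phi t r' i).
  { intros i Hi. split; [rewrite <- Er | rewrite <- Er']; now rewrite sigma_x. }
  assert (EP : forall i, (i < n)%nat -> w (n + i)%nat = l * Phi s r (n + i)%nat).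
  { intros i Hi. unfold l. rewrite <- sigma_p by auto. now rewrite Er. }
  assert (EZ : w (2 * n)%nat = Phi s r (2 * n)%nat /\ w' (2 * n)%nat = Phi s r' (2 * n)%nat).
  { split; [rewrite <- Er | rewrite <- Er']; now rewrite sigma_z. }
  destruct EZ as [EZ EZ'].
  set (Ta := fsum m (fun k => alpha_coef n r k * (r' k - r k))) in *.
  assert (I := remainder_identity n w w' (Phi s r) (Phi s r') (fun i => Phi t r (n + i)%nat)
     (fun i => Phi s r (n + i)%nat) (fun i => w (n + i)%nat) (fun i => w' (n + i)%nat) l EP). simpl in I.
  set (R3 := fsum n (fun i => (w' (n + i)%nat - w (n + i)%nat) * ((w' i - Phi s r' i) - (w i - Phi s r i)))) in *.
  set (Y1 := fsum n (fun i => Phi t r (n + i)%nat * (Phi t r' i - Phi t r i))) in *.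
  set (Y2 := fsum n (fun i => Phi s r (n + i)%nat * (Phi s r' i - Phi s r i))) in *.
  assert (EY1 : fsum n (fun i => Phi t r (n + i)%nat * (w' i - w i)) = Y1).
  { apply fsum_ext. intros i Hi. destruct (EX i Hi) as [-> ->]. reflexivity. }
  rewrite EY1 in I.
  assert (EG : genS t w' - genS t w - fsum m (fun i => genA t i w * (w' i - w i)) =
     (Phi t r' (2 * n)%nat - Phi t r (2 * n)%nat - Y1 - conf t r * Ta) +
     - (l * (Phi s r' (2 * n)%nat - Phi s r (2 * n)%nat - Y2 - conf s r * Ta)) + - R3).
  { unfold m at 1. rewrite fsum_split, genA_z. fold r. fold l. unfold genS. fold r r'.
    rewrite (fsum_ext n (fun i => genA t i w * (w' i - w i))
       (fun i => (Phi t r (n + i)%nat - w (n + i)%nat) * (w' i - w i))) by (intros; now rewrite genA_x).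
    rewrite (fsum_ext n (fun i => genA t (n + i) w * (w' (n + i)%nat - w (n + i)%nat))
       (fun i => (Phi s r i - w i) * (w' (n + i)%nat - w (n + i)%nat))) by (intros; now rewrite genA_p).
    assert (ES : conf t r = l * conf s r) by (unfold l; field; lra). rewrite ES, EZ, EZ'.
    lra. }
  rewrite EG.
  assert (B3 : Rabs R3 <= dist1 m w w' * (2 * C * dist1 m r r')).
  { eapply Rle_trans; [apply fsum_abs|].
    apply (Rle_trans _ (fsum n (fun i => (2 * C * dist1 m r r') * Rabs (w' (n + i)%nat - w (n + i)%nat)))).
    - apply fsum_le. intros i Hi. rewrite Rabs_mult, (Rmult_comm (2 * C * _)). apply Rmult_le_compat_l; [apply Rabs_pos|].
      destruct (EX i Hi) as [-> ->].
      replace (Phi t r' i - Phi s r' i - (Phi t r i - Phi s r i)) with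
        ((Phi t r' i - Phi t r i) + - (Phi s r' i - Phi s r i)) by ring.
      eapply Rle_trans; [apply Rabs_triang|]. rewrite Rabs_Ropp.
      assert (Hi' : (i < m)%nat) by (unfold m; lia).
      assert (A1 := KC i Hi' t r r' Ht Hr Hr'). assert (A2 := KC i Hi' s r r' Hs Hr Hr'). lra.
    - rewrite fsum_scal, Rmult_comm. apply Rmult_le_compat_r.
      + assert (P := dist1_nonneg m r r'). repeat apply Rmult_le_pos; lra.
      + unfold dist1, m. rewrite fsum_split.
        assert (0 <= fsum n (fun i => Rabs (w' i - w i))) by (apply fsum_nonneg; intros; apply Rabs_pos).
        assert (P := Rabs_pos (w' (2 * n)%nat - w (2 * n)%nat)). lra. }
  assert (B3' : Rabs R3 <= e / 2 * dist1 m w w').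
  { eapply Rle_trans; [exact B3|]. rewrite Rmult_comm. apply Rmult_le_compat_r; auto.
    assert (d3 <= e / (4 * C * L * INR m)) by apply Rmin_r.
    apply (Rle_trans _ (2 * C * (L * (INR m * (e / (4 * C * L * INR m)))))).
    - apply Rmult_le_compat_l; [lra|]. eapply Rle_trans; [exact D1|]. apply Rmult_le_compat_l; [lra|].
      eapply Rle_trans; [exact D0|]. apply Rmult_le_compat_l; lra.
    - apply Req_le. field. repeat split; lra. }
  eapply Rle_trans; [apply Rabs_triang|]. rewrite Rabs_Ropp.
  apply (Rle_trans _ ((e1 * (L * dist1 m w w') + l * (e1 * (L * dist1 m w w'))) + e / 2 * dist1 m w w')).
  - apply Rplus_le_compat; auto. eapply Rle_trans; [apply Rabs_triang|].
    rewrite Rabs_Ropp, Rabs_mult, (Rabs_right l) by lra. apply Rplus_le_compat.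
    + eapply Rle_trans; [exact K1|]. apply Rmult_le_compat_l; lra.
    + apply Rmult_le_compat_l; [lra|]. eapply Rle_trans; [exact K2|]. apply Rmult_le_compat_l; lra.
  - apply Req_le. unfold e1. field. split; lra.
Qed.

Lemma step_exists : exists S A psi F, contact_step n S A psi F /\
  forall r, inR m r -> psi (Phi s r) = Phi t r /\ F (Phi s r) = conf t r * / conf s r.
Proof.
  destruct (Hinv s Hs) as [inv [[invR _] [invl invr]]].
  exists (genS t), (genA t), (fun q => Phi t (inv q)), (fun q => conf t (inv q) * / conf s (inv q)).
  split; [|intros r Hr; now rewrite invl].
  constructor.
  - apply genS_frechet.
  - apply genA_cont.
  - apply gen_supp.
  - apply genS_nonneg.
  - intros q Hq. apply HR; auto.
  - intros q Hq. apply Rmult_lt_0_compat; [apply E_pos; auto|].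
    apply Rinv_0_lt_compat, E_pos; auto.
  - intros w Hw. destruct (rho_spec t w) as [Hr Er]; [lra | auto |].
    exists (Phi s (rho t w)). split; [now apply HR|]. unfold generated. rewrite invl by auto.
    split; [intros i Hi; split; [|split; [|split]]|split; [|split]].
    + rewrite <- (sigma_x s t) by auto. now rewrite Er.
    + rewrite <- sigma_p by auto. now rewrite Er.
    + now apply genA_x.
    + now apply genA_p.
    + rewrite <- (sigma_z s t). now rewrite Er.
    + apply genA_z.
    + reflexivity.
Qed.
End Step.

Lemma local_steps t0 : 0 <= t0 <= 1 -> exists d, 0 < d /\ forall s t, 0 <= s <= 1 -> 0 <= t <= 1 ->
  Rabs (s - t0) < d -> Rabs (t - t0) < d -> s < t ->
  exists S A psi F, contact_step n S A psi F /\
  forall r, inR m r -> psi (Phi s r) = Phi t r /\ F (Phi s r) = conf t r * / conf s r.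
Proof.
  intros Ht0. destruct (sigma_bijective t0 Ht0) as [d [L [d0 [L0 K]]]].
  exists d. split; auto. intros s t Hs Ht Ss Tt st. apply (step_exists s t L); auto.
  intros x Hx. apply K; auto; [lra|]. apply Rabs_def1; [apply Rabs_def2 in Tt; lra | apply Rabs_def2 in Ss; lra].
Qed.

End Isotopy.

(** * Cutting a positive contactomorphism into steps *)

Fixpoint orbit (psi : nat -> (nat -> R) -> nat -> R) (q : nat -> R) (j : nat) : nat -> R :=
  match j with O => q | S j => psi j (orbit psi q j) end.

Fixpoint orbit_factor (F : nat -> (nat -> R) -> R) (psi : nat -> (nat -> R) -> nat -> R) (q : nat -> R) (j : nat) : R :=
  match j with O => 1 | S j => F j (orbit psi q j) * orbit_factor F psi q j end.

Definition contact_chain n (S : nat -> (nat -> R) -> R) A psi F :=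
  forall j : nat, contact_step n (S j) (A j) (psi j) (F j).

Lemma orbit_ext psi psi' q k : (forall j, (j < k)%nat -> psi j = psi' j) -> orbit psi q k = orbit psi' q k.
Proof. induction k; intros K; simpl; auto. rewrite IHk, K; auto. Qed.

Lemma orbit_shift psi q k j : orbit psi q (k + j) = orbit (fun i => psi (k + i)%nat) (orbit psi q k) j.
Proof. induction j; simpl; [now rewrite Nat.add_0_r | rewrite Nat.add_succ_r; simpl; now rewrite IHj]. Qed.

Lemma orbit_factor_ext F F' psi psi' q k : (forall j, (j < k)%nat -> psi j = psi' j /\ F j = F' j) ->
  orbit_factor F psi q k = orbit_factor F' psi' q k.
Proof.
  induction k; intros K; simpl; auto. rewrite IHk by auto. destruct (K k) as [_ ->]; auto.
  rewrite (orbit_ext psi psi'); auto. intros j Hj. apply K; lia.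
Qed.

Lemma orbit_factor_shift F psi q k j : orbit_factor F psi q (k + j) =
  orbit_factor (fun i => F (k + i)%nat) (fun i => psi (k + i)%nat) (orbit psi q k) j * orbit_factor F psi q k.
Proof.
  induction j; simpl; [rewrite Nat.add_0_r; ring|].
  rewrite Nat.add_succ_r; simpl. rewrite IHj, orbit_shift. ring.
Qed.

Lemma orbit_inR n S A psi F q j : contact_chain n S A psi F -> inR (2 * n + 1) q -> inR (2 * n + 1) (orbit psi q j).
Proof. intros C Hq. induction j; simpl; auto. now apply (step_inR _ _ _ _ _ (C j)). Qed.

Lemma step_decomposition (n : nat) (phi : (nat -> R) -> nat -> R) : positive_contactomorphism n phi ->
  exists N S A psi F, (1 <= N)%nat /\ contact_chain n S A psi F /\
    (forall q, inR (2 * n + 1) q -> orbit psi q N = phi q) /\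
    (forall g q, conf_factor n phi g -> inR (2 * n + 1) q -> orbit_factor F psi q N = exp (g q)).
Proof.
  intros [Phi [H [[Hsm [H0 Hct]] [[B HB] [HG [Hpos H1]]]]]].
  set (m := (2 * n + 1)%nat) in *.
  assert (Sm : forall j, (j < m)%nat -> smooth (S m) (component n Phi j)).
  { intros j Hj. replace (S m) with (2 * n + 2)%nat by (unfold m; lia). now apply Hsm. }
  set (D := fun j => match lt_dec j m with
    | left l => proj1_sig (constructive_indefinite_description _ (Ck_partials (S m) 1 _ (Sm j l 2%nat)))
    | right _ => fun _ _ => 0 end).
  assert (HDs : forall j, (j < m)%nat -> partials (S m) (component n Phi j) (D j) /\
     forall i, (i < S m)%nat -> Ck (S m) 1 (D j i)).
  { intros j Hj. unfold D. destruct (lt_dec j m) as [l|]; [|lia].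
    destruct (constructive_indefinite_description _ (Ck_partials (S m) 1 _ (Sm j l 2%nat))) as [g Hg]. exact Hg. }
  assert (HD : forall j, (j < m)%nat -> partials (S m) (component n Phi j) (D j)) by (intros; now apply HDs).
  assert (HDC : forall j i, (j < m)%nat -> (i < S m)%nat -> Ck (S m) 1 (D j i)) by (intros; now apply HDs).
  assert (HC : forall j, (j < m)%nat -> Ck (S m) 1 (component n Phi j)) by (intros j Hj; exact (Sm j Hj 1%nat)).
  assert (HB' : forall t r, 0 <= t <= 1 -> inR m r -> off m B r -> Phi t r = r) by (intros; now apply HB).
  assert (HR : forall t r, 0 <= t <= 1 -> inR m r -> inR m (Phi t r)).
  { intros t r Ht Hr. destruct (Hct t Ht) as [[Q _] _]. now apply Q. }
  assert (Hconf : forall t, 0 <= t <= 1 -> exists g, conf_factor n (Phi t) g).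
  { intros t Ht. destruct (Hct t Ht) as [_ [_ [g [_ Hg]]]]. now exists g. }
  assert (Hinv : forall t, 0 <= t <= 1 -> exists psi, smooth_map m psi /\
    (forall p, inR m p -> psi (Phi t p) = p) /\ (forall p, inR m p -> Phi t (psi p) = p)).
  { intros t Ht. destruct (Hct t Ht) as [_ [Q _]]. exact Q. }
  (* Positivity is assumed only in the interior of the support. [H t] is continuous, being a
     coefficient of the isotopy read at the preimage, so a point where it is nonzero has a
     neighbourhood of such points and lies in that interior. *)
  assert (Hnn : forall t p, 0 <= t <= 1 -> inR m p -> 0 <= H t p).
  { intros t p Ht Hp. destruct (Hinv t Ht) as [psi [[psiR psiS] [psil psir]]].
    assert (CH : cont m (H t)).
    { apply (cont_ext m (fun q => coeff n Phi D m (pack m t (psi q)))).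
      - intros v Hv. assert (Q := form_time n Phi H D HD HG t (psi v) Ht (psiR v Hv)).
        fold m in Q. rewrite Q. now rewrite psir.
      - apply (cont_comp m m (fun r => coeff n Phi D m (pack m t r)) psi); auto.
        + apply (cont_pack n). eapply Ck_cont. apply (form_C1 n Phi D HDC HC). fold m; lia.
        + intros i Hi. exact (Ck_cont _ _ _ (psiS i Hi 0%nat)). }
    destruct (Req_dec (H t p) 0) as [->|ne]; [lra|]. left. apply Hpos; auto.
    destruct (CH p Hp (Rabs (H t p)) (Rabs_pos_lt _ ne)) as [d [d0 K]].
    exists d. split; auto. intros w Hw N e e0. exists w. split; [auto|]. split; [now apply near_refl|].
    intros Z. specialize (K w Hw N). rewrite Z in K.
    unfold Rminus in K. rewrite Rplus_0_l, Rabs_Ropp in K. lra. }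
  set (E := conf n Phi D) in *.
  assert (Epos : forall t r, 0 <= t <= 1 -> inR m r -> 0 < E t r).
  { intros. now apply (E_pos n Phi D HD Hconf). }
  (* Chains from time [a] to time [b] concatenate, and the ratios [E b r / E a r] multiply
     accordingly, so [creeping] applies to this relation. *)
  set (G := fun a b => exists N S A psi F, (1 <= N)%nat /\ contact_chain n S A psi F /\
    forall r, inR m r -> orbit psi (Phi a r) N = Phi b r /\ orbit_factor F psi (Phi a r) N = E b r * / E a r).
  assert (G01 : G 0 1).
  { apply creeping; [lra | |].
    - intros a b c a0 ab bc c1 [N [S [A [psi [F [HN [HCh K]]]]]]] [N' [S' [A' [psi' [F' [HN' [HCh' K']]]]]]].
      set (glue := fun X (u v : nat -> X) j => if Nat.ltb j N then u j else v (j - N)%nat).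
      exists (N + N')%nat, (glue _ S S'), (glue _ A A'), (glue _ psi psi'), (glue _ F F').
      assert (g1 : forall X (u v : nat -> X) j, (j < N)%nat -> glue X u v j = u j).
      { intros X u v j Hj. unfold glue. destruct (Nat.ltb_spec j N); [auto|lia]. }
      assert (g2 : forall X (u v : nat -> X), (fun i => glue X u v (N + i)%nat) = v).
      { intros X u v. apply functional_extensionality. intros i. unfold glue.
        destruct (Nat.ltb_spec (N + i) N); [lia|]. f_equal. lia. }
      split; [lia|]. split.
      + intros j. unfold glue. destruct (Nat.ltb j N); auto.
      + intros r Hr. destruct (K r Hr) as [K1 K2]. destruct (K' r Hr) as [K1' K2'].
        assert (Eo : orbit (glue _ psi psi') (Phi a r) N = Phi b r).
        { rewrite (orbit_ext _ psi); auto. }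
        rewrite orbit_shift, orbit_factor_shift, !g2, Eo, K1', K2'. split; auto.
        rewrite (orbit_factor_ext _ F _ psi) by (intros; split; now apply g1). rewrite K2.
        assert (P1 := Epos b r ltac:(lra) Hr). assert (P2 := Epos a r ltac:(lra) Hr). field. lra.
    - intros x Hx. destruct (local_steps n Phi H D B HD HDC HC HB' HR Hconf Hinv HG Hnn x Hx) as [d [d0 K]].
      exists d. split; auto. intros s t s0 sx xt t1 ds dt st.
      destruct (K s t) as [S [A [psi [F [St Q]]]]]; try lra; try (apply Rabs_def1; lra).
      exists 1%nat, (fun _ => S), (fun _ => A), (fun _ => psi), (fun _ => F).
      split; [lia|]. split; [intros j; exact St|]. intros r Hr. simpl. destruct (Q r Hr) as [-> ->].
      split; auto. apply Rmult_1_r. }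
  destruct G01 as [N [S [A [psi [F [HN [HCh K]]]]]]].
  exists N, S, A, psi, F. split; auto. split; auto. split.
  - intros q Hq. destruct (K q Hq) as [K1 _]. rewrite H0 in K1 by auto. now rewrite K1, H1.
  - intros g q Hg Hq. destruct (K q Hq) as [_ K2]. rewrite H0 in K2 by auto. rewrite K2.
    assert (E1 : E 1 q = exp (g q)).
    { apply (E_conf n Phi D HD); [lra | | auto]. intros p Hp j Hj.
      destruct (Hg p Hp j Hj) as [dz [dx [Hz [Hx Ef]]]]. exists dz, dx. rewrite H1 by auto.
      split; [|split; [|exact Ef]].
      - apply (derivable_pt_lim_ext_near (fun s => phi (upd p j s) (2 * n)%nat) _ 0 _ 1 Rlt_0_1); auto.
        intros h _. rewrite H1; auto. now apply upd_inR.
      - intros i Hi. apply (derivable_pt_lim_ext_near (fun s => phi (upd p j s) i) _ 0 _ 1 Rlt_0_1); auto.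
        intros h _. rewrite H1; auto. now apply upd_inR. }
    assert (E0 : E 0 q = 1).
    { destruct (Hconf 0) as [g0 Hg0]; [lra|].
      unfold E. rewrite (E_conf n Phi D HD 0 g0) by (auto; lra).
      assert (H2n : (2 * n < m)%nat) by (unfold m; lia).
      destruct (Hg0 q Hq (2 * n)%nat H2n) as [dz [dx [Hz [Hx Ef]]]].
      rewrite alpha_last, Rmult_1_r in Ef. rewrite <- Ef.
      assert (Hup : forall j h, Phi 0 (upd q (2 * n) (0 + h)) j = upd q (2 * n) (0 + h) j).
      { intros j h. rewrite H0; auto. apply upd_inR; auto. }
      replace dz with 1.
      2:{ apply (uniqueness_limite (fun s => Phi 0 (upd q (2 * n) s) (2 * n)%nat) 0); auto.
          apply (derivable_pt_lim_ext_near (fun s => q (2 * n)%nat + s) _ 0 _ 1 Rlt_0_1).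
          - intros h _. rewrite Hup. now rewrite upd_same.
          - replace 1 with (0 + 1) by ring.
            apply (derivable_pt_lim_plus (fun _ => q (2 * n)%nat) id); [apply derivable_pt_lim_const | apply derivable_pt_lim_id]. }
      rewrite fsum_zero; [ring|]. intros i Hi. replace (dx i) with 0; [ring|].
      apply (uniqueness_limite (fun s => Phi 0 (upd q (2 * n) s) i) 0); auto.
      apply (derivable_pt_lim_ext_near (fun s => q i) _ 0 _ 1 Rlt_0_1).
      - intros h _. rewrite Hup. rewrite upd_other; auto. lia.
      - apply derivable_pt_lim_const. }
    rewrite E0, E1. field.
Qed.

(** * The discrete action functional *)

Lemma fsum_grid N n f : fsum (N * n) f = fsum N (fun j => fsum n (fun i => f (j * n + i)%nat)).
Proof.
  induction N; simpl; auto. rewrite Nat.add_comm, fsum_add, IHN. reflexivity.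
Qed.

Lemma frechet_cont M f A : (forall w, inR M w -> frechet M f (A w) w) -> cont M f.
Proof.
  intros H v Hv e e0. destruct (H v Hv 1 Rlt_0_1) as [d [d0 K]].
  set (C := fsum M (fun i => Rabs (A v i)) + 1).
  assert (CA : 0 <= fsum M (fun i => Rabs (A v i))) by (apply fsum_nonneg; intros; apply Rabs_pos).
  assert (Pm : 0 <= INR M) by apply pos_INR.
  assert (D0 : 0 < C * INR M + 1) by (unfold C; nra).
  set (d' := Rmin d (e / (C * INR M + 1))).
  assert (d'0 : 0 < d') by (apply Rmin_glb_lt; auto; apply Rdiv_lt_0_compat; lra).
  exists d'. split; auto. intros w Hw N.
  specialize (K w Hw (near_le _ _ _ _ _ (Rmin_l _ _) N)).
  assert (S1 : Rabs (fsum M (fun i => A v i * (w i - v i))) <= (C - 1) * dist1 M v w).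
  { eapply Rle_trans; [apply fsum_abs|]. unfold C.
    replace (fsum M (fun i => Rabs (A v i)) + 1 - 1) with (fsum M (fun i => Rabs (A v i))) by ring.
    rewrite Rmult_comm, <- fsum_scal. apply fsum_le. intros i Hi. rewrite Rabs_mult, Rmult_comm.
    apply Rmult_le_compat_r; [apply Rabs_pos | now apply dist1_coord]. }
  assert (D1 := dist1_near M v w d' N). assert (Pd := dist1_nonneg M v w).
  replace (f w - f v) with ((f w - f v - fsum M (fun i => A v i * (w i - v i))) + fsum M (fun i => A v i * (w i - v i))) by ring.
  eapply Rle_lt_trans; [apply Rabs_triang|].
  assert (L : d' <= e / (C * INR M + 1)) by apply Rmin_r.
  assert (C * INR M * (e / (C * INR M + 1)) < e).
  { replace (C * INR M * (e / (C * INR M + 1))) with (e - e / (C * INR M + 1)) by (field; lra).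
    assert (0 < e / (C * INR M + 1)) by (apply Rdiv_lt_0_compat; lra). lra. }
  assert (C * dist1 M v w <= C * (INR M * (e / (C * INR M + 1)))).
  { apply Rmult_le_compat_l; [unfold C; lra|]. eapply Rle_trans; [exact D1|]. now apply Rmult_le_compat_l. }
  lra.
Qed.

Section Action.
Variables (n N : nat) (St : nat -> (nat -> R) -> R) (A : nat -> nat -> (nat -> R) -> R).
Variables (psi : nat -> (nat -> R) -> nat -> R) (F : nat -> (nat -> R) -> R).
Hypothesis HN : (1 <= N)%nat.
Hypothesis Hch : contact_chain n St A psi F.
Let m := (2 * n + 1)%nat.

(* A configuration w holds the positions X_j, momenta P_j (j < N) and the initial height z. *)
Definition dimw : nat := (N * n + N * n + 1)%nat.
Definition iX (j i : nat) : nat := (j * n + i)%nat.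
Definition iP (j i : nat) : nat := (N * n + (j * n + i))%nat.
Definition iZ : nat := (N * n + N * n)%nat.

Lemma iX_lt j i : (j < N)%nat -> (i < n)%nat -> (iX j i < N * n)%nat.
Proof. unfold iX. intros. nia. Qed.

Lemma iX_dim j i : (j < N)%nat -> (i < n)%nat -> (iX j i < dimw)%nat.
Proof. intros. assert (Q := iX_lt j i H H0). unfold dimw. lia. Qed.

Lemma iP_dim j i : (j < N)%nat -> (i < n)%nat -> (iP j i < dimw)%nat.
Proof. intros. assert (Q := iX_lt j i H H0). unfold dimw, iP, iX in *. lia. Qed.

Lemma iZ_dim : (iZ < dimw)%nat.
Proof. unfold iZ, dimw. lia. Qed.

Lemma index_grid k : (k < dimw)%nat ->
  (exists j i, (j < N)%nat /\ (i < n)%nat /\ k = iX j i) \/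
  (exists j i, (j < N)%nat /\ (i < n)%nat /\ k = iP j i) \/ k = iZ.
Proof.
  intros Hk.
  assert (G : forall k, (k < N * n)%nat -> exists j i, (j < N)%nat /\ (i < n)%nat /\ k = (j * n + i)%nat).
  { intros l Hl. assert (n0 : n <> 0%nat) by nia. exists (l / n)%nat, (l mod n)%nat.
    split; [apply Nat.Div0.div_lt_upper_bound; lia|]. split; [now apply Nat.mod_upper_bound|].
    rewrite Nat.mul_comm. now apply Nat.div_mod. }
  destruct (lt_dec k (N * n)) as [l|l].
  - left. destruct (G k l) as [j [i [Hj [Hi ->]]]]. exists j, i. auto.
  - destruct (lt_dec k (N * n + N * n)) as [l'|l'].
    + right; left. destruct (G (k - N * n)%nat) as [j [i [Hj [Hi E]]]]; [lia|]. exists j, i.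
      unfold iP. repeat split; auto; lia.
    + right; right. unfold dimw in Hk. unfold iZ. lia.
Qed.

Definition layout (x p : nat -> nat -> R) (z : R) : nat -> R := fun k =>
  if Nat.ltb k (N * n) then x (k / n)%nat (k mod n)
  else if Nat.ltb k (N * n + N * n) then p ((k - N * n) / n)%nat ((k - N * n) mod n)
  else if Nat.eqb k iZ then z else 0.

Lemma layout_inR x p z : inR dimw (layout x p z).
Proof.
  intros k Hk. unfold layout, dimw, iZ in *. destruct (Nat.ltb_spec k (N * n)); [lia|].
  destruct (Nat.ltb_spec k (N * n + N * n)); [lia|]. destruct (Nat.eqb_spec k (N * n + N * n)); [lia|auto].
Qed.

Lemma grid_div j i : (i < n)%nat -> ((j * n + i) / n = j /\ (j * n + i) mod n = i)%nat.
Proof.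
  intros Hi. split.
  - rewrite Nat.div_add_l by lia. rewrite Nat.div_small; lia.
  - rewrite Nat.add_comm, Nat.Div0.mod_add. now apply Nat.mod_small.
Qed.

Lemma layout_X x p z j i : (j < N)%nat -> (i < n)%nat -> layout x p z (iX j i) = x j i.
Proof.
  intros Hj Hi. unfold layout. assert (Q := iX_lt j i Hj Hi).
  destruct (Nat.ltb_spec (iX j i) (N * n)); [|lia]. unfold iX. destruct (grid_div j i Hi) as [-> ->]. auto.
Qed.

Lemma layout_P x p z j i : (j < N)%nat -> (i < n)%nat -> layout x p z (iP j i) = p j i.
Proof.
  intros Hj Hi. unfold layout. assert (Q := iX_lt j i Hj Hi). unfold iX in Q.
  unfold iP. destruct (Nat.ltb_spec (N * n + (j * n + i)) (N * n)); [lia|].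
  destruct (Nat.ltb_spec (N * n + (j * n + i)) (N * n + N * n)); [|lia].
  replace (N * n + (j * n + i) - N * n)%nat with (j * n + i)%nat by lia.
  destruct (grid_div j i Hi) as [-> ->]. auto.
Qed.

Lemma layout_Z x p z : layout x p z iZ = z.
Proof.
  unfold layout, iZ. destruct (Nat.ltb_spec (N * n + N * n) (N * n)).
  - exfalso. lia.
  - rewrite Nat.ltb_irrefl, Nat.eqb_refl. auto.
Qed.

Lemma fsum_layout f : fsum dimw f = fsum N (fun j => fsum n (fun i => f (iX j i)))
  + fsum N (fun j => fsum n (fun i => f (iP j i))) + f iZ.
Proof.
  unfold dimw. rewrite Nat.add_1_r. simpl. rewrite fsum_add, !fsum_grid. reflexivity.
Qed.

Definition prev (j : nat) : nat := match j with O => (N - 1)%nat | S k => k end.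
Definition next (j : nat) : nat := if Nat.eqb (S j) N then O else S j.

Lemma prev_lt j : (j < N)%nat -> (prev j < N)%nat.
Proof. destruct j; simpl; lia. Qed.

Lemma fsum_cyclic (f : nat -> nat -> R) : fsum N (fun j => f (prev j) j) = fsum N (fun j => f j (next j)).
Proof.
  assert (Q : forall k, fsum (S k) (fun j => f (prev j) j) = f (prev 0) 0%nat + fsum k (fun j => f j (S j))).
  { induction k; [simpl; ring|]. change (fsum (S (S k)) (fun j => f (prev j) j)) with
      (fsum (S k) (fun j => f (prev j) j) + f (prev (S k)) (S k)). rewrite IHk. simpl. ring. }
  assert (EN : N = S (N - 1)) by lia.
  assert (E : fsum (S (N - 1)) (fun j => f j (next j)) = fsum (N - 1) (fun j => f j (S j)) + f (N - 1)%nat 0%nat).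
  { simpl. f_equal.
    - apply fsum_ext. intros j Hj. unfold next. destruct (Nat.eqb_spec (S j) N); [lia|auto].
    - unfold next. destruct (Nat.eqb_spec (S (N - 1)) N); [auto|lia]. }
  rewrite EN, Q, E. unfold prev. ring.
Qed.

Definition node (w : nat -> R) (z : R) (j : nat) : nat -> R := fun i =>
  if Nat.ltb i n then w (iX j i) else if Nat.ltb i (2 * n) then w (iP j (i - n))
  else if Nat.eqb i (2 * n) then z else 0.

Lemma node_inR w z j : inR m (node w z j).
Proof.
  intros i Hi. unfold node, m in *. destruct (Nat.ltb_spec i n); [lia|].
  destruct (Nat.ltb_spec i (2 * n)); [lia|]. destruct (Nat.eqb_spec i (2 * n)); [lia|auto].
Qed.

Lemma node_x w z j i : (i < n)%nat -> node w z j i = w (iX j i).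
Proof. intros Hi. unfold node. now destruct (Nat.ltb_spec i n); [|lia]. Qed.

Lemma node_p w z j i : (i < n)%nat -> node w z j (n + i)%nat = w (iP j i).
Proof.
  intros Hi. unfold node. destruct (Nat.ltb_spec (n + i) n); [lia|].
  destruct (Nat.ltb_spec (n + i) (2 * n)); [|lia]. now replace (n + i - n)%nat with i by lia.
Qed.

Lemma node_z w z j : node w z j (2 * n)%nat = z.
Proof.
  unfold node. destruct (Nat.ltb_spec (2 * n) n); [lia|]. now rewrite Nat.ltb_irrefl, Nat.eqb_refl.
Qed.

Definition xi (w : nat -> R) (j i : nat) : R := w (iX j i) - w (iX (prev j) i).
Definition pxi (w : nat -> R) (j : nat) : R := fsum n (fun i => w (iP j i) * xi w j i).

Fixpoint height (w : nat -> R) (j : nat) : R :=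
  match j with O => w iZ | S j => height w j + pxi w j + St j (node w (height w j) j) end.

Definition action (w : nat -> R) : R := height w N - height w 0.
Definition pt (w : nat -> R) (j : nat) : nat -> R := node w (height w j) j.
Lemma pt_x w j i : (i < n)%nat -> pt w j i = w (iX j i).
Proof. apply node_x. Qed.

Lemma pt_p w j i : (i < n)%nat -> pt w j (n + i)%nat = w (iP j i).
Proof. apply node_p. Qed.

Lemma pt_z w j : pt w j (2 * n)%nat = height w j.
Proof. apply node_z. Qed.

(** By [lam_generated] this is the conformal factor of step [j]. It multiplies a change of the
    height at [j], so [mu w j], the product over the steps from [j] on, measures the effect of that
    change on the final height. *)
Definition lam (w : nat -> R) (j : nat) : R := 1 + A j (2 * n) (pt w j).
Fixpoint lamprod (w : nat -> R) (j k : nat) : R := match k with O => 1 | S k => lam w j * lamprod w (S j) k end.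
Definition mu (w : nat -> R) (j : nat) : R := lamprod w j (N - j).

Lemma mu_step w j : (j < N)%nat -> mu w j = lam w j * mu w (S j).
Proof. intros H. unfold mu. replace (N - j)%nat with (S (N - S j)) by lia. reflexivity. Qed.

Lemma mu_last w : mu w N = 1.
Proof. unfold mu. now rewrite Nat.sub_diag. Qed.

Lemma lam_generated w j q : generated n (St j) (A j) (psi j) (F j) (pt w j) q -> lam w j = F j q.
Proof. intros [_ [_ [H _]]]. unfold lam. rewrite H. ring. Qed.

(** [X_j] enters twice: as position of step [j], and as previous position of step [next j]. Each
    contribution to a height is carried to the end by the corresponding [mu]. *)
Definition gX (w : nat -> R) (j i : nat) : R :=
  mu w (S j) * (w (iP j i) + A j i (pt w j)) - mu w (S (next j)) * w (iP (next j) i).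
Definition gP (w : nat -> R) (j i : nat) : R := mu w (S j) * (xi w j i + A j (n + i) (pt w j)).
Definition grad (w : nat -> R) : nat -> R := layout (gX w) (gP w) (mu w 0 - 1).

Definition line (x v : nat -> R) (t : R) : nat -> R := fun k => x k + t * v k.

Lemma line_inR x v t : inR dimw x -> inR dimw v -> inR dimw (line x v t).
Proof. intros Hx Hv k Hk. unfold line. rewrite Hx, Hv by auto. ring. Qed.

Lemma line_deriv x v t k : derivable_pt_lim (fun s => line x v s k) t (v k).
Proof.
  assert (Q : derivable_pt_lim (fun s => x k + s * v k) t (0 + (1 * v k + t * 0))).
  { apply (derivable_pt_lim_plus (fun _ => x k) (fun s => s * v k)); [apply derivable_pt_lim_const|].
    apply (derivable_pt_lim_mult id (fun _ => v k)); [apply derivable_pt_lim_id | apply derivable_pt_lim_const]. }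
  now replace (0 + (1 * v k + t * 0)) with (v k) in Q by ring.
Qed.

Definition dstep (w v : nat -> R) (j : nat) : R := fsum n (fun i =>
  v (iP j i) * (xi w j i + A j (n + i) (pt w j)) + v (iX j i) * (w (iP j i) + A j i (pt w j))
  - v (iX (prev j) i) * w (iP j i)).

Fixpoint dheight (w v : nat -> R) (j : nat) : R :=
  match j with O => v iZ | S j => lam w j * dheight w v j + dstep w v j end.

Lemma derivable_pt_lim_fsum k (f : nat -> R -> R) g t : (forall i, (i < k)%nat -> derivable_pt_lim (f i) t (g i)) ->
  derivable_pt_lim (fun s => fsum k (fun i => f i s)) t (fsum k g).
Proof.
  induction k; intros H; simpl; [apply derivable_pt_lim_const|].
  apply (derivable_pt_lim_plus (fun s => fsum k (fun i => f i s)) (f k)); auto.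
Qed.

Lemma height_deriv x v t j : derivable_pt_lim (fun s => height (line x v s) j) t (dheight (line x v t) v j).
Proof.
  induction j as [|j IH]; [exact (line_deriv x v t iZ)|].
  set (w := line x v t) in *. simpl.
  assert (D1 : derivable_pt_lim (fun s => pxi (line x v s) j) t
     (fsum n (fun i => v (iP j i) * xi w j i + w (iP j i) * (v (iX j i) - v (iX (prev j) i))))).
  { apply (derivable_pt_lim_fsum n (fun i s => line x v s (iP j i) * xi (line x v s) j i)). intros i Hi.
    apply (derivable_pt_lim_mult (fun s => line x v s (iP j i)) (fun s => xi (line x v s) j i)).
    - apply line_deriv.
    - apply (derivable_pt_lim_minus (fun s => line x v s (iX j i)) (fun s => line x v s (iX (prev j) i))); apply line_deriv. }
  assert (D2 := frechet_curve m (St j) (fun i => A j i (pt w j)) (fun s => pt (line x v s) j)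
     (fun i => if Nat.ltb i n then v (iX j i) else if Nat.ltb i (2 * n) then v (iP j (i - n)) else dheight w v j) t).
  assert (D2' : derivable_pt_lim (fun s => St j (pt (line x v s) j)) t
     (fsum m (fun i => A j i (pt w j) * (if Nat.ltb i n then v (iX j i) else if Nat.ltb i (2 * n) then v (iP j (i - n)) else dheight w v j)))).
  { apply D2.
    - apply (step_frechet _ _ _ _ _ (Hch j)). apply node_inR.
    - intros s. apply node_inR.
    - intros i Hi. unfold pt, node. destruct (Nat.ltb_spec i n); [apply line_deriv|].
      destruct (Nat.ltb_spec i (2 * n)); [apply line_deriv|].
      destruct (Nat.eqb_spec i (2 * n)); [exact IH | unfold m in Hi; lia]. }
  assert (D := derivable_pt_lim_plus _ _ t _ _ (derivable_pt_lim_plus _ _ t _ _ IH D1) D2').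
  match type of D with derivable_pt_lim _ _ ?a => match goal with |- derivable_pt_lim _ _ ?b => replace b with a end end; [exact D|].
  unfold m. rewrite fsum_split, Nat.ltb_irrefl.
  destruct (Nat.ltb_spec (2 * n) n); [lia|].
  rewrite (fsum_ext n (fun i => A j i (pt w j) * _) (fun i => A j i (pt w j) * v (iX j i))).
  2:{ intros i Hi. destruct (Nat.ltb_spec i n); [auto|lia]. }
  rewrite (fsum_ext n (fun i => A j (n + i) (pt w j) * _) (fun i => A j (n + i) (pt w j) * v (iP j i))).
  2:{ intros i Hi. destruct (Nat.ltb_spec (n + i) n); [lia|]. destruct (Nat.ltb_spec (n + i) (2 * n)); [|lia].
      now replace (n + i - n)%nat with i by lia. }
  unfold lam, dstep.
  rewrite (fsum_ext n (fun i => v (iP j i) * (xi w j i + _) + _ - _) (fun i =>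
     (v (iP j i) * xi w j i + w (iP j i) * (v (iX j i) - v (iX (prev j) i))) +
     (A j i (pt w j) * v (iX j i) + A j (n + i) (pt w j) * v (iP j i)))) by (intros; ring).
  rewrite !fsum_plus. ring.
Qed.

(** Variation of constants for the linear recursion [dheight], with integrating factor [mu]. *)
Lemma dheight_closed w v j : (j <= N)%nat ->
  mu w j * dheight w v j = mu w 0 * v iZ + fsum j (fun i => mu w (S i) * dstep w v i).
Proof.
  induction j; intros Hj; simpl; [ring|]. rewrite <- Rplus_assoc, <- IHj by lia.
  rewrite (mu_step w j) by lia. ring.
Qed.

Lemma action_deriv x v t : derivable_pt_lim (fun s => action (line x v s)) t
  (fsum dimw (fun k => grad (line x v t) k * v k)).
Proof.
  set (w := line x v t).
  assert (D := derivable_pt_lim_minus _ _ t _ _ (height_deriv x v t N) (height_deriv x v t 0)).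
  match type of D with derivable_pt_lim _ _ ?a => match goal with |- derivable_pt_lim _ _ ?b => replace b with a end end; [exact D|].
  fold w. assert (Q := dheight_closed w v N (le_n N)). rewrite mu_last, Rmult_1_l in Q. rewrite Q. simpl.
  rewrite fsum_layout. unfold grad at 3. rewrite layout_Z.
  rewrite (fsum_ext N (fun j => fsum n (fun i => grad w (iX j i) * v (iX j i)))
    (fun j => mu w (S j) * fsum n (fun i => (w (iP j i) + A j i (pt w j)) * v (iX j i)) -
      mu w (S (next j)) * fsum n (fun i => w (iP (next j) i) * v (iX j i)))).
  2:{ intros j Hj. rewrite <- !fsum_scal, <- fsum_minus. apply fsum_ext. intros i Hi.
      unfold grad. rewrite layout_X by auto. unfold gX. ring. }
  rewrite fsum_minus, <- (fsum_cyclic (fun j k => mu w (S k) * fsum n (fun i => w (iP k i) * v (iX j i)))).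
  rewrite (fsum_ext N (fun j => fsum n (fun i => grad w (iP j i) * v (iP j i)))
    (fun j => mu w (S j) * fsum n (fun i => (xi w j i + A j (n + i) (pt w j)) * v (iP j i)))).
  2:{ intros j Hj. rewrite <- !fsum_scal. apply fsum_ext. intros i Hi.
      unfold grad. rewrite layout_P by auto. unfold gP. ring. }
  rewrite (fsum_ext N (fun i => mu w (S i) * dstep w v i) (fun j =>
     mu w (S j) * fsum n (fun i => (w (iP j i) + A j i (pt w j)) * v (iX j i))
     - mu w (S j) * fsum n (fun i => w (iP j i) * v (iX (prev j) i))
     + mu w (S j) * fsum n (fun i => (xi w j i + A j (n + i) (pt w j)) * v (iP j i)))).
  - rewrite fsum_plus, fsum_minus. ring.
  - intros j Hj. rewrite <- Rmult_minus_distr_l, <- Rmult_plus_distr_l, <- fsum_minus, <- fsum_plus.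
    f_equal. unfold dstep. apply fsum_ext. intros; ring.
Qed.

(** * Continuity and critical points *)

Lemma cont_xi j i : (j < N)%nat -> (i < n)%nat -> cont dimw (fun w => xi w j i).
Proof. intros Hj Hi. apply cont_minus; apply cont_coord, iX_dim; auto. now apply prev_lt. Qed.

Lemma cont_height j : (j <= N)%nat -> cont dimw (fun w => height w j).
Proof.
  induction j as [|j IH]; intros Hj; simpl; [apply cont_coord, iZ_dim|].
  apply cont_plus; [apply cont_plus; [apply IH; lia|]|].
  + apply (cont_fsum dimw n (fun i w => w (iP j i) * xi w j i)). intros i Hi. apply cont_mult.
    * apply cont_coord, iP_dim; auto. * apply cont_xi; auto.
  + apply (cont_comp dimw m (St j) (fun w => node w (height w j) j)).
    * apply (frechet_cont m _ (fun w i => A j i w)). apply (step_frechet _ _ _ _ _ (Hch j)).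
    * intros; apply node_inR.
    * intros i Hi. unfold node. destruct (Nat.ltb_spec i n); [apply cont_coord, iX_dim; auto|].
      destruct (Nat.ltb_spec i (2 * n)); [apply cont_coord, iP_dim; auto; lia|].
      destruct (Nat.eqb_spec i (2 * n)); [apply IH; lia | apply cont_const].
Qed.

Lemma cont_pt j i : (j < N)%nat -> (i < m)%nat -> cont dimw (fun w => pt w j i).
Proof.
  intros Hj Hi. unfold pt, node. destruct (Nat.ltb_spec i n); [apply cont_coord, iX_dim; auto|].
    destruct (Nat.ltb_spec i (2 * n)); [apply cont_coord, iP_dim; auto; lia|].
    destruct (Nat.eqb_spec i (2 * n)); [apply cont_height; lia | apply cont_const].
Qed.

Lemma cont_action : cont dimw action.
Proof. apply cont_minus; apply cont_height; lia. Qed.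

Lemma cont_A j i : (j < N)%nat -> (i < m)%nat -> cont dimw (fun w => A j i (pt w j)).
Proof.
  intros Hj Hi. apply (cont_comp dimw m (A j i) (fun w => pt w j)).
  - now apply (step_cont _ _ _ _ _ (Hch j)).
  - intros; apply node_inR.
  - intros; now apply cont_pt.
Qed.

Lemma cont_mu j : (j <= N)%nat -> cont dimw (fun w => mu w j).
Proof.
  intros Hj. unfold mu. assert (Q : forall k j, (j + k <= N)%nat -> cont dimw (fun w => lamprod w j k)).
  { induction k; intros l Hl; simpl; [apply cont_const|].
    apply cont_mult; [|apply IHk; lia]. apply cont_plus; [apply cont_const | apply cont_A; unfold m; lia]. }
  apply Q. lia.
Qed.

Lemma next_lt j : (j < N)%nat -> (next j < N)%nat.
Proof. unfold next. destruct (Nat.eqb_spec (S j) N); lia. Qed.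

Lemma cont_grad k : (k < dimw)%nat -> cont dimw (fun w => grad w k).
Proof.
  intros Hk. destruct (index_grid k Hk) as [[j [i [Hj [Hi ->]]]]|[[j [i [Hj [Hi ->]]]]| ->]].
  - apply (cont_ext dimw (fun w => gX w j i)); [intros; unfold grad; now rewrite layout_X|].
    apply cont_minus; apply cont_mult.
    + apply cont_mu; lia.
    + apply cont_plus; [apply cont_coord, iP_dim; auto | apply cont_A; unfold m; lia].
    + apply cont_mu. assert (Q := next_lt j Hj). lia.
    + apply cont_coord, iP_dim; auto. now apply next_lt.
  - apply (cont_ext dimw (fun w => gP w j i)); [intros; unfold grad; now rewrite layout_P|].
    apply cont_mult; [apply cont_mu; lia|]. apply cont_plus; [now apply cont_xi | apply cont_A; unfold m; lia].
  - apply (cont_ext dimw (fun w => mu w 0 - 1)); [intros; unfold grad; now rewrite layout_Z|].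
    apply cont_minus; [apply cont_mu; lia | apply cont_const].
Qed.

Definition critical (w : nat -> R) := inR dimw w /\ forall k, (k < dimw)%nat -> grad w k = 0.

Lemma lam_pos w j : 0 < lam w j.
Proof.
  destruct (step_gen _ _ _ _ _ (Hch j) (pt w j)) as [q [Hq G]]; [apply node_inR|].
  rewrite (lam_generated _ _ _ G). now apply (step_pos _ _ _ _ _ (Hch j)).
Qed.

Lemma mu_pos w j : 0 < mu w j.
Proof.
  unfold mu. generalize (N - j)%nat as k. intros k. revert j. induction k; intros j; simpl; [lra|].
  apply Rmult_lt_0_compat; [apply lam_pos | apply IHk].
Qed.

(** The [P]-equations say that step [j] starts at position [X_(j-1)], the [X]-equations that the
    momentum produced by step [j] is the one with which the next step starts, and the [z]-equation
    that the total conformal factor is 1. Since the index is cyclic, the orbit closes up except in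
    height. *)
Lemma critical_orbit w : critical w -> exists q, inR m q /\
  (forall i, (i < 2 * n)%nat -> orbit psi q N i = q i) /\ orbit_factor F psi q N = 1 /\
  orbit psi q N (2 * n)%nat - q (2 * n)%nat = action w /\
  forall j, (j < N)%nat -> generated n (St j) (A j) (psi j) (F j) (pt w j) (orbit psi q j).
Proof.
  intros [Hw Hg].
  assert (gx : forall j i, (j < N)%nat -> (i < n)%nat -> gX w j i = 0).
  { intros j i Hj Hi. rewrite <- (Hg (iX j i)) by now apply iX_dim. unfold grad. now rewrite layout_X. }
  assert (gp : forall j i, (j < N)%nat -> (i < n)%nat -> gP w j i = 0).
  { intros j i Hj Hi. rewrite <- (Hg (iP j i)) by now apply iP_dim. unfold grad. now rewrite layout_P. }
  assert (gz : mu w 0 = 1).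
  { assert (Q := Hg iZ iZ_dim). unfold grad in Q. rewrite layout_Z in Q. lra. }
  destruct (step_gen _ _ _ _ _ (Hch 0%nat) (pt w 0)) as [q0 [Hq0 G0]]; [apply node_inR|].
  assert (next_gen : forall j q, (j < N)%nat -> generated n (St j) (A j) (psi j) (F j) (pt w j) q ->
    (forall i, (i < n)%nat -> q i = w (iX (prev j) i) /\ psi j q i = w (iX j i) /\
       psi j q (n + i)%nat = w (iP j i) + A j i (pt w j)) /\
    psi j q (2 * n)%nat = height w (S j)).
  { intros j q Hj [G1 [G2 [G3 G4]]].
    assert (Q : forall i, (i < n)%nat -> q i = w (iX (prev j) i)).
    { intros i Hi. assert (E := gp j i Hj Hi). unfold gP in E. apply Rmult_integral in E.
      destruct E as [E|E]; [assert (P := mu_pos w (S j)); lra|].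
      destruct (G1 i Hi) as [_ [_ [_ G]]]. rewrite G, pt_x in E by auto.
      unfold xi in E. lra. }
    split.
    - intros i Hi. split; auto. destruct (G1 i Hi) as [E1 [_ [E2 _]]]. rewrite E1, pt_x by auto.
      rewrite pt_p in E2 by auto. split; auto. lra.
    - change (height w (S j)) with (height w j + pxi w j + St j (pt w j)). rewrite G4, G2, pt_z. unfold pxi.
      rewrite (fsum_ext n (fun i => pt w j (n + i)%nat * (pt w j i - q i)) (fun i => w (iP j i) * xi w j i)).
      + ring.
      + intros i Hi. rewrite (Q i Hi). now rewrite (pt_p w j i), (pt_x w j i). }
  assert (K : forall j, (j < N)%nat -> generated n (St j) (A j) (psi j) (F j) (pt w j) (orbit psi q0 j)).
  { induction j as [|j IH]; intros Hj; [exact G0|].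
    assert (Hj' : (j < N)%nat) by lia. specialize (IH Hj').
    destruct (next_gen j _ Hj' IH) as [N1 N2].
    destruct (step_gen _ _ _ _ _ (Hch (S j)) (pt w (S j))) as [q [Hq G]]; [apply node_inR|].
    destruct (next_gen (S j) q Hj G) as [N1' N2'].
    replace (orbit psi q0 (S j)) with q; auto. simpl.
    apply (inR_ext m); auto.
    { apply (step_inR _ _ _ _ _ (Hch j)). eapply orbit_inR; eauto. }
    intros k Hk. destruct (index_cases n k Hk) as [Hn|[[i [Hi ->]]| ->]].
    - destruct (N1' k Hn) as [E _]. destruct (N1 k Hn) as [_ [E' _]]. rewrite E, E'. reflexivity.
    - destruct (N1 i Hi) as [_ [_ E]]. rewrite E.
      (* [w] stores the rescaled momentum [F * y] of step [j + 1], and [mu] at [j + 1] contains the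
         same factor [F]; after cancelling, the equation compares the momenta themselves. *)
      assert (E2 := gx j i Hj' Hi). unfold gX in E2.
      assert (En : next j = S j) by (unfold next; destruct (Nat.eqb_spec (S j) N); [lia|auto]).
      rewrite En, (mu_step w (S j) Hj) in E2. rewrite (lam_generated _ _ _ G) in E2.
      destruct G as [G1 _]. destruct (G1 i Hi) as [_ [E3 _]]. rewrite pt_p in E3 by auto.
      rewrite E3 in E2. assert (P := mu_pos w (S (S j))). assert (P' := step_pos _ _ _ _ _ (Hch (S j)) q Hq).
      apply (Rmult_eq_reg_l (F (S j) q * mu w (S (S j)))); [lra|].
      apply Rgt_not_eq. now apply Rmult_lt_0_compat.
    - destruct G as [_ [G _]]. rewrite G, pt_z. now rewrite N2. }
  exists q0. split; auto.
  destruct (next_gen 0%nat q0 ltac:(lia) G0) as [N0 _]. simpl in N0.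
  assert (HN' : (N - 1 < N)%nat) by lia.
  assert (KN := K (N - 1)%nat HN'). destruct (next_gen _ _ HN' KN) as [N1 N2].
  assert (EN : orbit psi q0 N = psi (N - 1)%nat (orbit psi q0 (N - 1))).
  { replace N with (S (N - 1)) at 1 by lia. reflexivity. }
  split; [|split; [|split; [|exact K]]].
  - intros k Hk. rewrite EN. destruct (lt_dec k n) as [l|l].
    + destruct (N1 k l) as [_ [-> _]]. destruct (N0 k l) as [-> _]. reflexivity.
    + assert (Hi : (k - n < n)%nat) by lia. replace k with (n + (k - n))%nat by lia. set (i := (k - n)%nat) in *.
      destruct (N1 i Hi) as [_ [_ ->]]. assert (E := gx (N - 1)%nat i HN' Hi). unfold gX in E.
      (* At the closing index the two sides carry [mu w N = 1] and [mu w 1]; the latter times the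
         factor of step 0 is [mu w 0 = 1]. *)
      replace (next (N - 1)) with 0%nat in E by (unfold next; destruct (Nat.eqb_spec (S (N - 1)) N); [auto|lia]).
      replace (S (N - 1)) with N in E by lia. rewrite mu_last in E.
      assert (E0 := mu_step w 0 ltac:(lia)). rewrite (lam_generated _ _ _ G0), gz in E0.
      destruct G0 as [G1 _]. destruct (G1 i Hi) as [_ [E3 _]]. rewrite pt_p in E3 by auto.
      rewrite E3 in E.
      replace (mu w 1 * (F 0%nat q0 * q0 (n + i)%nat)) with ((F 0%nat q0 * mu w 1) * q0 (n + i)%nat) in E by ring.
      rewrite <- E0 in E. lra.
  - assert (Q : forall j, (j <= N)%nat -> orbit_factor F psi q0 j * mu w j = 1).
    { induction j; intros Hj; simpl; [rewrite gz; ring|].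
      rewrite <- IHj, (mu_step w j), (lam_generated _ _ _ (K j ltac:(lia))) by lia. ring. }
    specialize (Q N (le_n N)). rewrite mu_last in Q. lra.
  - rewrite EN, N2. unfold action. replace (S (N - 1)) with N by lia.
    destruct G0 as [_ [-> _]]. now rewrite pt_z.
Qed.

Lemma height_bounds_uniform : exists B C l, 0 < B /\ 0 < C /\ 0 < l <= 1 /\ forall j w, (j < N)%nat -> inR m w ->
  (off m B w -> St j w = 0 /\ forall i, (i < m)%nat -> A j i w = 0) /\
  (forall i, (i < m)%nat -> Rabs (A j i w) <= C) /\ l <= 1 + A j (2 * n) w <= / l /\ 0 <= St j w <= C.
Proof.
  assert (HB : exists B, 0 < B /\ forall j, (j < N)%nat -> forall w, inR m w -> off m B w ->
     St j w = 0 /\ forall i, (i < m)%nat -> A j i w = 0).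
  { apply (finite_bound N (fun j B => forall w, inR m w -> off m B w ->
     St j w = 0 /\ forall i, (i < m)%nat -> A j i w = 0)).
    - intros j c c' le K w Hw [i [Hi L]]. apply K; auto. exists i; split; auto; lra.
    - intros j _. destruct (step_supp _ _ _ _ _ (Hch j)) as [B HB].
      assert (P := Rabs_pos B). assert (Q := Rle_abs B). exists (Rabs B + 1). split; [lra|].
      intros w Hw [i [Hi L]]. apply HB; auto. exists i; split; auto; lra. }
  destruct HB as [B [B0 HB]].
  assert (HC : exists C, 0 < C /\ forall j, (j < N)%nat -> forall w, inR m w ->
     (forall i, (i < m)%nat -> Rabs (A j i w) <= C) /\ 0 <= St j w <= C /\ / (1 + A j (2 * n) w) <= C).
  { apply (finite_bound N (fun j C => forall w, inR m w ->
     (forall i, (i < m)%nat -> Rabs (A j i w) <= C) /\ 0 <= St j w <= C /\ / (1 + A j (2 * n) w) <= C)).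
    - intros j c c' le K w Hw. destruct (K w Hw) as [K1 [K2 K3]]. split; [|lra].
      intros i Hi. specialize (K1 i Hi). lra.
    - intros j Hj.
      assert (H1 : exists C, 0 < C /\ forall i, (i < m)%nat -> forall w, inR m w -> Rabs (A j i w) <= C).
      { apply (finite_bound m (fun i C => forall w, inR m w -> Rabs (A j i w) <= C)).
        - intros i c c' le K w Hw. specialize (K w Hw). lra.
        - intros i Hi. destruct (cont_bounded m (A j i) B) as [C [C0 K]].
          { now apply (step_cont _ _ _ _ _ (Hch j)). }
          exists C. split; auto. intros w Hw. destruct (off_or_box m B w) as [Ho|Hb]; auto.
          destruct (HB j Hj w Hw Ho) as [_ ->]; auto. rewrite Rabs_R0; lra. }
      destruct H1 as [C1 [C10 H1]].
      assert (Sc : cont m (St j)).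
      { apply (frechet_cont m _ (fun w i => A j i w)). apply (step_frechet _ _ _ _ _ (Hch j)). }
      destruct (cont_bounded m (St j) B Sc) as [C2 [C20 H2]].
      assert (Lp : forall w, inR m w -> 0 < 1 + A j (2 * n) w).
      { intros w Hw. destruct (step_gen _ _ _ _ _ (Hch j) w Hw) as [q [Hq [_ [_ [-> _]]]]].
        assert (P := step_pos _ _ _ _ _ (Hch j) q Hq). lra. }
      destruct (cont_bounded m (fun w => / (1 + A j (2 * n) w)) B) as [C3 [C30 H3]].
      { apply cont_inv; auto. apply cont_plus; [apply cont_const|].
        apply (step_cont _ _ _ _ _ (Hch j)). unfold m; lia. }
      exists (C1 + C2 + C3 + 1). split; [lra|]. intros w Hw.
      split; [intros i Hi; specialize (H1 i Hi w Hw); lra|].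
      split; [split; [now apply (step_nonneg _ _ _ _ _ (Hch j))|]|].
      + destruct (off_or_box m B w) as [Ho|Hb].
        * destruct (HB j Hj w Hw Ho) as [-> _]. lra.
        * specialize (H2 w Hw Hb). assert (Q := Rle_abs (St j w)). lra.
      + destruct (off_or_box m B w) as [Ho|Hb].
        * destruct (HB j Hj w Hw Ho) as [_ ->]; [|unfold m; lia]. rewrite Rplus_0_r, Rinv_1. lra.
        * specialize (H3 w Hw Hb). assert (Q := Rle_abs (/ (1 + A j (2 * n) w))). lra. }
  destruct HC as [C [C0 HC]].
  assert (Q : 0 < / (1 + C)) by (apply Rinv_0_lt_compat; lra).
  exists B, C, (/ (1 + C)). split; auto. split; auto. split.
  { split; auto. rewrite <- Rinv_1. apply Rinv_le_contravar; lra. }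
  intros j w Hj Hw. destruct (HC j Hj w Hw) as [H1 [H2 H3]].
  split; [now apply HB|]. split; auto. split; auto.
  rewrite Rinv_inv. specialize (H1 (2 * n)%nat ltac:(unfold m; lia)). apply abs_le_inv in H1. split; [|lra].
  assert (Lp : 0 < 1 + A j (2 * n) w).
  { destruct (step_gen _ _ _ _ _ (Hch j) w Hw) as [q [Hq [_ [_ [E _]]]]]. rewrite E.
    assert (P := step_pos _ _ _ _ _ (Hch j) q Hq). lra. }
  rewrite <- (Rinv_inv (1 + A j (2 * n) w)). apply Rinv_le_contravar; [now apply Rinv_0_lt_compat | lra].
Qed.

(** * Deforming below a level *)

(** The gradient of the quadratic form, without its last position component. There the weights
    [mu w N] and [mu w 1] are not related by a single step, so the sign of the gradient is not
    controlled; the other differences already bound every [P_j - P_k]. *)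
Definition hfield (w : nat -> R) : nat -> R :=
  layout (fun j i => if Nat.eqb (S j) N then 0 else w (iP j i) - w (iP (S j) i)) (xi w) 0.

Lemma hfield_near x y t k : (k < dimw)%nat -> (forall k, (k < dimw)%nat -> Rabs (y k - x k) <= t) ->
  Rabs (hfield y k - hfield x k) <= 2 * t.
Proof.
  intros Hk H. assert (t0 : 0 <= t) by (eapply Rle_trans; [apply Rabs_pos | apply (H k Hk)]).
  assert (D : forall a b, (a < dimw)%nat -> (b < dimw)%nat -> Rabs (y a - y b - (x a - x b)) <= 2 * t).
  { intros a b Ha Hb. apply H in Ha. apply H in Hb. apply abs_le_inv in Ha. apply abs_le_inv in Hb.
    apply Rabs_le. lra. }
  unfold hfield. destruct (index_grid k Hk) as [[j [i [Hj [Hi ->]]]]|[[j [i [Hj [Hi ->]]]]| ->]].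
  - rewrite !layout_X by auto. destruct (Nat.eqb_spec (S j) N); [rewrite Rminus_diag, Rabs_R0; lra|].
    apply D; apply iP_dim; auto; lia.
  - rewrite !layout_P by auto. apply D; apply iX_dim; auto. now apply prev_lt.
  - rewrite !layout_Z, Rminus_diag, Rabs_R0. lra.
Qed.

Lemma cont_hfield k : (k < dimw)%nat -> cont dimw (fun w => hfield w k).
Proof.
  intros Hk. destruct (index_grid k Hk) as [[j [i [Hj [Hi ->]]]]|[[j [i [Hj [Hi ->]]]]| ->]].
  - apply (cont_ext dimw (fun w => if Nat.eqb (S j) N then 0 else w (iP j i) - w (iP (S j) i))).
    { intros; unfold hfield; now rewrite layout_X. }
    destruct (Nat.eqb_spec (S j) N); [apply cont_const|].
    apply cont_minus; apply cont_coord, iP_dim; auto; lia.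
  - apply (cont_ext dimw (fun w => xi w j i)); [|now apply cont_xi].
    intros; unfold hfield; now rewrite layout_P.
  - apply (cont_ext dimw (fun _ => 0)); [|apply cont_const]. intros; unfold hfield; now rewrite layout_Z.
Qed.

Lemma action_descend x v b : inR dimw x -> inR dimw v ->
  (forall y k, inR dimw y -> (forall k, (k < dimw)%nat -> Rabs (y k - x k) <= Rabs (v k)) ->
     (k < dimw)%nat -> b * Rabs (v k) <= grad y k * v k) ->
  action (fun k => x k - v k) <= action x - b * fsum dimw (fun k => Rabs (v k)).
Proof.
  intros Hx Hv H.
  destruct (MVT_cor2 (fun s => action (line x (fun k => - v k) s))
    (fun s => fsum dimw (fun k => grad (line x (fun k => - v k) s) k * - v k)) 0 1) as [c [Hc1 Hc2]]; [lra| |].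
  { intros c _. apply action_deriv. }
  simpl in Hc1.
  replace (line x (fun k => - v k) 1) with (fun k => x k - v k) in Hc1
    by (apply functional_extensionality; intros; unfold line; ring).
  replace (line x (fun k => - v k) 0) with x in Hc1
    by (apply functional_extensionality; intros; unfold line; ring).
  assert (Q : b * fsum dimw (fun k => Rabs (v k)) <=
    fsum dimw (fun k => grad (line x (fun k => - v k) c) k * v k)).
  { rewrite <- fsum_scal. apply fsum_le. intros k Hk. apply H; auto.
    - apply line_inR; auto. intros i Hi. rewrite Hv by auto. ring.
    - intros i Hi. unfold line. replace (x i + c * - v i - x i) with (- (c * v i)) by ring.
      rewrite Rabs_Ropp, Rabs_mult, (Rabs_right c) by lra. assert (P := Rabs_pos (v i)). nra. }
  rewrite (fsum_ext dimw (fun k => grad (line x (fun k => - v k) c) k * - v k)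
    (fun k => (-1) * (grad (line x (fun k => - v k) c) k * v k))) in Hc1 by (intros; ring).
  rewrite fsum_scal in Hc1. lra.
Qed.

(* Vanishes for |s| <= a and has the sign of s beyond. *)
Definition clamp (a s : R) : R := Rmax 0 (Rmin 1 (s - a)) - Rmax 0 (Rmin 1 (- s - a)).

Lemma clamp_spec a s : 0 <= a ->
  Rabs (clamp a s) <= 1 /\ (0 < clamp a s -> a < s) /\ (clamp a s < 0 -> s < - a) /\
  forall e, e <= 1 -> a + e <= Rabs s -> e <= Rabs (clamp a s).
Proof.
  intros a0.
  assert (Q : (a < s /\ clamp a s = Rmin 1 (s - a)) \/ (s < - a /\ clamp a s = - Rmin 1 (- s - a)) \/
     (- a <= s <= a /\ clamp a s = 0)).
  { unfold clamp. destruct (Rlt_le_dec a s); [left|right; destruct (Rlt_le_dec s (- a)); [left|right]]; (split; [lra|]).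
    - rewrite Rmax_right by (apply Rmin_glb; lra). rewrite Rmax_left; [ring|].
      eapply Rle_trans; [apply Rmin_r|lra].
    - rewrite (Rmax_right 0 (Rmin 1 (- s - a))) by (apply Rmin_glb; lra). rewrite Rmax_left; [ring|].
      eapply Rle_trans; [apply Rmin_r|lra].
    - rewrite !Rmax_left; [ring | |]; (eapply Rle_trans; [apply Rmin_r|lra]). }
  destruct Q as [[H1 ->]|[[H1 ->]|[H1 ->]]].
  - assert (0 < Rmin 1 (s - a)) by (apply Rmin_glb_lt; lra). assert (L := Rmin_l 1 (s - a)).
    rewrite !Rabs_right by lra. repeat split; try lra. intros e e1 He. apply Rmin_glb; lra.
  - assert (0 < Rmin 1 (- s - a)) by (apply Rmin_glb_lt; lra). assert (L := Rmin_l 1 (- s - a)).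
    rewrite Rabs_Ropp, (Rabs_right (Rmin _ _)), (Rabs_left s) by lra.
    repeat split; try lra. intros e e1 He. apply Rmin_glb; lra.
  - rewrite Rabs_R0. repeat split; try lra. intros e e1 He.
    assert (Rabs s <= a) by (apply Rabs_le; lra). lra.
Qed.

Lemma cont_Rmax0 M f : cont M f -> cont M (fun v => Rmax 0 (f v)).
Proof.
  intros Hf. apply (cont_ext M (fun v => / 2 * (f v + Rabs (f v)))).
  - intros v _. unfold Rmax. destruct (Rle_dec 0 (f v)); [rewrite Rabs_right by lra | rewrite Rabs_left by lra]; lra.
  - apply cont_scal, cont_plus; [auto | now apply cont_abs].
Qed.

Lemma cont_Rmin1 M f : cont M f -> cont M (fun v => Rmin 1 (f v)).
Proof.
  intros Hf. apply (cont_ext M (fun v => 1 - Rmax 0 (1 - f v))).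
  - intros v _. unfold Rmax, Rmin. destruct (Rle_dec 0 (1 - f v)), (Rle_dec 1 (f v)); lra.
  - apply cont_minus; [apply cont_const|]. apply (cont_Rmax0 M (fun v => 1 - f v)).
    apply cont_minus; [apply cont_const | auto].
Qed.

Lemma cont_clamp M a f : cont M f -> cont M (fun v => clamp a (f v)).
Proof.
  intros Hf. apply cont_minus.
  - apply (cont_Rmax0 M (fun v => Rmin 1 (f v - a))), cont_Rmin1, cont_minus; [auto | apply cont_const].
  - apply (cont_Rmax0 M (fun v => Rmin 1 (- f v - a))), (cont_Rmin1 M (fun v => - f v - a)), cont_minus;
      [now apply cont_opp | apply cont_const].
Qed.

Section Deformation.
Variables (B C l : R).
Hypothesis B0 : 0 < B.
Hypothesis C0 : 0 < C.
Hypothesis l0 : 0 < l <= 1.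
Hypothesis Hbd : forall j w, (j < N)%nat -> inR m w ->
  (off m B w -> St j w = 0 /\ forall i, (i < m)%nat -> A j i w = 0) /\
  (forall i, (i < m)%nat -> Rabs (A j i w) <= C) /\ l <= 1 + A j (2 * n) w <= / l /\ 0 <= St j w <= C.

Lemma pt_inR w j : inR m (pt w j).
Proof. apply node_inR. Qed.

Lemma mu_lower w j : (j <= N)%nat -> l ^ N <= mu w j.
Proof.
  intros Hj.
  assert (Q : forall k j, (j + k <= N)%nat -> l ^ k <= lamprod w j k).
  { induction k; intros i Hi; simpl; [lra|]. apply Rmult_le_compat; [lra | apply pow_le; lra | | apply IHk; lia].
    destruct (Hbd i (pt w i) ltac:(lia) (pt_inR _ _)) as [_ [_ [L _]]]. unfold lam. lra. }
  eapply Rle_trans; [|apply Q; lia].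
  replace N with ((N - j) + j)%nat at 1 by lia. rewrite pow_add.
  assert (P : 0 < l ^ (N - j)) by (apply pow_lt; lra).
  assert (l ^ j <= 1).
  { clear -l0. induction j; simpl; [lra|]. assert (0 < l ^ j) by (apply pow_lt; lra). nra. }
  nra.
Qed.

(** The 1 allows for moving each coordinate by a half, [C] absorbs [A], and [l] times the last
    summand exceeds by 1 the bound [(1 + / l) * B] on the term produced by the conformal factor. *)
Definition thr : R := 1 + C + (1 + (1 + / l) * B) / l.

Lemma thr_pos : 1 <= thr.
Proof.
  unfold thr. assert (P : 0 < / l) by (apply Rinv_0_lt_compat; lra).
  assert (0 < (1 + (1 + / l) * B) / l) by (apply Rdiv_lt_0_compat; nra). lra.
Qed.

(** Up to the positive factor [mu], a large component of [hfield] dominates the rest of the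
    gradient. The only rest that could grow is [(L - 1) * p'], but [L = 1] once [p'] has left the
    support. *)
Lemma grad_sign x y k : (forall k, (k < dimw)%nat -> Rabs (y k - x k) <= / 2) -> (k < dimw)%nat ->
  (thr < hfield x k -> l ^ N <= grad y k) /\ (hfield x k < - thr -> grad y k <= - l ^ N).
Proof.
  intros Hn Hk. assert (Hh := hfield_near x y (/2) k Hk Hn). apply abs_le_inv in Hh.
  assert (PL : 0 < l ^ N) by (apply pow_lt; lra).
  assert (T1 := thr_pos). assert (Pl : 0 < / l) by (apply Rinv_0_lt_compat; lra).
  assert (scale : forall u s, l ^ N <= u -> (1 <= s -> l ^ N <= u * s) /\ (s <= -1 -> u * s <= - l ^ N)).
  { intros u s Hu. split; intros Hs; nra. }
  unfold hfield, grad in *.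
  destruct (index_grid k Hk) as [[j [i [Hj [Hi ->]]]]|[[j [i [Hj [Hi ->]]]]| ->]].
  - rewrite !layout_X in * by auto. destruct (Nat.eqb_spec (S j) N) as [e|ne]; [lra|].
    unfold gX. replace (next j) with (S j) by (unfold next; destruct (Nat.eqb_spec (S j) N); [lia|auto]).
    assert (HSj : (S j < N)%nat) by lia. rewrite (mu_step y (S j)) by auto.
    assert (M := mu_lower y (S (S j)) HSj).
    set (p := y (iP j i)) in *. set (p' := y (iP (S j) i)) in *.
    replace (lam y (S j) * mu y (S (S j)) * (p + A j i (pt y j)) - mu y (S (S j)) * p') with
      (mu y (S (S j)) * (lam y (S j) * (p - p' + A j i (pt y j)) + (lam y (S j) - 1) * p')) by ring.
    destruct (Hbd j (pt y j) Hj (pt_inR _ _)) as [_ [HA _]].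
    specialize (HA i ltac:(unfold m; lia)). apply abs_le_inv in HA.
    destruct (Hbd (S j) (pt y (S j)) HSj (pt_inR _ _)) as [Hoff [_ [HL _]]].
    change (1 + A (S j) (2 * n)%nat (pt y (S j))) with (lam y (S j)) in HL.
    set (L := lam y (S j)) in *. set (a := A j i (pt y j)) in *.
    assert (rest : Rabs ((L - 1) * p') <= (1 + / l) * B).
    { destruct (Rlt_le_dec B (Rabs p')) as [Hp|Hp].
      - destruct Hoff as [_ HA0].
        { exists (n + i)%nat. split; [unfold m; lia|]. now rewrite pt_p. }
        assert (E : L = 1). { unfold L, lam. rewrite HA0 by (unfold m; lia). ring. }
        rewrite E, Rminus_diag, Rmult_0_l, Rabs_R0. apply Rmult_le_pos; lra.
      - rewrite Rabs_mult. apply Rmult_le_compat; auto; try apply Rabs_pos. apply Rabs_le. lra. }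
    apply abs_le_inv in rest.
    assert (main : l * ((1 + (1 + / l) * B) / l) = 1 + (1 + / l) * B) by (field; lra).
    set (V := (1 + (1 + / l) * B) / l) in *.
    assert (V0 : 0 < V) by (unfold V; apply Rdiv_lt_0_compat; nra).
    split; intros Hs; apply (scale _ _ M); unfold thr in Hs; fold V in Hs.
    + assert (V <= p - p' + a) by lra. assert (l * V <= L * (p - p' + a)) by (apply Rmult_le_compat; lra). lra.
    + assert (V <= - (p - p' + a)) by lra.
      assert (l * V <= L * (- (p - p' + a))) by (apply Rmult_le_compat; lra). lra.
  - rewrite !layout_P in * by auto. unfold gP.
    assert (M := mu_lower y (S j) Hj).
    destruct (Hbd j (pt y j) Hj (pt_inR _ _)) as [_ [HA _]].
    specialize (HA (n + i)%nat ltac:(unfold m; lia)). apply abs_le_inv in HA.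
    assert (V0 : 0 < (1 + (1 + / l) * B) / l) by (apply Rdiv_lt_0_compat; nra).
    assert (V1 : 1 <= (1 + (1 + / l) * B) / l).
    { apply (Rmult_le_reg_l l); [lra|]. replace (l * ((1 + (1 + / l) * B) / l)) with (1 + (1 + / l) * B) by (field; lra).
      assert (0 < (1 + / l) * B) by (apply Rmult_lt_0_compat; lra). lra. }
    split; intros Hs; apply (scale _ _ M); unfold thr in Hs; lra.
  - rewrite !layout_Z in *. lra.
Qed.

Definition flat (w : nat -> R) : Prop := forall j, (j < N)%nat -> off m B (pt w j).

Lemma flat_mu w j : flat w -> (j <= N)%nat -> mu w j = 1.
Proof.
  intros Hf Hj. unfold mu. assert (Q : forall k j, (j + k <= N)%nat -> lamprod w j k = 1).
  { induction k; intros i Hi; simpl; auto. rewrite IHk by lia. unfold lam.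
    destruct (Hbd i (pt w i) ltac:(lia) (pt_inR _ _)) as [H0 _].
    destruct (H0 (Hf i ltac:(lia))) as [_ ->]; [ring | unfold m; lia]. }
  apply Q. lia.
Qed.

Lemma flat_grad_X w j i : flat w -> (j < N)%nat -> (i < n)%nat ->
  grad w (iX j i) = w (iP j i) - w (iP (next j) i).
Proof.
  intros Hf Hj Hi. unfold grad. rewrite layout_X by auto. unfold gX.
  assert (Q := next_lt j Hj). rewrite !flat_mu by (auto; lia).
  destruct (Hbd j (pt w j) Hj (pt_inR _ _)) as [H0 _].
  destruct (H0 (Hf j Hj)) as [_ ->]; [ring | unfold m; lia].
Qed.

Lemma flat_grad_P w j i : flat w -> (j < N)%nat -> (i < n)%nat -> grad w (iP j i) = xi w j i.
Proof.
  intros Hf Hj Hi. unfold grad. rewrite layout_P by auto. unfold gP.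
  rewrite flat_mu by (auto; lia). destruct (Hbd j (pt w j) Hj (pt_inR _ _)) as [H0 _].
  destruct (H0 (Hf j Hj)) as [_ ->]; [ring | unfold m; lia].
Qed.

Lemma flat_grad_Z w : flat w -> grad w iZ = 0.
Proof. intros Hf. unfold grad. rewrite layout_Z, flat_mu by (auto; lia). ring. Qed.

Lemma flat_action w : flat w -> action w = fsum N (pxi w).
Proof.
  intros Hf. unfold action. assert (Q : forall j, (j <= N)%nat -> height w j - height w 0 = fsum j (pxi w)).
  { induction j; intros Hj; [simpl; ring|]. simpl fsum. rewrite <- IHj by lia.
    change (height w (S j)) with (height w j + pxi w j + St j (pt w j)).
    destruct (Hbd j (pt w j) Hj (pt_inR _ _)) as [H0 _]. destruct (H0 (Hf j Hj)) as [-> _]. ring. }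
  now apply Q.
Qed.

Lemma fsum_swap a b (f : nat -> nat -> R) :
  fsum a (fun j => fsum b (fun i => f j i)) = fsum b (fun i => fsum a (fun j => f j i)).
Proof.
  induction a; simpl; [now rewrite fsum_zero|]. now rewrite IHa, fsum_plus.
Qed.

Lemma sum_xi w i : fsum N (fun j => xi w j i) = 0.
Proof.
  unfold xi. rewrite fsum_minus, (fsum_cyclic (fun a _ => w (iX a i))). ring.
Qed.

(** The increments of [X] sum to zero around the cycle, so a constant may be subtracted from the
    momenta. *)
Lemma sum_pxi w : fsum N (pxi w) = fsum N (fun j => fsum n (fun i => (w (iP j i) - w (iP 0 i)) * xi w j i)).
Proof.
  assert (Z : fsum N (fun j => fsum n (fun i => w (iP 0 i) * xi w j i)) = 0).
  { rewrite fsum_swap. apply fsum_zero. intros i _. rewrite fsum_scal, sum_xi. ring. }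
  rewrite <- (Rminus_0_r (fsum N (pxi w))), <- Z, <- fsum_minus. apply fsum_ext. intros j _.
  unfold pxi. rewrite <- fsum_minus. apply fsum_ext. intros; ring.
Qed.

(** Off the supports the action is a sum of products of differences of [P] and of [X], and both
    kinds of differences are controlled by gradient components. A positive level therefore keeps the
    gradient away from 0. *)
Lemma flat_small w e : flat w -> (forall k, (k < dimw)%nat -> Rabs (grad w k) <= e) ->
  Rabs (action w) <= INR N * (INR n * (INR N * e * e)).
Proof.
  intros Hf Hg. rewrite flat_action, sum_pxi by auto.
  assert (e0 : 0 <= e) by (eapply Rle_trans; [apply Rabs_pos | apply (Hg iZ iZ_dim)]).
  assert (PD : forall j i, (j < N)%nat -> (i < n)%nat -> Rabs (w (iP j i) - w (iP 0 i)) <= INR j * e).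
  { induction j; intros i Hj Hi.
    - rewrite Rminus_diag, Rabs_R0. simpl; lra.
    - assert (Q := Hg (iX j i) ltac:(apply iX_dim; auto; lia)). rewrite flat_grad_X in Q by (auto; lia).
      replace (next j) with (S j) in Q by (unfold next; destruct (Nat.eqb_spec (S j) N); [lia|auto]).
      rewrite S_INR. specialize (IHj i ltac:(lia) Hi). apply abs_le_inv in IHj. apply abs_le_inv in Q.
      apply Rabs_le. lra. }
  eapply Rle_trans; [apply fsum_abs|]. rewrite <- fsum_const. apply fsum_le. intros j Hj.
  eapply Rle_trans; [apply fsum_abs|]. rewrite <- fsum_const. apply fsum_le. intros i Hi.
  rewrite Rabs_mult. apply Rmult_le_compat; try apply Rabs_pos.
  - eapply Rle_trans; [apply PD; auto|]. apply Rmult_le_compat_r; auto. apply le_INR; lia.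
  - rewrite <- (flat_grad_P w j i) by auto. apply Hg, iP_dim; auto.
Qed.

Lemma chain_bound (f : nat -> R) (r : R) : 0 <= r -> (forall j, (S j < N)%nat -> Rabs (f (S j) - f j) <= r) ->
  forall j k, (j < N)%nat -> (k < N)%nat -> Rabs (f j - f k) <= 2 * INR N * r.
Proof.
  intros r0 H.
  assert (Q : forall j, (j < N)%nat -> Rabs (f j - f 0%nat) <= INR N * r).
  { intros j Hj. apply (Rle_trans _ (INR j * r)).
    - induction j; [rewrite Rminus_diag, Rabs_R0; simpl; lra|].
      specialize (IHj ltac:(lia)). specialize (H j Hj). rewrite S_INR.
      apply abs_le_inv in IHj. apply abs_le_inv in H. apply Rabs_le. lra.
    - apply Rmult_le_compat_r; auto. apply le_INR; lia. }
  intros j k Hj Hk. apply Q in Hj. apply Q in Hk. apply abs_le_inv in Hj. apply abs_le_inv in Hk.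
  apply Rabs_le. lra.
Qed.

(** Bounded differences keep all [X_j] together and all [P_j] together: if one exceeds [R1], all
    exceed [B]. If none does, each step changes the height by at most [q], and the same argument
    applies to the heights with [R2]. *)
Lemma flat_or_box r : 0 <= r -> exists R0, 0 < R0 /\ forall x, inR dimw x ->
  (forall k, (k < dimw)%nat -> Rabs (hfield x k) <= r) -> box dimw R0 x \/ flat x.
Proof.
  intros r0. set (R1 := B + 2 * INR N * r).
  assert (NN : 0 <= INR N) by apply pos_INR. assert (nn : 0 <= INR n) by apply pos_INR.
  assert (R10 : 0 < R1) by (unfold R1; assert (0 <= INR N * r) by (apply Rmult_le_pos; auto); lra).
  set (q := INR n * (R1 * (2 * R1)) + C).
  assert (q0 : 0 < q) by (unfold q; assert (0 <= INR n * (R1 * (2 * R1))) by (repeat apply Rmult_le_pos; lra); lra).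
  set (R2 := B + INR N * q).
  assert (R20 : 0 < R2) by (unfold R2; assert (0 <= INR N * q) by (apply Rmult_le_pos; lra); lra).
  exists (R1 + R2). split; [lra|]. intros x Hx Hh.
  assert (CX : forall i j k, (i < n)%nat -> (j < N)%nat -> (k < N)%nat -> Rabs (x (iX j i) - x (iX k i)) <= 2 * INR N * r).
  { intros i j k Hi Hj Hk. apply (chain_bound (fun j => x (iX j i))); auto. intros a Ha.
    assert (Q := Hh (iP (S a) i) ltac:(apply iP_dim; auto)). unfold hfield in Q. rewrite layout_P in Q by auto. exact Q. }
  assert (CP : forall i j k, (i < n)%nat -> (j < N)%nat -> (k < N)%nat -> Rabs (x (iP j i) - x (iP k i)) <= 2 * INR N * r).
  { intros i j k Hi Hj Hk. apply (chain_bound (fun j => x (iP j i))); auto. intros a Ha.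
    assert (Q := Hh (iX a i) ltac:(apply iX_dim; auto; lia)). unfold hfield in Q. rewrite layout_X in Q by (auto; lia).
    destruct (Nat.eqb_spec (S a) N); [lia|]. now rewrite Rabs_minus_sym. }
  assert (far : forall a b, R1 < Rabs b -> Rabs (b - a) <= 2 * INR N * r -> B < Rabs a).
  { intros a b Hb Hd. unfold R1 in Hb. assert (T := Rabs_triang (b - a) a).
    replace (b - a + a) with b in T by ring. lra. }
  destruct (classic (exists j i, (j < N)%nat /\ (i < n)%nat /\ (R1 < Rabs (x (iX j i)) \/ R1 < Rabs (x (iP j i))))) as [[j [i [Hj [Hi [Hl|Hl]]]]]|Hno].
  { right. intros k Hk. exists i. split; [unfold m; lia|]. rewrite pt_x by auto.
    apply (far _ _ Hl). now apply CX. }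
  { right. intros k Hk. exists (n + i)%nat. split; [unfold m; lia|]. rewrite pt_p by auto.
    apply (far _ _ Hl). now apply CP. }
  assert (bX : forall j i, (j < N)%nat -> (i < n)%nat -> Rabs (x (iX j i)) <= R1 /\ Rabs (x (iP j i)) <= R1).
  { intros j i Hj Hi. split; apply Rnot_lt_le; intros L; apply Hno; exists j, i; auto. }
  assert (hb : forall j, (j <= N)%nat -> Rabs (height x j - x iZ) <= INR j * q).
  { induction j; intros Hj; [simpl; rewrite Rminus_diag, Rabs_R0; lra|].
    change (height x (S j)) with (height x j + pxi x j + St j (pt x j)). rewrite S_INR.
    specialize (IHj ltac:(lia)).
    destruct (Hbd j (pt x j) Hj (pt_inR _ _)) as [_ [_ [_ HS]]].
    assert (Hp : Rabs (pxi x j) <= INR n * (R1 * (2 * R1))).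
    { unfold pxi. eapply Rle_trans; [apply fsum_abs|]. rewrite <- fsum_const. apply fsum_le. intros i Hi.
      rewrite Rabs_mult. destruct (bX j i Hj Hi) as [b1 b2]. destruct (bX (prev j) i (prev_lt j Hj) Hi) as [b3 _].
      apply Rmult_le_compat; auto; try apply Rabs_pos. unfold xi. apply abs_le_inv in b1. apply abs_le_inv in b3.
      apply Rabs_le. lra. }
    apply abs_le_inv in Hp. apply abs_le_inv in IHj. apply Rabs_le. unfold q in *. lra. }
  destruct (Rlt_le_dec R2 (Rabs (x iZ))) as [Hz|Hz].
  - right. intros j Hj. exists (2 * n)%nat. split; [unfold m; lia|]. rewrite pt_z.
    specialize (hb j ltac:(lia)). unfold R2 in Hz. rewrite Rabs_minus_sym in hb.
    assert (T := Rabs_triang (x iZ - height x j) (height x j)).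
    replace (x iZ - height x j + height x j) with (x iZ) in T by ring.
    assert (INR j * q <= INR N * q) by (apply Rmult_le_compat_r; [lra | apply le_INR; lia]). lra.
  - left. intros k Hk. destruct (index_grid k Hk) as [[j [i [Hj [Hi ->]]]]|[[j [i [Hj [Hi ->]]]]| ->]].
    + destruct (bX j i Hj Hi). lra. + destruct (bX j i Hj Hi). lra. + lra.
Qed.

(** In a large box this is uniform continuity on a compact set; if both points are flat, the
    gradient is an explicit linear function of the coordinates. *)
Lemma grad_uniform r e : 0 <= r -> 0 < e -> exists d, 0 < d /\ d <= / 4 /\ forall x y, inR dimw x -> inR dimw y ->
  (forall k, (k < dimw)%nat -> Rabs (hfield x k) <= r) -> (forall k, (k < dimw)%nat -> Rabs (y k - x k) <= d) ->
  forall k, (k < dimw)%nat -> Rabs (grad y k - grad x k) <= e.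
Proof.
  intros r0 e0. destruct (flat_or_box (r + 1)) as [R0 [R00 HR0]]; [lra|].
  destruct (finite_delta dimw (fun k d => forall v w, inR dimw v -> inR dimw w -> box dimw R0 v ->
     near dimw v w d -> Rabs (grad w k - grad v k) <= e)) as [d [d0 K]].
  { intros k d d' d'0 le Q v w Hv Hw Hb Hn. apply Q; auto. eapply near_le; eauto. }
  { intros k Hk. apply (cont_uniform dimw (fun w => grad w k)); auto. now apply cont_grad. }
  set (d' := Rmin (d / 2) (Rmin (/ 4) (e / 2))).
  assert (d'0 : 0 < d') by (repeat apply Rmin_glb_lt; lra).
  assert (L1 : d' <= d / 2) by apply Rmin_l.
  assert (L2 : d' <= / 4) by (eapply Rle_trans; [apply Rmin_r | apply Rmin_l]).
  assert (L3 : d' <= e / 2) by (eapply Rle_trans; [apply Rmin_r | apply Rmin_r]).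
  exists d'. split; auto. split; auto. intros x y Hx Hy Hh Hn k Hk.
  assert (Nx : near dimw x y d) by (intros i Hi; specialize (Hn i Hi); lra).
  assert (Hhy : forall k, (k < dimw)%nat -> Rabs (hfield y k) <= r + 1).
  { intros i Hi. assert (Q := hfield_near x y d' i Hi Hn). specialize (Hh i Hi).
    apply abs_le_inv in Q. apply abs_le_inv in Hh. apply Rabs_le. lra. }
  destruct (HR0 x Hx) as [Bx|Fx].
  { intros i Hi. specialize (Hh i Hi). lra. }
  { now apply K. }
  destruct (HR0 y Hy Hhy) as [By|Fy].
  { rewrite Rabs_minus_sym. apply K; auto. now apply near_sym. }
  assert (D2 : forall a b, (a < dimw)%nat -> (b < dimw)%nat -> Rabs (y a - y b - (x a - x b)) <= e).
  { intros a b Ha Hb. apply Hn in Ha. apply Hn in Hb. apply abs_le_inv in Ha. apply abs_le_inv in Hb.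
    apply Rabs_le. lra. }
  destruct (index_grid k Hk) as [[j [i [Hj [Hi ->]]]]|[[j [i [Hj [Hi ->]]]]| ->]].
  - rewrite !flat_grad_X by auto. apply D2; apply iP_dim; auto. now apply next_lt.
  - rewrite !flat_grad_P by auto. apply D2; apply iX_dim; auto. now apply prev_lt.
  - rewrite !flat_grad_Z by auto. rewrite Rminus_diag, Rabs_R0. lra.
Qed.

(** A quantitative Palais-Smale condition with a second way out at critical points, where [g] is
    larger. In the box it comes from compactness. For flat configurations a gradient below [e] would
    give [c - e <= Q * e * e], which the choice of [e] at most [c / (2 * (Q + 1))] forbids. *)
Lemma level_dichotomy c g r : 0 < c -> 0 <= r -> cont dimw g -> (forall w, inR dimw w -> action w <= g w) ->
  (forall w, critical w -> action w = c -> action w < g w) ->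
  exists e, 0 < e /\ forall x, inR dimw x -> (forall k, (k < dimw)%nat -> Rabs (hfield x k) <= r) ->
    Rabs (action x - c) <= e -> (exists k, (k < dimw)%nat /\ e <= Rabs (grad x k)) \/ e <= g x - action x.
Proof.
  intros c0 r0 Hg Hle Hcrit. destruct (flat_or_box r r0) as [R0 [R00 HR0]].
  destruct (compact_uniform dimw R0 (fun e x => Rabs (action x - c) <= e ->
     (exists k, (k < dimw)%nat /\ e <= Rabs (grad x k)) \/ e <= g x - action x)) as [d [d0 K]].
  - intros d d' y d'0 le Hy H. destruct Hy as [[k [Hk H1]]|H1]; [lra | left | right; lra].
    exists k. split; auto. lra.
  - intros x Hx _.
    destruct (Req_dec (action x) c) as [E|E].
    + destruct (classic (exists k, (k < dimw)%nat /\ grad x k <> 0)) as [[k [Hk Hne]]|Hall].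
      * assert (P := Rabs_pos_lt _ Hne).
        destruct (cont_grad k Hk x Hx (Rabs (grad x k) / 2)) as [d [d0 K]]; [lra|].
        exists (Rmin d (Rabs (grad x k) / 2)). split; [apply Rmin_glb_lt; lra|].
        intros y Hy _ Nn _. left. exists k. split; auto.
        specialize (K y Hy (near_le _ _ _ _ _ (Rmin_l _ _) Nn)).
        assert (L := Rmin_r d (Rabs (grad x k) / 2)).
        assert (T := Rabs_triang (grad x k - grad y k) (grad y k)). rewrite Rabs_minus_sym in K.
        replace (grad x k - grad y k + grad y k) with (grad x k) in T by ring. lra.
      * assert (Cx : critical x).
        { split; auto. intros k Hk. apply NNPP. intros Hne. apply Hall. exists k; auto. }
        specialize (Hcrit x Cx E).
        assert (Cd : cont dimw (fun w => g w - action w)) by (apply cont_minus; [auto | apply cont_action]).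
        destruct (Cd x Hx ((g x - action x) / 2)) as [d [d0 K]]; [lra|].
        exists (Rmin d ((g x - action x) / 2)). split; [apply Rmin_glb_lt; lra|].
        intros y Hy _ Nn _. right. specialize (K y Hy (near_le _ _ _ _ _ (Rmin_l _ _) Nn)).
        apply Rabs_def2 in K. assert (L := Rmin_r d ((g x - action x) / 2)). lra.
    + assert (P : 0 < Rabs (action x - c)) by (apply Rabs_pos_lt; lra).
      destruct (cont_action x Hx (Rabs (action x - c) / 2)) as [d [d0 K]]; [lra|].
      exists (Rmin d (Rabs (action x - c) / 4)). split; [apply Rmin_glb_lt; lra|].
      intros y Hy _ Nn Hc. exfalso. specialize (K y Hy (near_le _ _ _ _ _ (Rmin_l _ _) Nn)).
      assert (L := Rmin_r d (Rabs (action x - c) / 4)). rewrite Rabs_minus_sym in K.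
      assert (T := Rabs_triang (action x - action y) (action y - c)).
      replace (action x - action y + (action y - c)) with (action x - c) in T by ring. lra.
  - set (Q := INR N * (INR n * INR N)).
    assert (Q0 : 0 <= Q) by (unfold Q; repeat apply Rmult_le_pos; apply pos_INR).
    set (e := Rmin d (Rmin 1 (c / (2 * (Q + 1))))).
    assert (q0 : 0 < c / (2 * (Q + 1))) by (apply Rdiv_lt_0_compat; lra).
    assert (e0 : 0 < e) by (repeat apply Rmin_glb_lt; lra).
    assert (L1 : e <= d) by apply Rmin_l.
    assert (L2 : e <= 1) by (eapply Rle_trans; [apply Rmin_r | apply Rmin_l]).
    assert (L3 : e <= c / (2 * (Q + 1))) by (eapply Rle_trans; [apply Rmin_r | apply Rmin_r]).
    exists e. split; auto. intros x Hx Hh Hc. destruct (HR0 x Hx Hh) as [Bx|Fx].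
    + destruct (K x Hx Bx) as [[k [Hk H1]]|H1]; [lra | left; exists k; split; auto; lra | right; lra].
    + left. apply NNPP. intros Hno.
      assert (S1 : Rabs (action x) <= INR N * (INR n * (INR N * e * e))).
      { apply flat_small; auto. intros k Hk. apply Rnot_lt_le. intros L. apply Hno. exists k. split; auto. lra. }
      replace (INR N * (INR n * (INR N * e * e))) with (Q * e * e) in S1 by (unfold Q; ring).
      apply abs_le_inv in S1. apply abs_le_inv in Hc.
      assert (Q * e * e <= Q * e) by (assert (0 <= Q * e) by (apply Rmult_le_pos; lra); nra).
      assert ((Q + 1) * e <= c / 2).
      { apply (Rle_trans _ ((Q + 1) * (c / (2 * (Q + 1))))); [apply Rmult_le_compat_l; lra|].
        apply Req_le. field. lra. }
      lra.
Qed.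

(** An explicit step in place of a flow: each coordinate moves against the sign of [h], by at most
    [tau]. The dead zone [a] avoids coordinates where the sign of the gradient is not known, and
    [th] is a cut-off. *)
Definition push (tau : R) (th : (nat -> R) -> R) (a : R) (h : (nat -> R) -> nat -> R) (x : nat -> R) : nat -> R :=
  trunc dimw (fun k => x k - tau * th x * clamp a (h x k)).

Lemma push_cont tau th a h : cont dimw th -> (forall k, (k < dimw)%nat -> cont dimw (fun x => h x k)) ->
  forall k, (k < dimw)%nat -> cont dimw (fun x => push tau th a h x k).
Proof.
  intros Ct Ch k Hk. unfold push.
  apply (cont_ext dimw (fun x => x k - tau * th x * clamp a (h x k))); [intros; now rewrite trunc_lt|].
  apply cont_minus; [now apply cont_coord|]. apply (cont_mult dimw (fun x => tau * th x)); [now apply cont_scal|].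
  apply cont_clamp; auto.
Qed.

Lemma push_near tau th a h x k : 0 <= tau -> 0 <= a -> 0 <= th x <= 1 -> (k < dimw)%nat ->
  Rabs (push tau th a h x k - x k) <= tau.
Proof.
  intros t0 a0 Ht Hk. unfold push. rewrite trunc_lt by auto.
  replace (x k - tau * th x * clamp a (h x k) - x k) with (- (tau * th x * clamp a (h x k))) by ring.
  rewrite Rabs_Ropp, !Rabs_mult, (Rabs_right tau), (Rabs_right (th x)) by lra.
  destruct (clamp_spec a (h x k) a0) as [Q _]. assert (P := Rabs_pos (clamp a (h x k))).
  assert (th x * Rabs (clamp a (h x k)) <= 1) by nra.
  rewrite Rmult_assoc. nra.
Qed.

Lemma push_descends tau th a h b x : 0 <= tau -> 0 <= a -> 0 <= b -> inR dimw x -> 0 <= th x <= 1 ->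
  (0 < th x -> forall y k, inR dimw y -> (forall k, (k < dimw)%nat -> Rabs (y k - x k) <= tau) -> (k < dimw)%nat ->
     (a < h x k -> b <= grad y k) /\ (h x k < - a -> grad y k <= - b)) ->
  action (push tau th a h x) <= action x /\
  forall k e, (k < dimw)%nat -> 0 <= e <= 1 -> th x = 1 -> a + e <= Rabs (h x k) ->
    action (push tau th a h x) <= action x - b * (tau * e).
Proof.
  intros t0 a0 b0 Hx Ht H.
  set (v := trunc dimw (fun k => tau * th x * clamp a (h x k))).
  assert (Ev : push tau th a h x = fun k => x k - v k).
  { apply functional_extensionality. intros k. unfold push, v, trunc. destruct (Nat.ltb_spec k dimw); [auto|].
    rewrite (Hx k) by auto. ring. }
  assert (vk : forall k, (k < dimw)%nat -> v k = tau * th x * clamp a (h x k)) by (intros; unfold v; now rewrite trunc_lt).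
  assert (Vn : forall k, (k < dimw)%nat -> Rabs (v k) <= tau).
  { intros k Hk. assert (Q := push_near tau th a h x k t0 a0 Ht Hk). rewrite Ev in Q.
    replace (x k - v k - x k) with (- v k) in Q by ring. now rewrite Rabs_Ropp in Q. }
  assert (Dn : action (fun k => x k - v k) <= action x - b * fsum dimw (fun k => Rabs (v k))).
  { apply action_descend; auto; [apply trunc_inR|]. intros y k Hy Hn Hk. rewrite vk by auto.
    destruct (Rlt_le_dec 0 (th x)) as [tp|tn].
    - assert (Hn' : forall k, (k < dimw)%nat -> Rabs (y k - x k) <= tau).
      { intros i Hi. eapply Rle_trans; [apply Hn; auto | now apply Vn]. }
      destruct (H tp y k Hy Hn' Hk) as [Hp Hm]. destruct (clamp_spec a (h x k) a0) as [_ [Q1 [Q2 _]]].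
      set (s := clamp a (h x k)) in *. assert (tt : 0 <= tau * th x) by (apply Rmult_le_pos; lra).
      rewrite Rabs_mult, (Rabs_right (tau * th x)) by lra.
      destruct (Rtotal_order s 0) as [S1|[S1|S1]].
      + rewrite (Rabs_left s) by auto. specialize (Hm (Q2 S1)).
        assert (tau * th x * - s * b <= tau * th x * - s * - grad y k).
        { apply Rmult_le_compat_l; [apply Rmult_le_pos; lra | lra]. } lra.
      + rewrite S1, Rabs_R0. lra.
      + rewrite (Rabs_right s) by lra. specialize (Hp (Q1 S1)).
        assert (tau * th x * s * b <= tau * th x * s * grad y k).
        { apply Rmult_le_compat_l; [apply Rmult_le_pos; lra | lra]. } lra.
    - replace (th x) with 0 by lra. rewrite Rmult_0_r, Rmult_0_l, Rabs_R0. lra. }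
  rewrite Ev.
  assert (S0 : 0 <= fsum dimw (fun k => Rabs (v k))) by (apply fsum_nonneg; intros; apply Rabs_pos).
  split; [nra|]. intros k e Hk He Et Ha.
  assert (Q := fsum_term_le dimw (fun k => Rabs (v k)) k (fun _ _ => Rabs_pos _) Hk). simpl in Q.
  rewrite vk, Et, Rmult_1_r, Rabs_mult, (Rabs_right tau) in Q by (auto; lra).
  destruct (clamp_spec a (h x k) a0) as [_ [_ [_ Q3]]]. specialize (Q3 e ltac:(lra) Ha).
  assert (tau * e <= tau * Rabs (clamp a (h x k))) by (apply Rmult_le_compat_l; auto).
  assert (b * (tau * e) <= b * fsum dimw (fun k => Rabs (v k))) by (apply Rmult_le_compat_l; lra). lra.
Qed.

(** Confines the gradient push to the region of bounded [hfield], where [grad_uniform] applies, with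
    a margin for the push along [hfield] to take over. *)
Definition theta (x : nat -> R) : R := Rmax 0 (1 - fsum dimw (fun k => Rmax 0 (Rabs (hfield x k) - (thr + 1)))).

Lemma theta_spec x : 0 <= theta x <= 1 /\
  (0 < theta x -> forall k, (k < dimw)%nat -> Rabs (hfield x k) <= thr + 2) /\
  ((forall k, (k < dimw)%nat -> Rabs (hfield x k) <= thr + 1) -> theta x = 1).
Proof.
  set (s := fsum dimw (fun k => Rmax 0 (Rabs (hfield x k) - (thr + 1)))).
  assert (S0 : 0 <= s) by (apply fsum_nonneg; intros; apply Rmax_l).
  unfold theta. fold s. split; [|split].
  - split; [apply Rmax_l | apply Rmax_lub; lra].
  - intros H k Hk. assert (s < 1).
    { apply Rnot_le_lt. intros L. rewrite Rmax_left in H by lra. lra. }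
    assert (Q := fsum_term_le dimw (fun k => Rmax 0 (Rabs (hfield x k) - (thr + 1))) k (fun _ _ => Rmax_l _ _) Hk).
    simpl in Q. fold s in Q. assert (L := Rmax_r 0 (Rabs (hfield x k) - (thr + 1))). lra.
  - intros H. assert (E : s = 0).
    { apply fsum_zero. intros k Hk. apply Rmax_left. specialize (H k Hk). lra. }
    rewrite E, Rminus_0_r. apply Rmax_right. lra.
Qed.

Lemma theta_cont : cont dimw theta.
Proof.
  apply (cont_Rmax0 dimw (fun x => 1 - fsum dimw (fun k => Rmax 0 (Rabs (hfield x k) - (thr + 1))))).
  apply cont_minus; [apply cont_const|].
  apply (cont_fsum dimw dimw (fun k x => Rmax 0 (Rabs (hfield x k) - (thr + 1)))). intros k Hk.
  apply (cont_Rmax0 dimw (fun x => Rabs (hfield x k) - (thr + 1))), cont_minus; [|apply cont_const].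
  apply cont_abs. now apply cont_hfield.
Qed.

(* First follow the gradient where the fibre coordinates are bounded, then the differences
   X_j - X_{j-1} and P_j - P_{j+1}, along which the action decreases wherever they are large. *)
Lemma deformation_bounded c g : 0 < c -> cont dimw g -> (forall w, inR dimw w -> action w <= g w) ->
  (forall w, critical w -> action w = c -> action w < g w) ->
  exists e T, 0 < e /\ (forall k, (k < dimw)%nat -> cont dimw (fun x => T x k)) /\
    (forall x, inR dimw (T x)) /\ (forall x k, (k < dimw)%nat -> Rabs (T x k - x k) <= 1) /\
    forall x, inR dimw x -> g x < c + e -> action (T x) <= c - e.
Proof.
  intros c0 Cg Hle Hcrit. assert (T1 := thr_pos).
  destruct (level_dichotomy c g (thr + 2)) as [e0 [e00 Dich]]; auto; [lra|].
  destruct (grad_uniform (thr + 2) (e0 / 4)) as [t1 [t10 [t1q Unif]]]; [lra | lra |].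
  assert (PL : 0 < l ^ N) by (apply pow_lt; lra).
  (* A gradient component above [e0 / 2] at [x] stays above [e0 / 4] within distance [t1], which
     gives the rate of descent of the first push. *)
  set (P1 := push t1 theta (e0 / 2) grad). set (P2 := push (/ 4) (fun _ => 1) thr hfield).
  assert (P1in : forall x, inR dimw (P1 x)) by (intros; apply trunc_inR).
  assert (P2in : forall x, inR dimw (P2 x)) by (intros; apply trunc_inR).
  assert (D1 : forall x, inR dimw x -> action (P1 x) <= action x /\
    forall k e, (k < dimw)%nat -> 0 <= e <= 1 -> theta x = 1 -> e0 / 2 + e <= Rabs (grad x k) ->
      action (P1 x) <= action x - e0 / 4 * (t1 * e)).
  { intros x Hx. apply push_descends; auto; try lra; [apply theta_spec|].
    intros tp y k Hy Hn Hk. assert (Hh := proj1 (proj2 (theta_spec x)) tp).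
    assert (U := Unif x y Hx Hy Hh Hn k Hk). apply abs_le_inv in U. split; intros; lra. }
  assert (D2 : forall x, inR dimw x -> action (P2 x) <= action x /\
    forall k e, (k < dimw)%nat -> 0 <= e <= 1 -> 1 = 1 -> thr + e <= Rabs (hfield x k) ->
      action (P2 x) <= action x - l ^ N * (/ 4 * e)).
  { intros x Hx. apply (push_descends (/ 4) (fun _ => 1)); auto; try lra.
    intros _ y k Hy Hn Hk. apply grad_sign; auto. intros i Hi. specialize (Hn i Hi). lra. }
  set (u := Rmin (e0 / 2) 1). assert (u0 : 0 < u) by (apply Rmin_glb_lt; lra).
  assert (u1 : u <= 1) by apply Rmin_r. assert (u2 : u <= e0 / 2) by apply Rmin_l.
  set (mu1 := e0 / 4 * (t1 * u)). assert (mu10 : 0 < mu1) by (unfold mu1; repeat apply Rmult_lt_0_compat; lra).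
  set (mu2 := l ^ N * (/ 4 * / 2)). assert (mu20 : 0 < mu2) by (unfold mu2; lra).
  (* The three possible gains are [mu1] and [mu2] from the pushes and [e0] from the gap between [g]
     and [action]; each is at least [2 * e] and so leads from below [c + e] to below [c - e]. *)
  set (e := Rmin (Rmin mu1 mu2) e0 / 2).
  assert (m0 : 0 < Rmin (Rmin mu1 mu2) e0) by (repeat apply Rmin_glb_lt; auto).
  assert (e2 : 2 * e <= mu1 /\ 2 * e <= mu2 /\ 2 * e <= e0).
  { unfold e. assert (X1 := Rmin_l (Rmin mu1 mu2) e0). assert (X2 := Rmin_r (Rmin mu1 mu2) e0).
    assert (X3 := Rmin_l mu1 mu2). assert (X4 := Rmin_r mu1 mu2). lra. }
  assert (ep : 0 < e) by (unfold e; lra).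
  exists e, (fun x => P2 (P1 x)). split; auto. split; [|split; [|split]].
  - intros k Hk. apply (cont_comp dimw dimw (fun x => P2 x k) P1); auto.
    + apply push_cont; auto; [apply cont_const | intros; now apply cont_hfield].
    + apply push_cont; auto; [apply theta_cont | intros; now apply cont_grad].
  - intros x. apply P2in.
  - intros x k Hk. assert (Q1 : Rabs (P1 x k - x k) <= t1).
    { apply push_near; auto; try lra. apply theta_spec. }
    assert (Q2 : Rabs (P2 (P1 x) k - P1 x k) <= / 4) by (apply push_near; auto; lra).
    apply abs_le_inv in Q1. apply abs_le_inv in Q2. apply Rabs_le. lra.
  - intros x Hx Hgx. destruct (D1 x Hx) as [D1a D1b]. destruct (D2 (P1 x) (P1in x)) as [D2a D2b].
    specialize (Hle x Hx).
    destruct (Rle_lt_dec (action x) (c - e)) as [low|high]; [lra|].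
    destruct (classic (forall k, (k < dimw)%nat -> Rabs (hfield x k) <= thr + 1)) as [Fib|NFib].
    + destruct (Dich x Hx) as [[k [Hk Hgr]]|Hd].
      * intros k Hk. specialize (Fib k Hk). lra.
      * apply Rabs_le. lra.
      * assert (Q := D1b k u Hk ltac:(lra) (proj2 (proj2 (theta_spec x)) Fib) ltac:(lra)). fold mu1 in Q. lra.
      * lra.
    + assert (exists k, (k < dimw)%nat /\ thr + 1 < Rabs (hfield x k)) as [k [Hk Hbig]].
      { apply NNPP. intros No. apply NFib. intros k Hk. apply Rnot_lt_le. intros L. apply No. exists k; auto. }
      assert (Hn : forall k, (k < dimw)%nat -> Rabs (P1 x k - x k) <= t1).
      { intros i Hi. apply push_near; auto; try lra. apply theta_spec. }
      (* The first push changes [hfield] by at most [2 * t1], hence by at most a half, so the second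
         push still finds a component beyond [thr + 1/2]. *)
      assert (Hh := hfield_near x (P1 x) t1 k Hk Hn). rewrite Rabs_minus_sym in Hh.
      assert (Tr := Rabs_triang (hfield x k - hfield (P1 x) k) (hfield (P1 x) k)).
      replace (hfield x k - hfield (P1 x) k + hfield (P1 x) k) with (hfield x k) in Tr by ring.
      assert (Q := D2b k (/ 2) Hk ltac:(lra) eq_refl ltac:(lra)). fold mu2 in Q. lra.
Qed.
End Deformation.

Lemma deformation c g : 0 < c -> cont dimw g -> (forall w, inR dimw w -> action w <= g w) ->
  (forall w, critical w -> action w = c -> action w < g w) ->
  exists e T, 0 < e /\ (forall k, (k < dimw)%nat -> cont dimw (fun x => T x k)) /\
    (forall x, inR dimw (T x)) /\ (forall x k, (k < dimw)%nat -> Rabs (T x k - x k) <= 1) /\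
    forall x, inR dimw x -> g x < c + e -> action (T x) <= c - e.
Proof.
  destruct height_bounds_uniform as [B [C [l [B0 [C0 [l0 Hbd]]]]]].
  now apply (deformation_bounded B C l).
Qed.

(** * Linking and the minimax value *)

Lemma action_bounds w : fsum N (pxi w) <= action w.
Proof.
  unfold action. assert (Q : forall j, (j <= N)%nat -> fsum j (pxi w) <= height w j - height w 0).
  { induction j; intros Hj; [simpl; lra|]. simpl fsum. specialize (IHj ltac:(lia)).
    change (height w (S j)) with (height w j + pxi w j + St j (pt w j)).
    assert (P := step_nonneg _ _ _ _ _ (Hch j) (pt w j) (node_inR _ _ _)). lra. }
  now apply Q.
Qed.

Lemma action_upper : exists M, forall w, action w <= fsum N (pxi w) + M.
Proof.
  destruct height_bounds_uniform as [B [C [l [B0 [C0 [l0 Hbd]]]]]]. exists (INR N * C). intros w.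
  unfold action. assert (Q : forall j, (j <= N)%nat -> height w j - height w 0 <= fsum j (pxi w) + INR j * C).
  { induction j; intros Hj; [simpl; lra|]. simpl fsum. rewrite S_INR. specialize (IHj ltac:(lia)).
    change (height w (S j)) with (height w j + pxi w j + St j (pt w j)).
    destruct (Hbd j (pt w j) ltac:(lia) (node_inR _ _ _)) as [_ [_ [_ P]]]. lra. }
  now apply Q.
Qed.

Definition dimu : nat := (N * n + n + 1)%nat.
Definition ub (u : nat -> R) (j i : nat) : R := u (j * n + i)%nat.
Definition pbar (u : nat -> R) (i : nat) : R := / INR N * fsum N (fun j => ub u j i).
(** Deviations from the mean, so that the increments of the positions sum to zero around the
    cycle. *)
Definition uxi (u : nat -> R) (j i : nat) : R := (pbar u i - ub u j i) / 2.

(* Parametrizes the subspace P_j = pbar - (X_j - X_{j-1}), on which the quadratic part is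
   nonpositive, by z, X_{N-1} and the coordinates P_j - (X_j - X_{j-1}). *)
Definition embed (u : nat -> R) : nat -> R :=
  layout (fun j i => u (N * n + i)%nat + fsum (S j) (fun k => uxi u k i))
         (fun j i => (pbar u i + ub u j i) / 2) (u (N * n + n)%nat).

(** A left inverse of [embed]. Its fibres are the linking subspaces [P_j = y + (X_j - X_(j-1))] with
    [X_(N-1)] and [z] prescribed, on which the quadratic part is the sum of the squares of the
    increments. *)
Definition proj (w : nat -> R) : nat -> R := fun k =>
  if Nat.ltb k (N * n) then w (iP (k / n) (k mod n)) - xi w (k / n) (k mod n)
  else if Nat.ltb k (N * n + n) then w (iX (N - 1) (k - N * n)) else w iZ.

Lemma N_pos : 0 < INR N.
Proof. apply lt_0_INR. lia. Qed.

Lemma sum_uxi u i : fsum N (fun j => uxi u j i) = 0.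
Proof.
  unfold uxi. rewrite (fsum_ext N _ (fun j => / 2 * pbar u i - / 2 * ub u j i)) by (intros; field).
  rewrite fsum_minus, fsum_const, fsum_scal. unfold pbar at 1. assert (P := N_pos). field. lra.
Qed.

Lemma embed_xi u j i : (j < N)%nat -> (i < n)%nat -> xi (embed u) j i = uxi u j i.
Proof.
  intros Hj Hi. unfold xi, embed. rewrite !layout_X by (auto; now apply prev_lt).
  destruct j as [|j].
  - unfold prev. replace (S (N - 1)) with N by lia. rewrite sum_uxi. simpl. ring.
  - simpl. ring.
Qed.

Lemma proj_grid w j i : (j < N)%nat -> (i < n)%nat -> proj w (j * n + i)%nat = w (iP j i) - xi w j i.
Proof.
  intros Hj Hi. unfold proj. assert (Q := iX_lt j i Hj Hi). unfold iX in Q.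
  destruct (Nat.ltb_spec (j * n + i) (N * n)); [|lia]. now destruct (grid_div j i Hi) as [-> ->].
Qed.

Lemma proj_X w i : (i < n)%nat -> proj w (N * n + i)%nat = w (iX (N - 1) i).
Proof.
  intros Hi. unfold proj. destruct (Nat.ltb_spec (N * n + i) (N * n)); [lia|].
  destruct (Nat.ltb_spec (N * n + i) (N * n + n)); [|lia]. f_equal. f_equal. lia.
Qed.

Lemma proj_Z w : proj w (N * n + n)%nat = w iZ.
Proof.
  unfold proj. destruct (Nat.ltb_spec (N * n + n) (N * n)); [lia|]. now rewrite Nat.ltb_irrefl.
Qed.

Lemma index_u k : (k < dimu)%nat ->
  (exists j i, (j < N)%nat /\ (i < n)%nat /\ k = (j * n + i)%nat) \/
  (exists i, (i < n)%nat /\ k = (N * n + i)%nat) \/ k = (N * n + n)%nat.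
Proof.
  unfold dimu. intros Hk. destruct (lt_dec k (N * n)) as [l|l].
  - left. destruct (index_grid k) as [[j [i [Hj [Hi E]]]]|[[j [i [Hj [Hi E]]]]|E]]; [unfold dimw; lia | | |].
    + exists j, i. auto. + unfold iP in E. lia. + unfold iZ in E. lia.
  - right. destruct (lt_dec k (N * n + n)); [left; exists (k - N * n)%nat; lia | right; lia].
Qed.

Lemma proj_embed u k : (k < dimu)%nat -> proj (embed u) k = u k.
Proof.
  intros Hk. destruct (index_u k Hk) as [[j [i [Hj [Hi ->]]]]|[[i [Hi ->]]| ->]].
  - rewrite proj_grid, embed_xi by auto. unfold embed. rewrite layout_P by auto. unfold uxi.
    change (u (j * n + i)%nat) with (ub u j i). field.
  - rewrite proj_X by auto. unfold embed. rewrite layout_X by (auto; lia).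
    replace (S (N - 1)) with N by lia. rewrite sum_uxi. ring.
  - rewrite proj_Z. unfold embed. now rewrite layout_Z.
Qed.

Lemma embed_quadratic u : fsum N (pxi (embed u)) <= 0.
Proof.
  assert (E : fsum N (pxi (embed u)) = fsum N (fun j => fsum n (fun i => pbar u i * uxi u j i)) -
     fsum N (fun j => fsum n (fun i => uxi u j i * uxi u j i))).
  { rewrite <- fsum_minus. apply fsum_ext. intros j Hj. rewrite <- fsum_minus. apply fsum_ext. intros i Hi.
    rewrite embed_xi by auto. unfold embed. rewrite layout_P by auto. unfold uxi. field. }
  rewrite E, fsum_swap, (fsum_zero n).
  - assert (0 <= fsum N (fun j => fsum n (fun i => uxi u j i * uxi u j i))); [|lra].
    apply fsum_nonneg. intros j _. apply fsum_nonneg. intros i _. apply Rle_0_sqr.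
  - intros i _. rewrite fsum_scal, sum_uxi. ring.
Qed.

Definition admissible_map (s : (nat -> R) -> nat -> R) : Prop :=
  (forall k, (k < dimw)%nat -> cont dimu (fun u => s u k)) /\
  (forall u, inR dimu u -> inR dimw (s u)) /\
  exists C, forall u k, inR dimu u -> (k < dimw)%nat -> Rabs (s u k - embed u k) <= C.

Definition attainable (g : (nat -> R) -> R) (M : R) : Prop :=
  exists s, admissible_map s /\ forall u, inR dimu u -> g (s u) <= M.

Definition minimax (g : (nat -> R) -> R) (c : R) : Prop :=
  (forall M, attainable g M -> c <= M) /\ forall e, 0 < e -> exists M, attainable g M /\ M < c + e.

Lemma embed_admissible : admissible_map embed.
Proof.
  assert (Cb : forall j i, (j < N)%nat -> (i < n)%nat -> cont dimu (fun u => ub u j i)).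
  { intros j i Hj Hi. apply cont_coord. assert (Q := iX_lt j i Hj Hi). unfold iX in Q. unfold dimu. lia. }
  assert (Cp : forall i, (i < n)%nat -> cont dimu (fun u => pbar u i)).
  { intros i Hi. apply cont_scal. apply (cont_fsum dimu N (fun j u => ub u j i)). intros; now apply Cb. }
  split; [|split].
  - intros k Hk. unfold embed. destruct (index_grid k Hk) as [[j [i [Hj [Hi ->]]]]|[[j [i [Hj [Hi ->]]]]| ->]].
    + apply (cont_ext dimu (fun u => u (N * n + i)%nat + fsum (S j) (fun k => uxi u k i))).
      { intros; now rewrite layout_X. }
      apply cont_plus; [apply cont_coord; unfold dimu; lia|].
      apply (cont_fsum dimu (S j) (fun k u => uxi u k i)). intros k' Hk'.
      apply (cont_ext dimu (fun u => / 2 * (pbar u i - ub u k' i))); [intros; unfold uxi; field|].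
      apply cont_scal, cont_minus; [now apply Cp | apply Cb; auto; lia].
    + apply (cont_ext dimu (fun u => / 2 * (pbar u i + ub u j i))).
      { intros; rewrite layout_P by auto; field. }
      apply cont_scal, cont_plus; [now apply Cp | now apply Cb].
    + apply (cont_ext dimu (fun u => u (N * n + n)%nat)); [intros; now rewrite layout_Z|].
      apply cont_coord. unfold dimu; lia.
  - intros; apply layout_inR.
  - exists 0. intros u k _ _. rewrite Rminus_diag, Rabs_R0. lra.
Qed.

(** Each component of [proj] involves at most three coordinates with coefficients 1 or -1, so [proj]
    after [s] moves points by at most [3 * C]. *)
Lemma linking s (c : nat -> R) : admissible_map s ->
  exists u, inR dimu u /\ forall k, (k < dimu)%nat -> proj (s u) k = c k.
Proof.
  intros [Cs [Rs [C HC]]].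
  apply (bounded_displacement_surj dimu (3 * C) (fun u => proj (s u)) c).
  - intros k Hk. destruct (index_u k Hk) as [[j [i [Hj [Hi ->]]]]|[[i [Hi ->]]| ->]].
    + apply (cont_ext dimu (fun u => s u (iP j i) - (s u (iX j i) - s u (iX (prev j) i)))).
      { intros. now rewrite proj_grid. }
      apply cont_minus; [apply Cs, iP_dim; auto|].
      apply cont_minus; apply Cs, iX_dim; auto. now apply prev_lt.
    + apply (cont_ext dimu (fun u => s u (iX (N - 1) i))); [intros; now rewrite proj_X|].
      apply Cs, iX_dim; auto; lia.
    + apply (cont_ext dimu (fun u => s u iZ)); [intros; now rewrite proj_Z|]. apply Cs, iZ_dim.
  - intros u k Hu Hk. rewrite <- (proj_embed u k Hk).
    assert (K : forall k, (k < dimw)%nat -> - C <= s u k - embed u k <= C).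
    { intros l Hl. apply abs_le_inv. now apply HC. }
    destruct (index_u k Hk) as [[j [i [Hj [Hi ->]]]]|[[i [Hi ->]]| ->]].
    + rewrite !proj_grid by auto. unfold xi.
      assert (K1 := K _ (iP_dim j i Hj Hi)). assert (K2 := K _ (iX_dim j i Hj Hi)).
      assert (K3 := K _ (iX_dim (prev j) i (prev_lt j Hj) Hi)). apply Rabs_le. lra.
    + rewrite !proj_X by auto. assert (K1 := K _ (iX_dim (N - 1) i ltac:(lia) Hi)). apply Rabs_le. lra.
    + rewrite !proj_Z. assert (K1 := K _ iZ_dim). apply Rabs_le. lra.
Qed.

Definition constant_config (x y : nat -> R) (z : R) : nat -> R := layout (fun _ => x) (fun _ => y) z.

(** Every competitor meets the fibre of [proj] through the given constant configuration. There, if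
    all increments are at most [r], the point lies so close to that configuration that half of its
    action remains; otherwise the quadratic part alone is at least [r * r], and nonnegativity of the
    steps adds to it. *)
Lemma linking_lower_bound x0 y0 z0 : 0 < action (constant_config x0 y0 z0) ->
  exists d, 0 < d /\ forall M, attainable action M -> d <= M.
Proof.
  set (w0 := constant_config x0 y0 z0). intros Pos.
  assert (Hw0 : inR dimw w0) by apply layout_inR.
  destruct (cont_action w0 Hw0 (action w0 / 2)) as [d0 [d00 K]]; [lra|].
  assert (PN := N_pos). set (r := d0 / (2 * INR N + 2)).
  assert (r0 : 0 < r) by (apply Rdiv_lt_0_compat; lra).
  assert (rd : 2 * INR N * r < d0 /\ r < d0).
  { assert (E : (2 * INR N + 2) * r = d0) by (unfold r; field; lra).
    assert (0 < INR N * r) by (apply Rmult_lt_0_compat; auto). lra. }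
  exists (Rmin (action w0 / 2) (r * r)). split; [apply Rmin_glb_lt; [lra | now apply Rmult_lt_0_compat]|].
  intros M [s [Hs HM]].
  set (c := fun k => if Nat.ltb k (N * n) then y0 (k mod n) else if Nat.ltb k (N * n + n) then x0 (k - N * n)%nat else z0).
  destruct (linking s c Hs) as [u [Hu Hc]]. eapply Rle_trans; [|apply (HM u Hu)].
  set (w := s u) in *. assert (Hw : inR dimw w) by (apply Hs; auto).
  assert (HP : forall j i, (j < N)%nat -> (i < n)%nat -> w (iP j i) = y0 i + xi w j i).
  { intros j i Hj Hi. assert (Q := iX_lt j i Hj Hi). unfold iX in Q.
    assert (E := Hc (j * n + i)%nat ltac:(unfold dimu; lia)). rewrite proj_grid in E by auto.
    unfold c in E. destruct (Nat.ltb_spec (j * n + i) (N * n)); [|lia].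
    destruct (grid_div j i Hi) as [_ E2]. rewrite E2 in E. lra. }
  assert (HX : forall i, (i < n)%nat -> w (iX (N - 1) i) = x0 i).
  { intros i Hi. assert (E := Hc (N * n + i)%nat ltac:(unfold dimu; lia)). rewrite proj_X in E by auto.
    rewrite E. unfold c. destruct (Nat.ltb_spec (N * n + i) (N * n)); [lia|].
    destruct (Nat.ltb_spec (N * n + i) (N * n + n)); [|lia]. f_equal. lia. }
  assert (HZ : w iZ = z0).
  { rewrite <- proj_Z, Hc by (unfold dimu; lia). unfold c.
    destruct (Nat.ltb_spec (N * n + n) (N * n)); [lia|]. now rewrite Nat.ltb_irrefl. }
  destruct (classic (forall j i, (j < N)%nat -> (i < n)%nat -> Rabs (xi w j i) <= r)) as [Small|NSmall].
  - eapply Rle_trans; [apply Rmin_l|].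
    assert (Nr : near dimw w0 w d0).
    { intros k Hk. unfold w0, constant_config.
      destruct (index_grid k Hk) as [[j [i [Hj [Hi ->]]]]|[[j [i [Hj [Hi ->]]]]| ->]].
      - rewrite layout_X, <- (HX i Hi) by auto. apply (Rle_lt_trans _ (2 * INR N * r)); [|apply rd].
        apply (chain_bound (fun j => w (iX j i))); auto; try lra; try lia. intros a Ha.
        exact (Small (S a) i Ha Hi).
      - rewrite layout_P, HP by auto. replace (y0 i + xi w j i - y0 i) with (xi w j i) by ring.
        specialize (Small j i Hj Hi). lra.
      - rewrite layout_Z, HZ, Rminus_diag, Rabs_R0. lra. }
    specialize (K w Hw Nr). apply Rabs_def2 in K. lra.
  - assert (exists j i, (j < N)%nat /\ (i < n)%nat /\ r < Rabs (xi w j i)) as [j [i [Hj [Hi Hbig]]]].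
    { apply NNPP. intros No. apply NSmall. intros j i Hj Hi. apply Rnot_lt_le. intros L. apply No. exists j, i; auto. }
    eapply Rle_trans; [apply Rmin_r|]. eapply Rle_trans; [|apply action_bounds].
    assert (E : fsum N (pxi w) = fsum N (fun j => fsum n (fun i => y0 i * xi w j i)) +
       fsum N (fun j => fsum n (fun i => xi w j i * xi w j i))).
    { rewrite <- fsum_plus. apply fsum_ext. intros a Ha. rewrite <- fsum_plus. apply fsum_ext. intros b Hb.
      rewrite HP by auto. ring. }
    rewrite E, fsum_swap, (fsum_zero n), Rplus_0_l by (intros; rewrite fsum_scal, sum_xi; ring).
    assert (T1 := fsum_term_le N (fun j => fsum n (fun i => xi w j i * xi w j i)) j
      (fun a _ => fsum_nonneg n _ (fun b _ => Rle_0_sqr (xi w a b))) Hj). simpl in T1.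
    assert (T2 := fsum_term_le n (fun i => xi w j i * xi w j i) i (fun b _ => Rle_0_sqr (xi w j b)) Hi). simpl in T2.
    assert (r * r <= xi w j i * xi w j i).
    { assert (P := Rabs_pos (xi w j i)). rewrite <- (Rabs_right (xi w j i * xi w j i)) by (apply Rle_ge, Rle_0_sqr).
      rewrite Rabs_mult. apply Rmult_le_compat; lra. }
    lra.
Qed.

Lemma attainable_some : exists M, attainable action M.
Proof.
  destruct action_upper as [M HM]. exists M, embed. split; [apply embed_admissible|]. intros u _.
  specialize (HM (embed u)). assert (Q := embed_quadratic u). lra.
Qed.

Lemma minimax_exists d : (forall M, attainable action M -> d <= M) -> exists c, minimax action c /\ d <= c.
Proof.
  intros Hd. destruct attainable_some as [M0 HM0].
  destruct (completeness (fun x => attainable action (- x))) as [s [sub slub]].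
  { exists (- d). intros x Hx. specialize (Hd _ Hx). lra. }
  { exists (- M0). now rewrite Ropp_involutive. }
  exists (- s). split; [split|].
  - intros M HM. assert (- M <= s); [|lra]. apply sub. now rewrite Ropp_involutive.
  - intros e e0. apply NNPP. intros No. assert (s <= s - e); [|lra]. apply slub. intros x Hx.
    apply Rnot_lt_le. intros L. apply No. exists (- x). split; auto. lra.
  - assert (s <= - d); [|lra]. apply slub. intros x Hx. specialize (Hd _ Hx). lra.
Qed.

(** If [c' <= c], a competitor for [g] staying below [c + e] would be deformed into one for [action]
    staying below [c - e]. The deformation moves points by a bounded amount and so respects
    admissibility. *)
Lemma minimax_lt g c c' : 0 < c -> cont dimw g -> (forall w, inR dimw w -> action w <= g w) ->
  (forall w, critical w -> action w = c -> action w < g w) ->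
  minimax action c -> minimax g c' -> c < c'.
Proof.
  intros c0 Cg Hle Hcrit [H1 _] [_ H2']. apply Rnot_le_lt. intros L.
  destruct (deformation c g c0 Cg Hle Hcrit) as [e [T [e0 [CT [RT [DT HT]]]]]].
  destruct (H2' e e0) as [M [[s [[Cs [Rs [C HC]]] HM]] LM]].
  assert (c <= c - e); [|lra]. apply H1. exists (fun u => T (s u)). split; [split; [|split]|].
  - intros k Hk. apply (cont_comp dimu dimw (fun x => T x k) s); auto.
  - intros; apply RT.
  - exists (C + 1). intros u k Hu Hk. specialize (HC u k Hu Hk). specialize (DT (s u) k Hk).
    apply abs_le_inv in HC. apply abs_le_inv in DT. apply Rabs_le. lra.
  - intros u Hu. apply HT; auto. specialize (HM u Hu). lra.
Qed.

(** With [g = action] and no critical point at level [c], the previous lemma would give [c < c]. *)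
Lemma minimax_critical c : 0 < c -> minimax action c -> exists w, critical w /\ action w = c.
Proof.
  intros c0 Hc. apply NNPP. intros No. assert (c < c); [|lra].
  apply (minimax_lt action); auto; [apply cont_action | intros; lra|].
  intros w Hw E. exfalso. apply No. exists w; auto.
Qed.

End Action.

(** * Iterates and their conformal factors *)

(** [conf_factor] strengthened by derivatives of all components, momenta included, and by invariance
    of the space, as the chain rule for an outer map requires. *)
Definition full_conf (n : nat) (psi : (nat -> R) -> nat -> R) (g : (nat -> R) -> R) : Prop :=
  forall p, inR (2 * n + 1) p -> inR (2 * n + 1) (psi p) /\ forall j, (j < 2 * n + 1)%nat ->
    exists d, (forall i, (i < 2 * n + 1)%nat -> derivable_pt_lim (fun s => psi (upd p j s) i) 0 (d i)) /\
      d (2 * n)%nat - fsum n (fun i => psi p (n + i)%nat * d i) = exp (g p) * alpha_coef n p j.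

Lemma full_conf_conf n psi g : full_conf n psi g -> conf_factor n psi g.
Proof.
  intros H p Hp j Hj. destruct (proj2 (H p Hp) j Hj) as [d [Hd E]]. exists (d (2 * n)%nat), d.
  split; [apply Hd; lia|]. split; auto. intros i Hi. apply Hd; lia.
Qed.

Lemma alpha_pairing n p (d : nat -> R) : fsum (2 * n + 1) (fun k => alpha_coef n p k * d k) =
  d (2 * n)%nat - fsum n (fun i => p (n + i)%nat * d i).
Proof.
  rewrite fsum_split, alpha_last.
  rewrite (fsum_ext n (fun i => alpha_coef n p i * d i) (fun i => (-1) * (p (n + i)%nat * d i))).
  - rewrite fsum_scal, (fsum_zero n (fun i => alpha_coef n p (n + i) * d (n + i)%nat)); [ring|].
    intros i Hi. unfold alpha_coef. destruct (Nat.ltb_spec (n + i) n); [lia|].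
    destruct (Nat.ltb_spec (n + i) (2 * n)); [ring | lia].
  - intros i Hi. unfold alpha_coef. destruct (Nat.ltb_spec i n); [ring|lia].
Qed.

Lemma full_conf_id n : full_conf n (fun p => p) (fun _ => 0).
Proof.
  intros p Hp. split; auto. intros j Hj. set (d := fun i => if Nat.eqb i j then 1 else 0). exists d. split.
  - intros i Hi. unfold upd, d. destruct (Nat.eqb i j).
    + replace 1 with (0 + 1) by ring.
      apply (derivable_pt_lim_plus (fun _ => p i) id); [apply derivable_pt_lim_const | apply derivable_pt_lim_id].
    + apply derivable_pt_lim_const.
  - rewrite <- (alpha_pairing n p d), exp_0, Rmult_1_l. unfold d.
    rewrite (fsum_single _ _ j Hj); [rewrite Nat.eqb_refl; ring|].
    intros k _ ne. destruct (Nat.eqb_spec k j); [contradiction | ring].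
Qed.

Lemma full_conf_comp n phi g psi h : smooth_map (2 * n + 1) phi -> conf_factor n phi g -> full_conf n psi h ->
  full_conf n (fun p => phi (psi p)) (fun p => h p + g (psi p)).
Proof.
  intros [Rphi Sphi] Hg Hh p Hp. set (m := (2 * n + 1)%nat) in *. destruct (Hh p Hp) as [Rp Hj]. split; auto.
  intros j Hlt. destruct (Hj j Hlt) as [d [Hd E]].
  set (D := fun i => match lt_dec i m with
    | left l => proj1_sig (constructive_indefinite_description _ (Ck_partials m 0 _ (Sphi i l 1%nat)))
    | right _ => fun _ _ => 0 end).
  assert (HD : forall i, (i < m)%nat -> partials m (fun v => phi v i) (D i) /\ forall k, (k < m)%nat -> cont m (D i k)).
  { intros i Hi. unfold D. destruct (lt_dec i m) as [l|]; [|lia].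
    destruct (constructive_indefinite_description _ _) as [g' [H1 H2]]. simpl. auto. }
  exists (fun i => fsum m (fun k => D i k (psi p) * d k)). split.
  - intros i Hi. destruct (HD i Hi) as [H1 H2].
    assert (E0 : psi (upd p j 0) = psi p) by now rewrite upd_0.
    rewrite <- E0. apply (frechet_curve m (fun v => phi v i) _ (fun s => psi (upd p j s))); auto.
    + apply partials_frechet; auto. rewrite E0. auto.
    + intros s. apply Hh. now apply upd_inR.
  - assert (Hc : forall k, (k < m)%nat -> D (2 * n)%nat k (psi p) - fsum n (fun i => phi (psi p) (n + i)%nat * D i k (psi p))
       = exp (g (psi p)) * alpha_coef n (psi p) k).
    { intros k Hk. destruct (Hg (psi p) Rp k Hk) as [dz [dx [Hz [Hx <-]]]]. f_equal.
      - eapply uniqueness_limite; [|exact Hz]. apply HD; auto. unfold m; lia.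
      - apply fsum_ext. intros i Hi. f_equal. eapply uniqueness_limite; [|apply Hx; auto].
        apply HD; auto. unfold m; lia. }
    rewrite (fsum_ext n _ (fun i => fsum m (fun k => phi (psi p) (n + i)%nat * D i k (psi p) * d k))).
    2:{ intros i Hi. rewrite <- fsum_scal. apply fsum_ext. intros; ring. }
    rewrite fsum_swap, <- fsum_minus.
    rewrite (fsum_ext m _ (fun k => exp (g (psi p)) * (alpha_coef n (psi p) k * d k))).
    + rewrite fsum_scal. unfold m. rewrite (alpha_pairing n (psi p) d), E, exp_plus. ring.
    + intros k Hk. rewrite <- Rmult_assoc, <- Hc by auto. rewrite Rmult_minus_distr_r. f_equal.
      rewrite Rmult_comm, <- fsum_scal. apply fsum_ext. intros; ring.
Qed.

Definition iter_factor (g : (nat -> R) -> R) (phi : (nat -> R) -> nat -> R) (k : nat) (p : nat -> R) : R :=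
  fsum k (fun i => g (Nat.iter i phi p)).

Lemma iter_conf n phi g k : smooth_map (2 * n + 1) phi -> conf_factor n phi g ->
  full_conf n (Nat.iter k phi) (iter_factor g phi k).
Proof.
  intros Hs Hg. induction k; [apply full_conf_id|]. apply (full_conf_comp n phi g _ _ Hs Hg IHk).
Qed.

Lemma iter_inR m phi k q : (forall p, inR m p -> inR m (phi p)) -> inR m q -> inR m (Nat.iter k phi q).
Proof. intros H Hq. induction k; simpl; auto. Qed.

Lemma iter_add_apply {T : Type} (f : T -> T) a b x : Nat.iter (a + b) f x = Nat.iter a f (Nat.iter b f x).
Proof. induction a; simpl; congruence. Qed.

(** * Comparing heights *)

(** The derivative with respect to the height is [1 + A (2 * n)], which is a conformal factor and
    hence positive. *)
Lemma step_height_increasing n N S A psi F j w z z' : (1 <= N)%nat -> contact_step n S A psi F -> z < z' ->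
  z + S (node n N w z j) < z' + S (node n N w z' j).
Proof.
  intros HN St zz.
  destruct (MVT_cor2 (fun s => s + S (node n N w s j)) (fun s => 1 + A (2 * n)%nat (node n N w s j)) z z' zz) as [c [Hc1 Hc2]].
  - intros c _. apply (derivable_pt_lim_plus id (fun s => S (node n N w s j))); [apply derivable_pt_lim_id|].
    replace (A (2 * n)%nat (node n N w c j)) with
      (fsum (2 * n + 1) (fun i => A i (node n N w c j) * (if Nat.eqb i (2 * n) then 1 else 0))).
    + apply (frechet_curve (2 * n + 1) S _ (fun s => node n N w s j)).
      * apply (step_frechet _ _ _ _ _ St). now apply node_inR.
      * intros; now apply node_inR.
      * intros i Hi. unfold node. destruct (Nat.ltb_spec i n).
        { destruct (Nat.eqb_spec i (2 * n)); [lia | apply derivable_pt_lim_const]. }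
        destruct (Nat.ltb_spec i (2 * n)).
        { destruct (Nat.eqb_spec i (2 * n)); [lia | apply derivable_pt_lim_const]. }
        destruct (Nat.eqb_spec i (2 * n)); [apply derivable_pt_lim_id | apply derivable_pt_lim_const].
    + rewrite (fsum_single _ _ (2 * n)%nat); [rewrite Nat.eqb_refl; ring | lia |].
      intros k _ ne. destruct (Nat.eqb_spec k (2 * n)); [contradiction | ring].
  - assert (P : 0 < 1 + A (2 * n)%nat (node n N w c j)).
    { destruct (step_gen _ _ _ _ _ St (node n N w c j)) as [q [Hq [_ [_ [-> _]]]]]; [now apply node_inR|].
      assert (Q := step_pos _ _ _ _ _ St q Hq). lra. }
    assert (0 < (1 + A (2 * n)%nat (node n N w c j)) * (z' - z)) by (apply Rmult_lt_0_compat; lra). lra.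
Qed.

Section Compare.
Variables (n N : nat) (St St' : nat -> (nat -> R) -> R) (A A' : nat -> nat -> (nat -> R) -> R).
Variables (psi psi' : nat -> (nat -> R) -> nat -> R) (F F' : nat -> (nat -> R) -> R).
Hypothesis HN : (1 <= N)%nat.
Hypothesis Hch : contact_chain n St A psi F.
Hypothesis Hch' : contact_chain n St' A' psi' F'.
Hypothesis Hcmp : forall j, St j = St' j \/ St j = fun _ => 0.

(** A common step preserves the order of the heights because it is increasing in [z]; where the
    first chain is trivial, the second one adds a nonnegative amount. *)
Lemma height_le w j : height n N St w j <= height n N St' w j.
Proof.
  induction j; simpl; [lra|].
  destruct (Hcmp j) as [E|E]; rewrite E.
  - destruct (Rle_lt_or_eq_dec _ _ IHj) as [L|e]; [|rewrite e; lra].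
    assert (Q := step_height_increasing n N _ _ _ _ j w _ _ HN (Hch' j) L). lra.
  - assert (P := step_nonneg _ _ _ _ _ (Hch' j) (node n N w (height n N St' w j) j) (node_inR _ _ HN _ _ _)). lra.
Qed.

Lemma height_lt_step w j : height n N St w j < height n N St' w j -> height n N St w (S j) < height n N St' w (S j).
Proof.
  intros H. simpl. destruct (Hcmp j) as [E|E]; rewrite E.
  - assert (Q := step_height_increasing n N _ _ _ _ j w _ _ HN (Hch' j) H). lra.
  - assert (P := step_nonneg _ _ _ _ _ (Hch' j) (node n N w (height n N St' w j) j) (node_inR _ _ HN _ _ _)). lra.
Qed.

Lemma action_le w : action n N St w <= action n N St' w.
Proof. unfold action. simpl. assert (Q := height_le w N). lra. Qed.

(** A strict inequality at any stage would propagate to the end and make the actions differ. *)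
Lemma height_eq w j : ~ action n N St w < action n N St' w -> (j <= N)%nat ->
  height n N St w j = height n N St' w j.
Proof.
  intros H Hj. destruct (Rle_lt_or_eq_dec _ _ (height_le w j)) as [L|]; auto. exfalso. apply H.
  assert (Q : forall k, height n N St w (j + k) < height n N St' w (j + k)).
  { induction k; [now rewrite Nat.add_0_r|]. rewrite Nat.add_succ_r. now apply height_lt_step. }
  specialize (Q (N - j)%nat). replace (j + (N - j))%nat with N in Q by lia.
  unfold action. simpl. lra.
Qed.
End Compare.

Lemma trivial_step n : contact_step n (fun _ => 0) (fun _ _ => 0) (fun q => q) (fun _ => 1).
Proof.
  constructor.
  - intros w _ e e0. exists 1. split; [lra|]. intros w' _ _. rewrite fsum_zero by (intros; ring).
    replace (0 - 0 - 0) with 0 by ring. rewrite Rabs_R0.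
    assert (P := dist1_nonneg (2 * n + 1) w w'). apply Rmult_le_pos; lra.
  - intros; apply cont_const.
  - exists 0. auto.
  - intros; lra.
  - auto.
  - intros; lra.
  - intros w Hw. exists w. split; auto. unfold generated. split; [intros; repeat split; ring|].
    split; auto. split; [ring|]. rewrite fsum_zero by (intros; ring). ring.
Qed.

Lemma zero_gradient M f A w : frechet M f A w -> (forall v, inR M v -> f w <= f v) -> inR M w ->
  forall i, (i < M)%nat -> A i = 0.
Proof.
  intros Hf Hmin Hw i Hi.
  assert (D : derivable_pt_lim (fun s => f (upd w i s)) 0 (A i)).
  { replace (A i) with (fsum M (fun k => A k * (if Nat.eqb k i then 1 else 0))).
    - apply (frechet_curve M f A (fun s => upd w i s)).
      + now rewrite upd_0.
      + intros; now apply upd_inR.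
      + intros k Hk. unfold upd. destruct (Nat.eqb k i); [|apply derivable_pt_lim_const].
        replace 1 with (0 + 1) by ring.
        apply (derivable_pt_lim_plus (fun _ => w k) id); [apply derivable_pt_lim_const | apply derivable_pt_lim_id].
    - rewrite (fsum_single _ _ i Hi); [rewrite Nat.eqb_refl; ring|].
      intros k _ ne. destruct (Nat.eqb_spec k i); [contradiction | ring]. }
  set (pr := exist (fun l => derivable_pt_abs (fun s => f (upd w i s)) 0 l) (A i) D : derivable_pt (fun s => f (upd w i s)) 0).
  change (A i) with (derive_pt (fun s => f (upd w i s)) 0 pr).
  apply (deriv_minimum _ (-1) 1); try lra. intros x _ _. rewrite upd_0. apply Hmin. now apply upd_inR.
Qed.

(* S is nonnegative, hence critical where it vanishes; then psi fixes the corresponding point. *)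
Lemma step_zero n S A psi F w : contact_step n S A psi F -> inR (2 * n + 1) w -> S w = 0 -> psi w = w.
Proof.
  intros St Hw Z.
  assert (A0 : forall i, (i < 2 * n + 1)%nat -> A i w = 0).
  { apply (zero_gradient (2 * n + 1) S (fun i => A i w) w); auto.
    - now apply (step_frechet _ _ _ _ _ St).
    - intros v Hv. rewrite Z. now apply (step_nonneg _ _ _ _ _ St). }
  destruct (step_gen _ _ _ _ _ St w Hw) as [q [Hq [G1 [G2 [G3 G4]]]]].
  assert (F1 : F q = 1) by (rewrite A0 in G3 by lia; lra).
  assert (qw : q = w).
  { apply (inR_ext (2 * n + 1)); auto. intros k Hk.
    destruct (index_cases n k Hk) as [Hn|[[i [Hi ->]]| ->]]; auto.
    - destruct (G1 k Hn) as [_ [_ [_ E]]]. rewrite A0 in E by lia. lra.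
    - destruct (G1 i Hi) as [_ [E _]]. rewrite F1 in E. lra. }
  subst q. apply (inR_ext (2 * n + 1)); auto; [now apply (step_inR _ _ _ _ _ St)|]. intros k Hk.
  destruct (index_cases n k Hk) as [Hn|[[i [Hi ->]]| ->]].
  - now destruct (G1 k Hn).
  - destruct (G1 i Hi) as [_ [_ [E _]]]. rewrite A0 in E by lia. lra.
  - rewrite Z, fsum_zero in G4 by (intros; ring). lra.
Qed.

(** * Strictly increasing critical values of the iterates *)

Section Levels.
Variables (n : nat) (phi : (nat -> R) -> nat -> R) (g : (nat -> R) -> R) (N0 K : nat).
Variables (St : nat -> (nat -> R) -> R) (A : nat -> nat -> (nat -> R) -> R).
Variables (psi : nat -> (nat -> R) -> nat -> R) (F : nat -> (nat -> R) -> R).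
Let m := (2 * n + 1)%nat.
Hypothesis Hphi : contactomorphism n phi.
Hypothesis Hg : conf_factor n phi g.
Hypothesis HN0 : (1 <= N0)%nat.
Hypothesis HK : (1 <= K)%nat.
Hypothesis Hch : contact_chain n St A psi F.
Hypothesis Horb : forall q, inR m q -> orbit psi q N0 = phi q.
Hypothesis Hfac : forall q, inR m q -> orbit_factor F psi q N0 = exp (g q).
Let N := (K * N0)%nat.

(* The chain of phi^k, completed by trivial steps so that all k <= K share one configuration space. *)
Definition pad {T : Type} (u : nat -> T) (v : T) (k j : nat) : T := if Nat.ltb j (k * N0) then u (j mod N0) else v.
Definition Sk := pad St (fun _ => 0).
Definition Ak := pad A (fun _ _ => 0).
Definition psik := pad psi (fun q => q).
Definition Fk := pad F (fun _ => 1).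
Definition act (k : nat) : (nat -> R) -> R := action n N (Sk k).

Lemma chain_k k : contact_chain n (Sk k) (Ak k) (psik k) (Fk k).
Proof.
  intros j. unfold Sk, Ak, psik, Fk, pad. destruct (Nat.ltb j (k * N0)); [apply Hch | apply trivial_step].
Qed.

Lemma N_ge1 : (1 <= N)%nat.
Proof. unfold N. nia. Qed.

Lemma pad_block {T : Type} (u : nat -> T) v k i a : (i < k)%nat -> (a < N0)%nat -> pad u v k (i * N0 + a) = u a.
Proof.
  intros Hi Ha. unfold pad. destruct (Nat.ltb_spec (i * N0 + a) (k * N0)); [|nia].
  rewrite Nat.add_comm, Nat.Div0.mod_add, Nat.mod_small; auto.
Qed.

Lemma pad_tail {T : Type} (u : nat -> T) v k a : pad u v k (k * N0 + a) = v.
Proof. unfold pad. destruct (Nat.ltb_spec (k * N0 + a) (k * N0)); [lia|auto]. Qed.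

Lemma phi_inR q : inR m q -> inR m (phi q).
Proof. destruct Hphi as [[H _] _]. apply H. Qed.

Lemma orbit_k k i q : (i <= k)%nat -> inR m q -> orbit (psik k) q (i * N0) = Nat.iter i phi q /\
  orbit_factor (Fk k) (psik k) q (i * N0) = exp (iter_factor g phi i q).
Proof.
  intros Hi Hq. induction i as [|i IH].
  - simpl. unfold iter_factor. simpl. now rewrite exp_0.
  - destruct IH as [I1 I2]; [lia|].
    assert (Hiq : inR m (Nat.iter i phi q)) by (apply iter_inR; auto; apply phi_inR).
    replace (S i * N0)%nat with (i * N0 + N0)%nat by lia.
    rewrite orbit_shift, orbit_factor_shift, I1, I2.
    rewrite (orbit_ext _ psi), (orbit_factor_ext _ F _ psi).
    + rewrite Horb, Hfac by auto. split; auto. unfold iter_factor. simpl. rewrite <- exp_plus. f_equal. ring.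
    + intros j Hj. unfold psik, Fk. now rewrite !pad_block by lia.
    + intros j Hj. unfold psik. now rewrite !pad_block by lia.
Qed.

Lemma orbit_tail k a q : inR m q -> orbit (psik k) q (k * N0 + a) = Nat.iter k phi q /\
  orbit_factor (Fk k) (psik k) q (k * N0 + a) = exp (iter_factor g phi k q).
Proof.
  intros Hq. induction a as [|a [I1 I2]].
  - rewrite Nat.add_0_r. now apply orbit_k.
  - rewrite Nat.add_succ_r. simpl. rewrite I1, I2. unfold psik, Fk. rewrite !pad_tail. split; auto. ring.
Qed.

Lemma orbit_end k q : (k <= K)%nat -> inR m q -> orbit (psik k) q N = Nat.iter k phi q /\
  orbit_factor (Fk k) (psik k) q N = exp (iter_factor g phi k q).
Proof.
  intros Hk Hq. replace N with (k * N0 + (K - k) * N0)%nat by (unfold N; nia). now apply orbit_tail.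
Qed.

Lemma translated_of_critical k w : (k <= K)%nat -> critical n N (Sk k) (Ak k) w ->
  exists q, translated_point n (Nat.iter k phi) q /\ contact_action n (Nat.iter k phi) q = act k w /\
    iter_factor g phi k q = 0 /\
    forall j, (j < N)%nat -> generated n (Sk k j) (Ak k j) (psik k j) (Fk k j) (pt n N (Sk k) w j) (orbit (psik k) q j).
Proof.
  intros Hk Hw.
  destruct (critical_orbit n N (Sk k) (Ak k) (psik k) (Fk k) N_ge1 (chain_k k) w Hw) as [q [Hq [H1 [H2 [H3 H4]]]]].
  destruct (orbit_end k q Hk Hq) as [E1 E2]. rewrite E1 in H1, H3. rewrite E2 in H2.
  assert (G0 : iter_factor g phi k q = 0) by (apply exp_inv; now rewrite H2, exp_0).
  exists q. split; [|split; [|split]]; auto.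
  split; auto. split; auto. exists (iter_factor g phi k). split; auto.
  apply full_conf_conf, iter_conf; auto. apply Hphi.
Qed.

Lemma Sk_cmp k k' j : (k <= k')%nat -> Sk k j = Sk k' j \/ Sk k j = fun _ => 0.
Proof.
  intros Hk. unfold Sk, pad. destruct (Nat.ltb_spec j (k * N0)); [|auto]. left.
  destruct (Nat.ltb_spec j (k' * N0)); [auto | nia].
Qed.

Lemma act_le k k' w : (k <= k')%nat -> act k w <= act k' w.
Proof.
  intros Hk. apply (action_le n N _ _ _ _ _ N_ge1 (chain_k k')). intros j. now apply Sk_cmp.
Qed.

Lemma phi_inj p q : inR m p -> inR m q -> phi p = phi q -> p = q.
Proof.
  intros Hp Hq E. destruct Hphi as [_ [[inv [_ [invl _]]] _]].
  rewrite <- (invl p Hp), <- (invl q Hq). now rewrite E.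
Qed.

Lemma fixed_by_zero_steps q : inR m q -> (forall a, (a < N0)%nat -> St a q = 0) -> phi q = q.
Proof.
  intros Hq Z. rewrite <- Horb by auto.
  assert (Q : forall a, (a <= N0)%nat -> orbit psi q a = q).
  { induction a; intros Ha; simpl; auto. rewrite IHa by lia.
    apply (step_zero n (St a) (A a) (psi a) (F a)); auto. }
  now apply Q.
Qed.

Lemma act_strict k w : (k < K)%nat -> critical n N (Sk k) (Ak k) w -> 0 < act k w -> act k w < act (S k) w.
Proof.
  intros Hk Hw Pos. apply NNPP. intros Neq.
  destruct (translated_of_critical k w ltac:(lia) Hw) as [q [[Hq [Hxy _]] [Hact [_ Hgen]]]].
  set (q' := Nat.iter k phi q) in *.
  assert (Hq' : inR m q') by (apply iter_inR; auto; apply phi_inR).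
  assert (Hh : forall j, (j <= N)%nat -> height n N (Sk k) w j = height n N (Sk (S k)) w j).
  { intros j Hj. apply (height_eq n N (Sk k) (Sk (S k)) _ _ _ N_ge1 (chain_k (S k))); auto.
    intros i. apply Sk_cmp. lia. }
  assert (Z : forall a, (a < N0)%nat -> St a q' = 0).
  { intros a Ha. assert (Hj : (k * N0 + a < N)%nat) by (unfold N; nia).
    assert (E1 := Hh (S (k * N0 + a)) Hj). simpl in E1. rewrite <- Hh in E1 by lia.
    assert (G := Hgen _ Hj). rewrite (proj1 (orbit_tail k a q Hq)) in G. fold q' in G.
    assert (Et : Sk k (k * N0 + a) = fun _ => 0) by (unfold Sk; apply pad_tail).
    assert (Eb : Sk (S k) (k * N0 + a) = St a) by (unfold Sk; apply pad_block; lia).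
    rewrite Et, Eb in E1.
    (* For a trivial step [generated] makes the node equal to the orbit point, which after [k]
       periods is [q']. *)
    replace (node n N w (height n N (Sk k) w (k * N0 + a)) (k * N0 + a)) with q' in E1; [lra|].
    fold (pt n N (Sk k) w (k * N0 + a)).
    unfold Sk, Ak, psik, Fk in G. rewrite !pad_tail in G. fold Sk in G. destruct G as [G1 [G2 _]].
    apply (inR_ext m); auto; [apply node_inR, N_ge1|]. intros i Hi.
    destruct (index_cases n i Hi) as [Hn|[[i' [Hi' ->]]| ->]]; auto.
    - now destruct (G1 i Hn).
    - destruct (G1 i' Hi') as [_ [E _]]. lra. }
  assert (Fix : phi q' = q') by now apply fixed_by_zero_steps.
  (* [phi^k] takes the same value [q'] at [q] and at [q'], and it is injective. Then [q] is fixed by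
     [phi^k] and has action 0, against [Pos]. *)
  assert (q = q').
  { assert (E : Nat.iter k phi q' = q').
    { clearbody q'. clear - Fix. induction k as [|i IH]; simpl; auto. now rewrite IH. }
    assert (Inj : forall i x y, inR m x -> inR m y -> Nat.iter i phi x = Nat.iter i phi y -> x = y).
    { induction i; simpl; intros x y Hx Hy Exy; auto. apply IHi; auto. apply phi_inj; auto; apply iter_inR; auto; apply phi_inR. }
    apply (Inj k); auto. }
  unfold contact_action in Hact. fold q' in Hact. rewrite <- H in Hact. lra.
Qed.

(** The quadratic part vanishes at a constant configuration, so the heights change only by the
    nonnegative [S_j]. Without any growth, every [St a] vanishes at [p], and [p] would be fixed. *)
Lemma act_constant_pos p : inR m p -> phi p <> p -> 0 < act 1 (constant_config n N p (fun i => p (n + i)%nat) (p (2 * n)%nat)).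
Proof.
  intros Hp Hne. set (w := constant_config n N p (fun i => p (n + i)%nat) (p (2 * n)%nat)).
  apply NNPP. intros Neg.
  assert (Hpxi : forall j, (j < N)%nat -> pxi n N w j = 0).
  { intros j Hj. apply fsum_zero. intros i Hi. unfold xi, w, constant_config.
    rewrite !layout_X by (auto using N_ge1, prev_lt). ring. }
  assert (Snn : forall j v, inR m v -> 0 <= Sk 1 j v).
  { intros j v Hv. now apply (step_nonneg _ _ _ _ _ (chain_k 1 j)). }
  assert (Up : forall j i, (j + i <= N)%nat -> height n N (Sk 1) w j <= height n N (Sk 1) w (j + i)).
  { intros j i Hi. induction i; [rewrite Nat.add_0_r; lra|]. rewrite Nat.add_succ_r. simpl.
    rewrite Hpxi by lia. specialize (IHi ltac:(lia)).
    assert (P := Snn (j + i)%nat _ (node_inR n N N_ge1 w (height n N (Sk 1) w (j + i)) (j + i))). lra. }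
  assert (Eq : forall j, (j <= N)%nat -> height n N (Sk 1) w j = p (2 * n)%nat).
  { intros j Hj. assert (U1 := Up 0%nat j ltac:(lia)). assert (U2 := Up j (N - j)%nat ltac:(lia)).
    replace (j + (N - j))%nat with N in U2 by lia. simpl (0 + j)%nat in U1.
    unfold act, action in Neg. fold w in Neg.
    assert (E0 : height n N (Sk 1) w 0 = p (2 * n)%nat) by (simpl; unfold w, constant_config; apply layout_Z, N_ge1).
    rewrite E0 in *. lra. }
  apply Hne. apply fixed_by_zero_steps; auto. intros a Ha.
  assert (HaN : (a < N)%nat) by (unfold N; nia).
  assert (E := Eq (S a) HaN).
  change (height n N (Sk 1) w (S a)) with (height n N (Sk 1) w a + pxi n N w a +
    Sk 1 a (node n N w (height n N (Sk 1) w a) a)) in E.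
  rewrite Eq, Hpxi in E by lia.
  assert (Es : Sk 1 a = St a) by exact (pad_block St (fun _ => 0) 1 0 a Nat.lt_0_1 Ha).
  rewrite Es in E. replace (node n N w (p (2 * n)%nat) a) with p in E; [lra|].
  apply (inR_ext m); auto; [apply node_inR, N_ge1|]. intros i Hi.
  destruct (index_cases n i Hi) as [Hn|[[i' [Hi' ->]]| ->]].
  - rewrite node_x by (auto using N_ge1). symmetry. unfold w, constant_config. apply layout_X; auto; apply N_ge1.
  - rewrite node_p by (auto using N_ge1). symmetry. unfold w, constant_config. apply layout_P; auto; apply N_ge1.
  - apply eq_sym, node_z, N_ge1.
Qed.

Lemma spectrum : (exists p, inR m p /\ phi p <> p) -> exists (c : nat -> R) (q : nat -> nat -> R),
  (forall k, (1 <= k <= K)%nat -> 0 < c k /\ translated_point n (Nat.iter k phi) (q k) /\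
     contact_action n (Nat.iter k phi) (q k) = c k /\ iter_factor g phi k (q k) = 0) /\
  forall k, (1 <= k < K)%nat -> c k < c (S k).
Proof.
  intros [p [Hp Hne]].
  destruct (linking_lower_bound n N (Sk 1) (Ak 1) (psik 1) (Fk 1) N_ge1 (chain_k 1) _ _ _ (act_constant_pos p Hp Hne)) as [d [d0 Hd]].
  (* The positive bound [d] obtained for [act 1] serves every [k], because [act 1 <= act k]. *)
  assert (M : forall k, exists c, (1 <= k)%nat -> minimax n N (act k) c /\ d <= c).
  { intros k. destruct (le_dec 1 k) as [Hk|]; [|exists 0; lia].
    destruct (minimax_exists n N (Sk k) (Ak k) (psik k) (Fk k) N_ge1 (chain_k k) d) as [c Hc]; [|exists c; auto].
    intros M [s [Hs HM]]. apply Hd. exists s. split; auto. intros u Hu. specialize (HM u Hu).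
    assert (L := act_le 1 k (s u) Hk). unfold act in L. lra. }
  set (c := fun k => proj1_sig (constructive_indefinite_description _ (M k))).
  assert (Hc : forall k, (1 <= k)%nat -> minimax n N (act k) (c k) /\ d <= c k).
  { intros k. unfold c. destruct (constructive_indefinite_description _ (M k)) as [x Hx]. exact Hx. }
  assert (Q : forall k, exists q, (1 <= k <= K)%nat -> translated_point n (Nat.iter k phi) q /\
     contact_action n (Nat.iter k phi) q = c k /\ iter_factor g phi k q = 0).
  { intros k. destruct (classic (1 <= k <= K)%nat) as [Hk|]; [|exists (fun _ => 0); tauto].
    destruct (Hc k) as [Hm Hdk]; [lia|].
    destruct (minimax_critical n N (Sk k) (Ak k) (psik k) (Fk k) N_ge1 (chain_k k) (c k)) as [w [Hw Ew]]; [lra | exact Hm |].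
    destruct (translated_of_critical k w ltac:(lia) Hw) as [q [H1 [H2 [H3 _]]]].
    exists q. intros _. repeat split; try apply H1; auto. unfold act in H2. now rewrite H2. }
  exists c, (fun k => proj1_sig (constructive_indefinite_description _ (Q k))). split.
  - intros k Hk. destruct (Hc k) as [_ Hdk]; [lia|]. split; [lra|].
    destruct (constructive_indefinite_description _ (Q k)) as [x Hx]. simpl. auto.
  - intros k Hk. destruct (Hc k) as [Hm Hdk]; [lia|]. destruct (Hc (S k)) as [Hm' _]; [lia|].
    apply (minimax_lt n N (Sk k) (Ak k) (psik k) (Fk k) N_ge1 (chain_k k) (act (S k))); auto; try lra.
    + apply (cont_action n N _ _ _ _ N_ge1 (chain_k (S k))).
    + intros w _. apply act_le. lia.
    + intros w Hw Ew. apply act_strict; auto; [lia|]. unfold act. lra.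
Qed.
End Levels.

(** * Counting translated points *)

Lemma iter_factor_add g phi a b q :
  iter_factor g phi (b + a) q = iter_factor g phi b q + iter_factor g phi a (Nat.iter b phi q).
Proof.
  unfold iter_factor. rewrite fsum_add. f_equal. apply fsum_ext. intros i _. f_equal.
  rewrite Nat.add_comm. apply iter_add_apply.
Qed.

Theorem theorem3p1 (n : nat) (phi : (nat -> R) -> (nat -> R)) :
  contactomorphism n phi ->
  compactly_supported n phi ->
  positive_contactomorphism n phi ->
  (exists p, inR (2 * n + 1) p /\ phi p <> p) ->
  forall L : list (nat -> R), exists q, ~ In q L /\
    exists k : nat, (1 <= k)%nat /\
      translated_point n (Nat.iter k phi) q /\
      contact_action n (Nat.iter k phi) q <> 0.
Proof.
  intros Hphi _ Hpos Hne L. apply NNPP. intros No.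
  assert (InL : forall q k, (1 <= k)%nat -> translated_point n (Nat.iter k phi) q ->
     contact_action n (Nat.iter k phi) q <> 0 -> In q L).
  { intros q k Hk Ht Ha. apply NNPP. intros NI. apply No. exists q. split; auto. exists k; auto. }
  destruct (step_decomposition n phi Hpos) as [N0 [St [A [psi [F [HN0 [Hch [Horb Hfac]]]]]]]].
  assert (Hc := Hphi). destruct Hc as [Hsm [_ [g [_ Hg]]]].
  (* One more than the number of pairs made of an element of [L] and either an element of [L] or
     [None]. *)
  set (K := S (length L * S (length L))).
  destruct (spectrum n phi g N0 K St A psi F Hphi Hg HN0 ltac:(unfold K; lia) Hch Horb
    (fun q => Hfac g q Hg) Hne) as [c [q [Hq Hc]]].
  assert (Hlt : forall k l, (1 <= k)%nat -> (k < l <= K)%nat -> c k < c l).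
  { intros k l Hk Hl. induction l; [lia|]. destruct (Nat.eq_dec k l) as [->|]; [apply Hc; lia|].
    apply (Rlt_trans _ (c l)); [apply IHl; lia | apply Hc; lia]. }
  (* [phi^k (q k)] is known to lie in [L] only if [q k] serves a later index too; the second entry
     of [f] is [None] otherwise. If [f k = f l] with [k < l], then [q k] recurs, so both entries are
     points, and comparing their heights gives [c k = c l]. *)
  set (again := fun k => exists l, (k < l <= K)%nat /\ q l = q k).
  set (f := fun k => (q k, if excluded_middle_informative (again k) then Some (Nat.iter k phi (q k)) else None)).
  assert (height_q : forall k, (1 <= k <= K)%nat -> Nat.iter k phi (q k) (2 * n)%nat = q k (2 * n)%nat + c k).
  { intros k Hk. destruct (Hq k Hk) as [_ [_ [E _]]]. unfold contact_action in E. lra. }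
  assert (inj : forall k l, (1 <= k)%nat -> (k < l <= K)%nat -> f k <> f l).
  { intros k l Hk Hl E. unfold f in E. injection E as E1 E2.
    destruct (excluded_middle_informative (again k)) as [Ak|NAk].
    2:{ apply NAk. exists l. auto. }
    destruct (excluded_middle_informative (again l)) as [Al|NAl]; [|discriminate].
    injection E2 as E2. assert (E3 := f_equal (fun v => v (2 * n)%nat) E2). simpl in E3.
    change (n + (n + 0))%nat with (2 * n)%nat in E3.
    rewrite !height_q, E1 in E3 by lia. specialize (Hlt k l Hk Hl). lra. }
  assert (incl_f : incl (map f (seq 1 K)) (list_prod L (None :: map Some L))).
  { intros x Hx. apply in_map_iff in Hx. destruct Hx as [k [<- Hk]]. apply in_seq in Hk.
    assert (Hk' : (1 <= k <= K)%nat) by lia. destruct (Hq k Hk') as [c0 [T [Ea Ef]]].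
    unfold f. apply in_prod.
    - apply (InL _ k); [lia | auto |]. lra.
    - destruct (excluded_middle_informative (again k)) as [[l [Hl El]]|]; [right | now left].
      apply in_map. destruct (Hq l ltac:(lia)) as [_ [Tl [Eal Efl]]]. rewrite El in Tl, Eal, Efl.
      assert (It : Nat.iter (l - k) phi (Nat.iter k phi (q k)) = Nat.iter l phi (q k)).
      { rewrite <- iter_add_apply. f_equal. lia. }
      destruct T as [T1 [T2 _]]. destruct Tl as [_ [Tl2 _]].
      apply (InL _ (l - k)%nat); [lia | |].
      + split; [|split].
        * apply iter_inR; auto. apply Hsm.
        * intros i Hi. rewrite It, Tl2, T2; auto.
        * exists (iter_factor g phi (l - k)). split; [now apply full_conf_conf, iter_conf|].
          assert (E := iter_factor_add g phi (l - k) k (q k)).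
          replace (k + (l - k))%nat with l in E by lia. lra.
      + unfold contact_action in *. rewrite It. specialize (Hlt k l ltac:(lia) ltac:(lia)). lra. }
  assert (nd : NoDup (map f (seq 1 K))).
  { apply NoDup_map_NoDup_ForallPairs; [|apply seq_NoDup]. intros k l Hk Hl E.
    apply in_seq in Hk. apply in_seq in Hl. destruct (lt_eq_lt_dec k l) as [[H|H]|H]; auto; exfalso.
    - apply (inj k l); auto; lia.
    - apply (inj l k); auto; lia. }
  assert (len := NoDup_incl_length nd incl_f).
  rewrite length_map, length_seq, length_prod in len. simpl in len. rewrite length_map in len.
  unfold K in len. lia.
Qed.
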